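(* Let $(Z,\mathcal F)$ be a foliated manifold and let $i_F:F\to Z$ be a leaf of $\mathcal F$. Then the pull-back cochain morphism $i_F^*:(\mathbb R,\mathcal O^*(Z),d)\to(\mathbb R,\mathcal O^*(F),d)$ from the de Rham complex of $Z$ to the de Rham complex of $F$ factorizes through the cochain morphism $i^*_{\mathcal F}:(\mathbb R,\mathcal O^*(Z),d)\to(S_{\mathcal F}(Z),\mathfrak F^*(Z),\tilde d)$ to the leafwise de Rham complex; i.e. it is the composition of $i^*_{\mathcal F}$ with a cochain morphism $(S_{\mathcal F}(Z),\mathfrak F^*(Z),\tilde d)\to(\mathbb R,\mathcal O^*(F),d)$. Accordingly, the induced homomorphism of de Rham cohomology $H^*(Z)\to H^*(F)$ factorizes through the homomorphism $[i^*_{\mathcal F}]:H^*(Z)\to H^*_{\mathcal F}(Z)$ to the leafwise de Rham cohomology: $$H^*(Z)\xrightarrow{[i^*_{\mathcal F}]}H^*_{\mathcal F}(Z)\longrightarrow H^*(F).$$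
   Context: Manifolds are smooth, Hausdorff, second-countable and connected. A (regular) foliation $\mathcal F$ of $Z$ consists of the maximal integral manifolds (leaves) of an involutive distribution $i_{\mathcal F}:T\mathcal F\to TZ$; leaves are injectively immersed submanifolds. $S_{\mathcal F}(Z)\subset C^\infty(Z)$ is the ring of smooth real functions constant on the leaves. Leafwise $r$-forms are the global sections of $\bigwedge^r T\mathcal F^*\to Z$, where $T\mathcal F^*$ is the dual bundle of $T\mathcal F$; they form $\mathfrak F^r(Z)$, with $\mathfrak F^0(Z)=C^\infty(Z)$. The leafwise exterior differential $\tilde d:\mathfrak F^r(Z)\to\mathfrak F^{r+1}(Z)$ is the Chevalley–Eilenberg differential of the Lie algebra $\mathcal T_1(\mathcal F)$ of global sections of $T\mathcal F$ with coefficients in $C^\infty(Z)$; in coordinates $(z^\lambda;z^i)$ adapted to the foliation (leaves locally given by $z^\lambda=\mathrm{const}$), $\tilde d\phi=\tilde dz^k\wedge\partial_k\phi$, where $\{\tilde dz^i\}$ is the dual of the basis $\{\partial_i\}$ of $T\mathcal F$. The leafwise de Rham complex is $$0\to S_{\mathcal F}(Z)\to C^\infty(Z)\xrightarrow{\tilde d}\mathfrak F^1(Z)\xrightarrow{\tilde d}\cdots\xrightarrow{\tilde d}\mathfrak F^{\dim\mathcal F}(Z)\to0,$$ and its cohomology $H^*_{\mathcal F}(Z)$ is the leafwise de Rham cohomology. $\mathcal O^*(Z)$ is the graded algebra of exterior forms on $Z$, and $H^*(Z)$ its de Rham cohomology. The bundle epimorphism $i^*_{\mathcal F}:T^*Z\to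 T\mathcal F^*$ dual to $i_{\mathcal F}$ induces an epimorphism $\mathcal O^*(Z)\to\mathfrak F^*(Z)$ with $dz^\lambda\mapsto0$, $dz^i\mapsto\tilde dz^i$ and $i^*_{\mathcal F}\circ d=\tilde d\circ i^*_{\mathcal F}$; this is the cochain morphism $i^*_{\mathcal F}$. *)

(* Defs.v *)
From HB Require Import structures.
From mathcomp Require Import all_boot all_order all_algebra.
From mathcomp Require Import all_classical all_reals all_analysis.

Set Implicit Arguments.
Unset Strict Implicit.
Unset Printing Implicit Defensive.

Import Order.TTheory GRing.Theory Num.Theory.
Import numFieldNormedType.Exports.

Local Open Scope classical_set_scope.
Local Open Scope ring_scope.

Fixpoint C_on (R : realType) (n k : nat) (U : set 'rV[R]_n)
    (f : 'rV[R]_n -> R) {struct k} : Prop :=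
  (forall x, U x -> {for x, continuous f}) /\
  if k is k'.+1 then
    forall j : 'I_n,
      (forall x, U x -> derivable f x (delta_mx 0 j)) /\
      C_on k' U (fun x => 'D_(delta_mx 0 j) f x)
  else True.

Definition smooth_on (R : realType) (n : nat) (U : set 'rV[R]_n)
    (f : 'rV[R]_n -> R) : Prop :=
  forall k, C_on k U f.

Definition smooth_map_on (R : realType) (n m : nat) (U : set 'rV[R]_n)
    (g : 'rV[R]_n -> 'rV[R]_m) : Prop :=
  forall j : 'I_m, smooth_on U (fun x => g x 0 j).

(* A chart is a total map [fwd] together with a total inverse [bwd]; only the
   values of [fwd] on [dom] and of [bwd] on [fwd @` dom] are meaningful. *)
Record chart (R : realType) (M : topologicalType) (n : nat) := Chart {
  dom : set M;
  fwd : M -> 'rV[R]_n;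
  bwd : 'rV[R]_n -> M }.

Definition is_chart (R : realType) (M : topologicalType) (n : nat)
    (c : chart R M n) : Prop :=
  [/\ open (dom c),
      open (fwd c @` dom c),
      forall p, dom c p -> bwd c (fwd c p) = p,
      forall p, dom c p -> {for p, continuous (fwd c)} &
      forall x, (fwd c @` dom c) x -> {for x, continuous (bwd c)}].

(* The atlas need not be maximal.  [chart_at p] is a preferred chart around
   [p]; it serves to represent tangent vectors at [p] by their coordinates.
   [connected] holds of the empty set in the library, whence
   [manifold_nonempty]. *)
Record manifold (R : realType) (n : nat) := Manifold {
  carrier :> topologicalType;
  atlas : set (chart R carrier n);
  chart_at : carrier -> chart R carrier n;
  manifold_hausdorff : hausdorff_space carrier;
  manifold_second_countable : @second_countable carrier;
  manifold_connected : connected [set: carrier];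
  manifold_nonempty : [set: carrier] !=set0;
  atlas_chart : forall c, atlas c -> is_chart c;
  atlas_compatible : forall c c', atlas c -> atlas c' ->
    smooth_map_on (fwd c @` (dom c `&` dom c')) (fwd c' \o bwd c);
  chart_at_atlas : forall p, atlas (chart_at p);
  chart_at_dom : forall p, dom (chart_at p) p }.

Arguments atlas {R n}.
Arguments chart_at {R n m} : rename.

Section Calculus.
Context (R : realType) (n : nat) (M : manifold R n).

Definition smooth_fun_on (U : set M) (f : M -> R) : Prop :=
  forall c, atlas M c -> smooth_on (fwd c @` (dom c `&` U)) (f \o bwd c).

(* The tangent space at [p] is ['rV[R]_n]: a tangent vector is given by its
   components in the preferred chart [chart_at p].  [tcoord c p v] are the
   components of the same tangent vector in the chart [c]. *)
Definition tcoord (c : chart R M n) (p : M) (v : 'rV[R]_n) : 'rV[R]_n :=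
  'D_v (fwd c \o bwd (chart_at p)) (fwd (chart_at p) p).

Definition vfield : Type := M -> 'rV[R]_n.

Definition vrep (c : chart R M n) (X : vfield) (x : 'rV[R]_n) : 'rV[R]_n :=
  tcoord c (bwd c x) (X (bwd c x)).

Definition smooth_vfield_on (U : set M) (X : vfield) : Prop :=
  forall c, atlas M c -> smooth_map_on (fwd c @` (dom c `&` U)) (vrep c X).

Definition vderiv (X : vfield) (f : M -> R) (p : M) : R :=
  'D_(X p) (f \o bwd (chart_at p)) (fwd (chart_at p) p).

(* [X, Y]^k = X^j d_j Y^k - Y^j d_j X^k, computed at [p] in [chart_at p] *)
Definition lie (X Y : vfield) : vfield := fun p =>
  let c := chart_at p in
  'D_(X p) (vrep c Y) (fwd c p) - 'D_(Y p) (vrep c X) (fwd c p).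

Definition section_on (E : M -> {vspace 'rV[R]_n}) (U : set M) (X : vfield)
    : Prop :=
  smooth_vfield_on U X /\ forall p, U p -> X p \in E p.

Definition global_section (E : M -> {vspace 'rV[R]_n}) (X : vfield) : Prop :=
  section_on E setT X.

Definition cochain (r : nat) : Type := M -> ('I_r -> 'rV[R]_n) -> R.

(* Smooth sections of the r-th exterior power of the dual of a subbundle [E] of
   the tangent bundle.  The value at [p] is an alternating multilinear form on
   [E p]; as a total function it is extended by 0 outside [E p], so that two
   such sections are equal iff they agree on [E].  For [E = fun=> fullv] these
   are the exterior r-forms on [M]. *)
Definition forms (E : M -> {vspace 'rV[R]_n}) (r : nat) : set (cochain r) :=
  [set phi |
    [/\ forall p v i, v i \notin E p -> phi p v = 0,
        forall p v i (a : R) u w,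
          (forall j, v j \in E p) -> u \in E p -> w \in E p ->
          phi p [eta v with i |-> a *: u + w] =
          a * phi p [eta v with i |-> u] + phi p [eta v with i |-> w],
        forall p v i j, i != j -> v i = v j -> phi p v = 0 &
        forall (U : set M) (X : 'I_r -> vfield), open U ->
          (forall i, section_on E U (X i)) ->
          smooth_fun_on U (fun p => phi p (fun i => X i p))]].

(* Chevalley-Eilenberg formula:
     sum_i (-1)^i X_i (phi (X_0, .., ^X_i, .., X_r))
     + sum_(i < j) (-1)^(i+j) phi ([X_i, X_j], X_0, .., ^X_i, .., ^X_j, .., X_r)
   where [bump j (bump i _)] enumerates, in order, the indices other than
   [i < j]. *)
Definition chevalley_eilenberg (r : nat) (phi : cochain r)
    (X : 'I_r.+1 -> vfield) (p : M) : R :=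
  \sum_(i < r.+1) (-1) ^+ i *
    vderiv (X i) (fun q => phi q (fun m => X (lift i m) q)) p
  + \sum_(i < r.+1) \sum_(j < r.+1 | (i < j)%N) (-1) ^+ (i + j) *
    phi p (fun m : 'I_r =>
             if m == 0%N :> nat then lie (X i) (X j) p
             else X (inord (bump j (bump i m.-1))) p).

(* The differential of [phi] is the (unique) form taking the Chevalley-Eilenberg
   value on global sections of [E]; [xget] makes it a total function. *)
Definition ce_diff (E : M -> {vspace 'rV[R]_n}) (r : nat) (phi : cochain r)
    : cochain r.+1 :=
  xget (0 : cochain r.+1) [set psi | forms E psi /\
    forall X : 'I_r.+1 -> vfield, (forall i, global_section E (X i)) ->
    forall p, psi p (fun i => X i p) = chevalley_eilenberg phi X p].

End Calculus.

Record foliation (R : realType) (n : nat) (Z : manifold R n) (k : nat) :=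
  Foliation {
    tfol :> Z -> {vspace 'rV[R]_n};
    tfol_rank : forall p, \dim (tfol p) = k;
    tfol_smooth : forall p : Z, exists (U : set Z) (X : 'I_k -> vfield Z),
      [/\ open U, U p, forall i, section_on tfol U (X i) &
          forall q, U q -> (tfol q = <<[seq X i q | i : 'I_k]>>)%VS];
    tfol_involutive : forall X Y,
      global_section tfol X -> global_section tfol Y ->
      global_section tfol (lie X Y) }.

Section Maps.
Context (R : realType) (m n : nat) (N : manifold R m) (Z : manifold R n).

Definition smooth_map (f : N -> Z) : Prop :=
  continuous f /\
  forall c c', atlas N c -> atlas Z c' ->
    smooth_map_on (fwd c @` (dom c `&` f @^-1` dom c'))
                  (fwd c' \o f \o bwd c).

Definition tmap (f : N -> Z) (q : N) (v : 'rV[R]_m) : 'rV[R]_n :=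
  'D_v (fwd (chart_at (f q)) \o f \o bwd (chart_at q)) (fwd (chart_at q) q).

End Maps.

Section Leaves.
Context (R : realType) (n k : nat) (Z : manifold R n) (D : foliation Z k).

Definition integral_manifold (N : manifold R k) (j : N -> Z) : Prop :=
  [/\ smooth_map j, injective j, forall q, injective (tmap j q) &
      forall q, range (tmap j q) = [set w | w \in D (j q)]].

Definition is_leaf (F : manifold R k) (i : F -> Z) : Prop :=
  integral_manifold i /\
  forall (N : manifold R k) (j : N -> Z),
    integral_manifold j -> range i `<=` range j -> range j = range i.

(* S_F(Z) *)
Definition leafwise_constant : set (Z -> R) :=
  [set f | smooth_fun_on setT f /\
    forall (F : manifold R k) (i : F -> Z), is_leaf i ->
    forall a b, f (i a) = f (i b)].

End Leaves.

Definition linear_on (R : realType) (V W : lmodType R) (S : set V)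
    (f : V -> W) : Prop :=
  forall (a : R) x y, S x -> S y -> f (a *: x + y) = a *: f x + f y.

(* An augmented sequence  A -> C^0 -> C^1 -> ...  whose terms are the subsets
   [caug] and [cterm r] of ambient real vector spaces. *)
Record complex (R : realType) := Complex {
  cspace : nat -> lmodType R;
  cterm : forall r, set (cspace r);
  cdiff : forall r, cspace r -> cspace r.+1;
  caspace : lmodType R;
  caug : set caspace;
  ceps : caspace -> cspace 0 }.

Arguments cterm {R}.
Arguments cdiff {R}.
Arguments caug {R}.
Arguments ceps {R}.

Record cmap (R : realType) (K L : complex R) := CMap {
  cmor :> forall r, cspace K r -> cspace L r;
  cmor_aug : caspace K -> caspace L }.

Section Complexes.
Context (R : realType).

Definition cochain_morphism (K L : complex R) (f : cmap K L) : Prop :=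
  [/\ forall r x, cterm K r x -> cterm L r (f r x),
      forall r, linear_on (cterm K r) (@f r),
      forall r x, cterm K r x -> f r.+1 (cdiff K r x) = cdiff L r (f r x) &
      [/\ forall s, caug K s -> caug L (cmor_aug f s),
          linear_on (caug K) (cmor_aug f) &
          forall s, caug K s -> f 0%N (ceps K s) = ceps L (cmor_aug f s)]].

Definition cmap_comp (K L P : complex R) (g : cmap L P) (f : cmap K L)
    : cmap K P :=
  CMap (fun r x => g r (f r x)) (fun s => cmor_aug g (cmor_aug f s)).

Definition cmap_eq (K L : complex R) (f g : cmap K L) : Prop :=
  (forall r x, cterm K r x -> f r x = g r x) /\
  (forall s, caug K s -> cmor_aug f s = cmor_aug g s).

Definition cocycles (K : complex R) r : set (cspace K r) :=
  [set x | cterm K r x /\ cdiff K r x = 0].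

Definition coboundaries (K : complex R) r : set (cspace K r) :=
  if r is r'.+1 then cdiff K r' @` cterm K r' else [set 0].

Arguments cocycles : clear implicits.
Arguments coboundaries : clear implicits.

(* H^r, as the set of cosets of the coboundaries in the cocycles; in degree 0
   it is the kernel of the differential (the augmentation is not quotiented
   out). *)
Definition cohomology (K : complex R) r : set (set (cspace K r)) :=
  [set [set x + b | b in coboundaries K r] | x in cocycles K r].

Arguments cohomology : clear implicits.

(* the coset a A + B *)
Definition lincomb (V : lmodType R) (a : R) (A B : set V) : set V :=
  [set a *: x + y | x in A & y in B].

(* the map  [x] |-> [f x]  on cosets *)
Definition cohom_map (K L : complex R) (f : cmap K L) r
    (A : set (cspace K r)) : set (cspace L r) :=
  [set f r x + b | x in A & b in coboundaries L r].

Definition cohom_homomorphism (K L : complex R)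
    (h : forall r, set (cspace K r) -> set (cspace L r)) : Prop :=
  forall r,
    (forall A, cohomology K r A -> cohomology L r (h r A)) /\
    (forall (a : R) A B, cohomology K r A -> cohomology K r B ->
       h r (lincomb a A B) = lincomb a (h r A) (h r B)).

End Complexes.

Arguments cohomology {R}.
Arguments cohom_map {R K L} f r A.

Definition deRham (R : realType) (n : nat) (M : manifold R n) : complex R :=
  @Complex R (fun r => cochain M r : lmodType R)
    (@forms R n M (fun=> fullv)) (@ce_diff R n M (fun=> fullv))
    (R^o : lmodType R) setT (fun c _ _ => c).

Section Leafwise.
Context (R : realType) (n k : nat) (Z : manifold R n) (D : foliation Z k).

Definition leafwise_deRham : complex R :=
  @Complex R (fun r => cochain Z r : lmodType R)
    (forms D) (ce_diff D)
    ((Z -> R) : lmodType R) (leafwise_constant D) (fun f p _ => f p).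

Definition leafwise_restriction : cmap (deRham Z) leafwise_deRham :=
  @CMap R (deRham Z) leafwise_deRham
    (fun r (omega : cochain Z r) p v =>
       if [forall i, v i \in D p] then omega p v else 0)
    (fun (c : R) _ => c).

Definition pullback (F : manifold R k) (i : F -> Z)
    : cmap (deRham Z) (deRham F) :=
  @CMap R (deRham Z) (deRham F)
    (fun r (omega : cochain Z r) q v => omega (i q) (fun m => tmap i q (v m)))
    id.

End Leafwise.

(* Main.v *)
From HB Require Import structures.
Require Import Defs.
From mathcomp Require Import all_boot all_order all_algebra.
From mathcomp Require Import all_classical all_reals all_analysis.
From mathcomp Require Import perm ring lra zify.

(* A tangent vector is used only through its action as a derivation on germs of
   smooth functions.  The chain rule and Schwarz's theorem show that a bracket
   acts as the commutator and that the tangent map of i acts by composition with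
   i; after that, charts play no role.

   For an involutive subbundle E of the tangent bundle, the Chevalley-Eilenberg
   expression is additive and alternating in its arguments and homogeneous over
   smooth functions in the first one, hence in all of them; so it depends only on
   the values of the fields at the point and defines a form.  Bump functions,
   built from exp (-1/t), extend germs of sections of E to global sections, which
   makes that form the unique one taking the prescribed values.

   The tangent map of the leaf i : F -> Z takes its values in the distribution,
   so phi |-> phi (Ti _, .., Ti _) is defined on leafwise forms, and i^* is its
   composite with the restriction to the distribution.  It commutes with the
   differentials because a section Y of the distribution restricts to a smooth
   field on F (Cramer's rule) which is i-related to Y, and the Chevalley-Eilenberg
   expression is natural for i-related fields. *)

Set Implicit Arguments.
Unset Strict Implicit.
Unset Printing Implicit Defensive.
Import Order.TTheory GRing.Theory Num.Theory.
Import numFieldNormedType.Exports.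

Local Open Scope classical_set_scope.
Local Open Scope ring_scope.
(** * Calculus in row vector spaces *)

(** A tangent vector at [p] is stored by its components in [chart_at p], and [chart_at] depends on
    [p] without any continuity. The components of a smooth field therefore need not be smooth
    functions of the point, whereas the functions [dv q (X q) f] are; this is what forces the
    language of derivations. [ce_diff] is picked by [xget], so nothing can be said about it before
    such a form is known to exist; afterwards every commutation with the differentials is a
    comparison of Chevalley-Eilenberg values on global sections. On the leaf an arbitrary field need
    not come from a section of the distribution, since a leaf is only immersed. But values are
    compared at one point at a time, and there tensoriality lets the given fields be replaced by
    fields related to sections. On the augmentation terms the factor evaluates a leafwise constant
    function at a point of the leaf; this is where being a leaf enters. *)

Lemma near_forall (T : topologicalType) (I : finType) (P : I -> T -> Prop) (x : T) :
  (forall i, \forall y \near x, P i y) -> \forall y \near x, forall i, P i y.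
Proof. exact: (@filter_forall _ _ P _ (nbhs_filter x)). Qed.

Section Germs.
Context (R : realType) (n : nat).
Implicit Types (f g : 'rV[R]_n -> R) (x y v : 'rV[R]_n) (k : nat).

(** [C_on] on a singleton constrains the derivatives at one point only. Asking for it at all nearby
    points gives a property of the germ, which can be differentiated. *)
Definition C_germ k x f : Prop := \forall y \near x, C_on k [set y] f.

(** One neighbourhood serves all orders [k]; this is what smoothness on an open set provides at each
    of its points. *)
Definition smooth_at x f : Prop := \forall y \near x, smooth_on [set y] f.

(** Derivatives are taken in the ambient space, so the set only records where the conditions are
    checked. *)
Lemma C_onP k (U : set 'rV[R]_n) f :
  C_on k U f <-> forall x, U x -> C_on k [set x] f.
Proof.
elim: k U f => [|k IH] U f /=.
  split=> [[Uf _] x Ux|Uf]; split=> // y; first by move=> ->; exact: Uf.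
  by move=> /Uf[/(_ y erefl)].
split=> [[Uf Df] x Ux|Uf].
  split=> [y ->|j]; first exact: Uf.
  by split=> [y ->|]; [exact: (Df j).1|apply: (IH _ _).1 (Df j).2 _ Ux].
split=> [x /Uf[/(_ x erefl)]//|j]; split=> [x /Uf[_ /(_ j)[/(_ x erefl)]]//|].
by apply/IH => x /Uf[_ /(_ j)[]].
Qed.

Lemma smooth_onP (U : set 'rV[R]_n) f :
  smooth_on U f <-> forall x, U x -> smooth_on [set x] f.
Proof.
split=> [Uf x Ux k|Uf k]; first exact: (C_onP _ _ _).1 (Uf k) _ Ux.
by apply/C_onP => x Ux; exact: Uf.
Qed.

Lemma C_on_pred k (U : set 'rV[R]_n) f : C_on k.+1 U f -> C_on k U f.
Proof.
elim: k f => [|k IH] f [fc Df] /=; first by split.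
by split=> // j; split; [exact: (Df j).1|exact/IH/(Df j).2].
Qed.

Lemma C_on_le k l (U : set 'rV[R]_n) f : (k <= l)%N -> C_on l U f -> C_on k U f.
Proof.
by move=> kl; rewrite -(subnK kl); elim: (l - k)%N => // m IH /C_on_pred.
Qed.

Lemma C_germ_pred k x f : C_germ k.+1 x f -> C_germ k x f.
Proof. by apply: filterS => y /C_on_pred. Qed.

Lemma C_germ_le k l x f : (k <= l)%N -> C_germ l x f -> C_germ k x f.
Proof. by move=> kl; apply: filterS => y /(C_on_le kl). Qed.

Lemma C_germ_near k x f : C_germ k x f -> \forall y \near x, C_germ k y f.
Proof. exact: near_join. Qed.

Lemma C_germS k x f : C_germ k.+1 x f <->
  (\forall y \near x, {for y, continuous f} /\
     forall j, derivable f y (delta_mx 0 j)) /\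
  forall j, C_germ k x (fun y => 'D_(delta_mx 0 j) f y).
Proof.
split=> [fk|[f1 Df]].
  split; last by move=> j; apply: filterS fk => y [_ /(_ j)[]].
  by apply: filterS fk => y [/(_ y erefl)? Df]; split=> // j; case: (Df j) => /(_ y erefl).
have {}Df : \forall y \near x, forall j : 'I_n, C_on k [set y] ('D_(delta_mx 0 j) f).
  exact: near_forall.
apply: filterS2 f1 Df => y [fc fd] fk.
by split=> [_ -> //|j]; split=> // _ ->.
Qed.

Lemma C_germ_continuous k x f : C_germ k x f -> {for x, continuous f}.
Proof. by move=> /nbhs_singleton; case: k => [|k] [/(_ x erefl)]. Qed.

Lemma near_eq_continuous_at (V W : topologicalType) (f g : V -> W) (x : V) :
  (\forall y \near x, f y = g y) -> {for x, continuous f} -> {for x, continuous g}.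
Proof.
move=> fg fc; rewrite /prop_for /continuous_at -(nbhs_singleton fg).
apply: cvg_trans fc; apply: near_eq_cvg; exact: fg.
Qed.

Lemma near_eq_C_germ k x f g :
  (\forall y \near x, f y = g y) -> C_germ k x f -> C_germ k x g.
Proof.
elim: k x f g => [|k IH] x f g fg.
  apply: filterS2 (near_join fg) => y fgy [/(_ y erefl) fc _]; split=> // _ ->.
  exact: near_eq_continuous_at fc.
move=> /C_germS[f1 Df]; apply/C_germS; split.
  apply: filterS2 (near_join fg) f1 => y fgy [fc fd]; split.
    exact: near_eq_continuous_at fc.
  by move=> j; apply: near_eq_derivable (fd j).
move=> j; apply: IH (Df j).
by apply: filterS (near_join fg) => y fgy; apply: near_eq_derive.
Qed.

Lemma smooth_atP x f :
  smooth_at x f <-> \forall y \near x, forall k, C_germ k y f.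
Proof.
split=> [/near_join fx|fx]; apply: filterS fx => y fy k; last first.
  exact: nbhs_singleton (fy k).
by apply: filterS fy => z; exact.
Qed.

Lemma smooth_at_C_germ k x f : smooth_at x f -> C_germ k x f.
Proof. by move=> /smooth_atP/nbhs_singleton. Qed.

Lemma smooth_at_near x f : smooth_at x f -> \forall y \near x, smooth_at y f.
Proof. exact: near_join. Qed.

Lemma smooth_at_continuous x f : smooth_at x f -> {for x, continuous f}.
Proof. by move=> /(smooth_at_C_germ 0)/C_germ_continuous. Qed.

Lemma near_eq_smooth_at x f g :
  (\forall y \near x, f y = g y) -> smooth_at x f -> smooth_at x g.
Proof.
move=> fg /smooth_atP fx; apply/smooth_atP.
by apply: filterS2 (near_join fg) fx => y fgy fy k; apply: near_eq_C_germ (fy k).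
Qed.

(** The passage from the given notion of smoothness to germs. It needs an open set, hence the lemmas
    on openness of chart images. *)
Lemma smooth_on_open (U : set 'rV[R]_n) f : open U ->
  smooth_on U f <-> forall x, U x -> smooth_at x f.
Proof.
move=> oU; split=> [/smooth_onP Uf x Ux|Uf].
  by apply: filterS (open_nbhs_nbhs (conj oU Ux)) => y; exact: Uf.
by apply/smooth_onP => x /Uf/nbhs_singleton.
Qed.

Lemma smooth_at_derive j x f :
  smooth_at x f -> smooth_at x (fun y => 'D_(delta_mx 0 j) f y).
Proof.
move=> /smooth_atP fx; apply/smooth_atP; apply: filterS fx => y fy k.
by have /C_germS[_] := fy k.+1.
Qed.

End Germs.

(** * Directional derivatives along a line *)

Section DirectionalDerivative.
Context (R : realType) (V : normedModType R).
Implicit Types (f : V -> R) (a v x : V).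

Lemma is_derive_line f a v (t : R) : derivable f (t *: v + a) v ->
  is_derive t 1 (fun s : R => f (s *: v + a)) ('D_v f (t *: v + a)).
Proof.
suff E h : h^-1 *: (f (h *: v + (t *: v + a)) - f (t *: v + a)) =
    h^-1 *: (((fun s : R => f (s *: v + a)) \o shift t) (h *: (1 : R)) - f (t *: v + a)).
  move=> df; apply: DeriveDef; rewrite /derivable /derive.
    by move: df; rewrite /derivable; under eq_fun do rewrite E.
  by under eq_fun do rewrite -E.
by rewrite /= [h *: 1]mulr1 scalerDl addrA.
Qed.

Lemma mean_value f a v : (forall t : R, 0 <= t <= 1 -> derivable f (t *: v + a) v) ->
  exists2 t : R, 0 <= t <= 1 & f (v + a) - f a = 'D_v f (t *: v + a).
Proof.
move=> df; pose g (t : R) := f (t *: v + a).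
have dg (t : R) : 0 <= t <= 1 -> is_derive t 1 g ('D_v f (t *: v + a)).
  by move=> t01; apply: is_derive_line; exact: df.
have [||t t01 E] := @MVT_segment R g (fun t => 'D_v f (t *: v + a)) 0 1 ler01.
- by move=> t /[!in_itv]/= /andP[t0 t1]; apply: dg; rewrite !ltW.
- apply: derivable_within_continuous => t /[!in_itv]/= /dg tg; exact: ex_derive.
exists t; first by move: t01; rewrite in_itv.
by move: E; rewrite /g scale1r scale0r add0r subr0 mulr1.
Qed.

(** Only derivability along [v] is known. Restriction to the line through [x] reduces this to one
    variable, where derivable means differentiable and homogeneity is that of the differential. *)
Lemma is_derive_scale f x v (s : R) : derivable f x v ->
  is_derive x (s *: v) f (s * 'D_v f x).
Proof.
move=> df; pose g (t : R) := f (t *: v + x).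
have dg : is_derive (0 : R) (1 : R) g ('D_v f x).
  by have := @is_derive_line f x v 0; rewrite scale0r add0r; exact.
have gd : differentiable g 0 by apply/derivable1_diffP; exact: ex_derive.
have sd : is_derive (0 : R) s g (s * 'D_v f x).
  apply: DeriveDef; first exact: diff_derivable.
  rewrite deriveE// -[X in 'd g 0 X = _]mulr1 -/(s *: (1 : R)) linearZ/=.
  by rewrite -deriveE// derive_val.
have E h : h^-1 *: (f (h *: (s *: v) + x) - f x) =
    h^-1 *: ((g \o shift 0) (h *: s) - g 0).
  by rewrite /= /g scale0r add0r addr0 scalerA.
case: sd => sd1 sd2; apply: DeriveDef.
  by move: sd1; rewrite /derivable; under eq_fun do rewrite -E.
by rewrite -sd2 /derive; under eq_fun do rewrite E.
Qed.

End DirectionalDerivative.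
Lemma differentiable_approx (R : realType) (V W : normedModType R) (f : V -> W)
    (x : V) (L : {linear V -> W}) : continuous L ->
  (forall e : R, 0 < e ->
     \forall h \near 0, `|f (h + x) - f x - L h| <= e * `|h|) ->
  differentiable f x /\ 'd f x = L :> (V -> W).
Proof.
move=> Lc fe.
have fL : f \o shift x = cst (f x) + L +o_ 0 id.
  apply/eqaddoP => _/posnumP[e]; apply: filterS (fe e%:num _) => // h.
  by rewrite !fctE /= opprD addrA.
have dE : 'd f x = L :> (_ -> _) by apply: diff_unique.
by split=> //; apply/diff_locallyP; rewrite dE.
Qed.

(** * Continuous partial derivatives imply differentiability *)

Section ContinuouslyDifferentiable.
Context (R : realType) (n : nat).
Implicit Types (f g : 'rV[R]_n -> R) (x y v h : 'rV[R]_n).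

Lemma rV_norm_le (a : 'rV[R]_n) (c : R) :
  0 <= c -> (forall j, `|a 0 j| <= c) -> `|a| <= c.
Proof.
move=> c0 ac; rewrite /Num.Def.normr/= mx_normrE; apply: bigmax_le => // -[i j] _.
by rewrite ord1.
Qed.

Lemma coord_norm_le (a : 'rV[R]_n) j : `|a 0 j| <= `|a|.
Proof.
by rewrite [leRHS]/Num.Def.normr/= mx_normrE; exact: (le_bigmax _ _ (0, j)).
Qed.

(** The corners of a path from 0 to [h] that moves along one coordinate axis at a time. *)
Definition rV_trunc (m : nat) (h : 'rV[R]_n) : 'rV[R]_n :=
  \row_j (if (j < m)%N then h 0 j else 0).

Lemma rV_truncS (h : 'rV[R]_n) (m : 'I_n) :
  rV_trunc m.+1 h = h 0 m *: delta_mx 0 m + rV_trunc m h.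
Proof.
apply/rowP => j; rewrite !mxE eqxx /= ltnS leq_eqVlt -val_eqE /=.
case: (ltngtP j m) => [||/val_inj ->]; rewrite ?mulr0 ?add0r ?addr0 ?mulr1 //.
Qed.

(** The increment of [f] is telescoped along the axis-parallel path given by [rV_trunc]; on each
    edge the mean value theorem yields a partial derivative at a point close to [x]. *)
Lemma differentiable_C1 f x :
  (\forall y \near x, forall j, derivable f y (delta_mx 0 j)) ->
  (forall j, {for x, continuous (fun y => 'D_(delta_mx 0 j) f y)}) ->
  differentiable f x /\
  forall v, 'D_v f x = \sum_j v 0 j * 'D_(delta_mx 0 j) f x.
Proof.
move=> fd fc.
pose L0 (h : 'rV[R]_n) : R := \sum_j h 0 j * 'D_(delta_mx 0 j) f x.
have L0lin : linear L0.
  move=> a u w; rewrite /L0 scaler_sumr -big_split /=; apply: eq_bigr => j _.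
  by rewrite !mxE mulrDl scalerAl.
pose LM := GRing.isLinear.Build _ _ _ _ _ L0lin.
pose L : {linear 'rV[R]_n -> R} := HB.pack L0 LM.
have Lc : continuous L.
  move=> h; apply: differentiable_continuous.
  have -> : (L : _ -> _) = \sum_j (fun h => h 0 j * 'D_(delta_mx 0 j) f x).
    by rewrite fct_sumE.
  apply: differentiable_sum => j; apply: differentiableM => //.
  exact: differentiable_coord.
have [|df dE] := @differentiable_approx R _ _ f x L Lc; last first.
  by split=> // v; rewrite deriveE// dE.
move=> e e0.
  (* The tolerance for each of the [n] edges; [n.+1] keeps the denominator nonzero for [n = 0]. *)
  have e'0 : 0 < e / n.+1%:R by rewrite divr_gt0.
  have : \forall y \near x, forall j,
      `|'D_(delta_mx 0 j) f x - 'D_(delta_mx 0 j) f y| <= e / n.+1%:R.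
    apply: near_forall => j.
    by have /cvgrPdist_le := fc j; apply.
  move/(filterI fd)/nbhs_ballP => [d d0 dP].
  have /nbhs_ballP := (nbhsx_ballx (0 : 'rV[R]_n) d d0).
  move=> _; near=> h.
  have hd : `|h| < d.
    near: h; apply/nbhs_ballP; exists d => //= y.
    by rewrite -ball_normE /= sub0r normrN.
  have near_h a : `|a| <= `|h| -> ball x d (a + x).
    by move=> ah; rewrite -ball_normE /= opprD addrCA subrr addr0 normrN (le_lt_trans ah).
  have -> : f (h + x) - f x - L h =
      \sum_(m < n) (f (rV_trunc m.+1 h + x) - f (rV_trunc m h + x) -
         h 0 m * 'D_(delta_mx 0 m) f x).
    rewrite sumrB -(big_mkord xpredT (fun m => f (rV_trunc m.+1 h + x) - f (rV_trunc m h + x))).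
    rewrite (telescope_sumr (fun m => f (rV_trunc m h + x)))//.
    have -> : rV_trunc n h = h by apply/rowP => j; rewrite mxE ltn_ord.
    have -> : rV_trunc 0 h = 0 by apply/rowP => j; rewrite !mxE.
    by rewrite add0r.
  apply: (@le_trans _ _ (\sum_(m < n) (e / n.+1%:R * `|h|))).
    apply: le_trans (ler_norm_sum _ _ _) _; apply: ler_sum => m _.
    rewrite rV_truncS -[_ + _ + x]addrA.
    (* The edges stay in the ball: each coordinate of their points is at most that of [h] in
       absolute value, and the norm is the maximum norm. *)
    have lt (t : R) : 0 <= t <= 1 -> ball x d (t *: (h 0 m *: delta_mx 0 m) + (rV_trunc m h + x)).
      move=> /andP[t0 t1]; rewrite addrA; apply: near_h; apply: rV_norm_le => // j.
      apply: le_trans (coord_norm_le h j); rewrite !mxE eqxx /= -val_eqE/=.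
      case: ltngtP => [jm|mj|/val_inj ->].
      - by rewrite !mulr0 add0r.
      - by rewrite !mulr0 add0r normr0.
      - by rewrite addr0 mulr1 normrM ger0_norm// ler_piMl.
    have [t /lt/dP[dy Dy]|t /lt/dP[dy Dy] ->] :=
      @mean_value R _ f (rV_trunc m h + x) (h 0 m *: delta_mx 0 m).
      by apply: ex_derive; exact: is_derive_scale.
    rewrite (@derive_val _ _ _ _ _ _ _ (is_derive_scale _ (dy m))) -mulrBr normrM mulrC.
    by apply: ler_pM => //; [rewrite distrC; exact: Dy|exact: coord_norm_le].
  rewrite -mulr_suml ler_wpM2r// sumr_const card_ord -[leLHS]mulr_natr mulrAC.
  by rewrite ler_pdivrMr// ler_wpM2l ?ler_nat ?ltW.
Unshelve. all: by end_near. Qed.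

Lemma C_germ_differentiable k f x : C_germ k.+1 x f -> differentiable f x.
Proof.
move=> /(C_germ_le (isT : (1 <= k.+1)%N))/C_germS[f1 Df]; apply: (differentiable_C1 _ _).1.
  by apply: filterS f1 => y [].
by move=> j; apply: (@C_germ_continuous _ _ 0); exact: Df.
Qed.

Lemma C_germ_deriveE k f x v : C_germ k.+1 x f ->
  'D_v f x = \sum_j v 0 j * 'D_(delta_mx 0 j) f x.
Proof.
move=> /(C_germ_le (isT : (1 <= k.+1)%N))/C_germS[f1 Df]; apply: (differentiable_C1 _ _).2.
  by apply: filterS f1 => y [].
by move=> j; apply: (@C_germ_continuous _ _ 0); exact: Df.
Qed.

End ContinuouslyDifferentiable.

(** * Algebraic operations on germs of finite order *)

Section GermClosure.
Context (R : realType) (n : nat).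
Implicit Types (f g : 'rV[R]_n -> R) (x y v : 'rV[R]_n) (k : nat).

Lemma C_germ0 x f : C_germ 0 x f <-> \forall y \near x, {for y, continuous f}.
Proof.
split; apply: filterS => y; first by move=> [/(_ y erefl)].
by move=> fy; split=> // _ ->.
Qed.

(** The induction step of the closure lemmas: it suffices to give a formula for the partial
    derivatives. Total differentiability is asked for, as that is what passes through products and
    compositions. *)
Lemma C_germS_of k x f (df : 'I_n -> 'rV[R]_n -> R) :
  (\forall y \near x, differentiable f y /\
     forall j, 'D_(delta_mx 0 j) f y = df j y) ->
  (forall j, C_germ k x (df j)) -> C_germ k.+1 x f.
Proof.
move=> fd Df; apply/C_germS; split.
  apply: filterS fd => y [fy _]; split; first exact: differentiable_continuous.
  by move=> j; exact: diff_derivable.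
move=> j; apply: near_eq_C_germ (Df j).
by apply: filterS fd => y [_ ->].
Qed.

Lemma C_germ_near_diff k x f :
  C_germ k.+1 x f -> \forall y \near x, differentiable f y.
Proof. by move=> /C_germ_near; apply: filterS => y /C_germ_differentiable. Qed.

Lemma C_germ_derive k x f j :
  C_germ k.+1 x f -> C_germ k x (fun y => 'D_(delta_mx 0 j) f y).
Proof. by move=> /C_germS[_]. Qed.

Lemma C_germ_cst k x (a : R) : C_germ k x (fun=> a).
Proof.
elim: k x a => [|k IH] x a.
  by apply/C_germ0; near=> y; exact: cst_continuous.
apply: (@C_germS_of _ _ _ (fun _ _ => 0)) => //.
near=> y; split=> [|j]; first exact: differentiable_cst.
exact: derive_cst.
Unshelve. all: by end_near. Qed.

Lemma C_germD k x f g :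
  C_germ k x f -> C_germ k x g -> C_germ k x (fun y => f y + g y).
Proof.
elim: k f g => [|k IH] f g fk gk.
  move: fk gk => /C_germ0 fk /C_germ0 gk; apply/C_germ0.
  by apply: filterS2 fk gk => y fy gy; exact: continuousD.
apply: (@C_germS_of _ _ _ (fun j y => 'D_(delta_mx 0 j) f y + 'D_(delta_mx 0 j) g y)).
  apply: filterS2 (C_germ_near_diff fk) (C_germ_near_diff gk) => y fy gy.
  split=> [|j]; first exact: differentiableD.
  by rewrite -deriveD//; exact: diff_derivable.
by move=> j; apply: IH; exact: C_germ_derive.
Qed.

Lemma C_germM k x f g :
  C_germ k x f -> C_germ k x g -> C_germ k x (fun y => f y * g y).
Proof.
elim: k f g => [|k IH] f g fk gk.
  move: fk gk => /C_germ0 fk /C_germ0 gk; apply/C_germ0.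
  by apply: filterS2 fk gk => y fy gy; exact: continuousM.
apply: (@C_germS_of _ _ _
  (fun j y => f y * 'D_(delta_mx 0 j) g y + g y * 'D_(delta_mx 0 j) f y)).
  apply: filterS2 (C_germ_near_diff fk) (C_germ_near_diff gk) => y fy gy.
  split=> [|j]; first exact: differentiableM.
  by rewrite -[LHS]/('D_(delta_mx 0 j) (f * g) y) deriveM//; exact: diff_derivable.
by move=> j; apply: C_germD; apply: IH; (try exact: C_germ_derive); exact: C_germ_pred.
Qed.

Lemma C_germN k x f : C_germ k x f -> C_germ k x (fun y => - f y).
Proof.
move=> fk; apply: near_eq_C_germ (C_germM (C_germ_cst k x (-1)) fk).
by near=> y; rewrite mulN1r.
Unshelve. all: by end_near. Qed.

Lemma C_germ_sum k x (I : Type) (r : seq I) (P : pred I) (F : I -> 'rV[R]_n -> R) :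
  (forall i, P i -> C_germ k x (F i)) ->
  C_germ k x (fun y => \sum_(i <- r | P i) F i y).
Proof.
move=> Fk; elim: r => [|i r IH].
  apply: near_eq_C_germ (C_germ_cst k x 0).
  by near=> y; rewrite big_nil.
have [Pi|Pi] := boolP (P i).
  apply: near_eq_C_germ (C_germD (Fk i Pi) IH).
  by near=> y; rewrite big_cons Pi.
apply: near_eq_C_germ IH.
by near=> y; rewrite big_cons (negbTE Pi).
Unshelve. all: by end_near. Qed.

Lemma C_germ_coord k x j : C_germ k x (fun y => y 0 j).
Proof.
have cd y : differentiable (fun y : 'rV[R]_n => y 0 j : R) y by exact: differentiable_coord.
case: k => [|k].
  by apply/C_germ0; near=> y; exact: coord_continuous.
apply: (@C_germS_of _ _ _ (fun l _ => (delta_mx 0 l : 'rV[R]_n) 0 j)) => [|l].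
  near=> y; split=> // l; rewrite /derive; apply: cvg_lim => //.
  apply: (@cvg_near_cst _ _ (delta_mx 0 l 0 j : R)).
  exists 1 => //= h _ h0; rewrite !mxE addrK [_ *: _]mulrA mulVf ?mul1r//.
exact: C_germ_cst.
Unshelve. all: by end_near. Qed.

Lemma C_germV k x f : f x != 0 -> C_germ k x f -> C_germ k x (fun y => (f y)^-1).
Proof.
elim: k => [|k IH] fx0 fk.
  move: (fk) => /C_germ0 fc; apply/C_germ0.
  have f0 : \forall y \near x, f y != 0.
    apply: (@near_fun _ _ f x (fun z => z != 0)); first exact: C_germ_continuous fk.
    by apply: (@open_nbhs_nbhs _ _ [set z | z != 0]); split=> //; exact: open_neq.
  by apply: filterS2 f0 fc => y f0 fc; exact: continuousV.
have f0 : \forall y \near x, f y != 0.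
  apply: (@near_fun _ _ f x (fun z => z != 0)); first exact: C_germ_continuous fk.
  by apply: (@open_nbhs_nbhs _ _ [set z | z != 0]); split=> //; exact: open_neq.
have IHk := IH fx0 (C_germ_pred fk).
apply: (@C_germS_of _ _ _ (fun j y => - ((f y)^-1 * (f y)^-1) * 'D_(delta_mx 0 j) f y)).
  apply: filterS2 f0 (C_germ_near_diff fk) => y fy0 fy; split=> [|j].
    exact: differentiableV.
  rewrite deriveV//; last exact: diff_derivable.
  by rewrite expr2 invfM.
move=> j; apply: C_germM; last exact: C_germ_derive.
exact/C_germN/C_germM.
Qed.

End GermClosure.

(** * Chain rule and composition *)

Section Composition.
Context (R : realType) (n m : nat).
Implicit Types (f : 'rV[R]_m -> R) (g : 'rV[R]_n -> 'rV[R]_m) (x : 'rV[R]_n).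

Lemma rV_continuous_at (T : topologicalType) (h : T -> 'rV[R]_m) (t : T) :
  (forall l, {for t, continuous (fun s => h s 0 l)}) -> {for t, continuous h}.
Proof.
move=> hc A [P hP PA]; apply: filterS PA _.
have : \forall s \near t, forall l : 'I_m, P 0 l (h s 0 l).
  apply: near_forall.
  by move=> l; exact: hc (hP 0 l).
by apply: filterS => s Ps i j; rewrite ord1.
Qed.

Lemma rV_differentiable g x :
  (forall l, differentiable (fun y => g y 0 l) x) -> differentiable g x.
Proof.
move=> gd; have -> : g = \sum_l (fun y => g y 0 l *: (delta_mx 0 l : 'rV[R]_m)).
  by rewrite fct_sumE; apply/funext => y; exact: row_sum_delta.
by apply: differentiable_sum => l; exact: differentiableZl.
Qed.

Lemma chain_rule k f g x v : C_germ k.+1 (g x) f ->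
  (forall l, differentiable (fun y => g y 0 l) x) ->
  'D_v (f \o g) x =
  \sum_l 'D_v (fun y => g y 0 l) x * 'D_(delta_mx 0 l) f (g x).
Proof.
move=> fk gl; have gd := rV_differentiable gl.
have fd := C_germ_differentiable fk.
rewrite deriveE; last exact: differentiable_comp.
rewrite diff_comp//= -!deriveE// (C_germ_deriveE _ fk); apply: eq_bigr => l _.
by rewrite derive_mx ?mxE//; exact: diff_derivable.
Qed.

Lemma C_germ_comp k f g x : C_germ k (g x) f ->
  (forall l, C_germ k x (fun y => g y 0 l)) -> C_germ k x (f \o g).
Proof.
elim: k f => [|k IH] f fk gk.
  have gc : \forall y \near x, {for y, continuous g}.
    have : \forall y \near x, forall l : 'I_m, {for y, continuous (fun z => g z 0 l)}.
      apply: near_forall.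
      by move=> l; apply/C_germ0.
    by apply: filterS => y; exact: rV_continuous_at.
  move/C_germ0/(near_fun _ _ _ (nbhs_singleton gc)) : fk => fk; apply/C_germ0.
  by apply: filterS2 gc fk => y gy fy; exact: continuous_comp.
have gc : {for x, continuous g}.
  by apply: rV_continuous_at => l; exact: C_germ_continuous (gk l).
apply: (@C_germS_of _ _ _ _ _
  (fun j y => \sum_l 'D_(delta_mx 0 j) (fun y => g y 0 l) y * 'D_(delta_mx 0 l) f (g y))).
  have gd : \forall y \near x, forall l : 'I_m, differentiable (fun z => g z 0 l) y.
    apply: near_forall.
    by move=> l; exact: C_germ_near_diff (gk l).
  have := near_fun _ _ _ gc (C_germ_near fk); apply: filterS2 gd => y gd fy.
  split=> [|j]; last exact: chain_rule fy gd.
  by apply: differentiable_comp; [exact: rV_differentiable|exact: C_germ_differentiable fy].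
move=> j; apply: C_germ_sum => l _; apply: C_germM.
  exact: C_germ_derive.
apply: (IH (fun z => 'D_(delta_mx 0 l) f z)); first exact: C_germ_derive.
by move=> i; exact: C_germ_pred.
Qed.

End Composition.

(** * Symmetry of second derivatives *)

Section Schwarz.
Context (R : realType) (n : nat).
Implicit Types (f : 'rV[R]_n -> R) (x : 'rV[R]_n) (i j : 'I_n).

Lemma is_derive_scaleB (f g : 'rV[R]_n -> R) x v (s df dg : R) :
  is_derive x v f df -> is_derive x v g dg ->
  is_derive x (s *: v) (f - g) (s * (df - dg)).
Proof.
move=> [fd <-] [gd <-]; rewrite -(deriveB fd gd).
exact: is_derive_scale (derivableB fd gd).
Qed.

Lemma is_derive_translate f x v (a : 'rV[R]_n) : derivable f (x + a) v ->
  is_derive x v (fun y => f (y + a)) ('D_v f (x + a)).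
Proof.
move=> df; apply: DeriveDef; rewrite /derivable /derive.
  by move: df; rewrite /derivable; under eq_fun do rewrite /= addrA.
by under [in RHS]eq_fun do rewrite /= addrA.
Qed.

(* The second difference is symmetric in [i] and [j] and equals [h ^ 2] times a
   mixed derivative at a nearby point. *)
Lemma second_difference f x i j (e : R) : 0 < e ->
  (forall y, `|y - x| < e -> derivable f y (delta_mx 0 i) /\
     derivable (fun z => 'D_(delta_mx 0 i) f z) y (delta_mx 0 j)) ->
  forall h : R, 0 < h -> h *+ 2 < e -> exists2 y, `|y - x| <= h *+ 2 &
  f (h *: delta_mx 0 i + (h *: delta_mx 0 j + x)) - f (h *: delta_mx 0 i + x)
  - (f (h *: delta_mx 0 j + x) - f x) =
  h * (h * 'D_(delta_mx 0 j) (fun z => 'D_(delta_mx 0 i) f z) y).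
Proof.
move=> e0 fd h h0 he.
have small (s t : R) : 0 <= s <= 1 -> 0 <= t <= 1 ->
    `|s *: (h *: delta_mx 0 j) + (t *: (h *: delta_mx 0 i) + x) - x : 'rV[R]_n| <= h *+ 2.
  move=> s01 t01; rewrite addrA addrK (le_trans (ler_normD _ _))// mulr2n.
  have sm (u : R) (l : 'I_n) : 0 <= u <= 1 -> `|u *: (h *: delta_mx 0 l) : 'rV[R]_n| <= h.
    move=> /andP[u0 u1]; apply: rV_norm_le; first exact: ltW.
    move=> p; rewrite !mxE eqxx/= !normrM [`|u|]ger0_norm// [`|h|]gtr0_norm// normr_nat.
    by case: (p == l); rewrite /= ?mulr1 ?mulr0; [exact: ler_piMl (ltW h0) u1|exact: ltW].
  by rewrite lerD// sm.
have le01 : (0 : R) <= (1 : R) <= (1 : R) by apply/andP; split; rewrite ?ler01 ?lexx.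
have le00 : (0 : R) <= (0 : R) <= (1 : R) by apply/andP; split; rewrite ?ler01 ?lexx.
(* The mean value theorem is used twice: along axis [i] for the difference [phi], then along axis
   [j] for the partial derivative of [f] that comes out. *)
pose fj (z : 'rV[R]_n) := f (z + h *: delta_mx 0 j); pose phi := fj - f.
have phid t : 0 <= t <= 1 -> is_derive (t *: (h *: delta_mx 0 i) + x) (h *: delta_mx 0 i) phi
   (h * ('D_(delta_mx 0 i) f (t *: (h *: delta_mx 0 i) + x + h *: delta_mx 0 j) -
         'D_(delta_mx 0 i) f (t *: (h *: delta_mx 0 i) + x))).
  move=> t01; apply: is_derive_scaleB; last first.
    have [d0 _] := fd _ (le_lt_trans (small 0 t le00 t01) he).
    by rewrite scale0r add0r in d0; exact: DeriveDef.
  have [d1 _] := fd _ (le_lt_trans (small 1 t le01 t01) he).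
  by rewrite scale1r addrC in d1; exact: is_derive_translate.
have [t t01|t t01 E] := @mean_value _ _ phi x (h *: delta_mx 0 i).
  by have := phid t t01 => ?; exact: ex_derive.
have E1 := @derive_val _ _ _ _ _ _ _ (phid t t01).
pose a := t *: (h *: delta_mx 0 i) + x.
have [s s01|s s01 E'] := @mean_value _ _ (fun z => 'D_(delta_mx 0 i) f z) a (h *: delta_mx 0 j).
  have [_ d] := fd _ (le_lt_trans (small s t s01 t01) he).
  by have := is_derive_scale h d => ?; exact: ex_derive.
have [_ d] := fd _ (le_lt_trans (small s t s01 t01) he).
have E2 := @derive_val _ _ _ _ _ _ _ (is_derive_scale h d).
exists (s *: (h *: delta_mx 0 j) + a); first exact: small.
have -> : h * 'D_(delta_mx 0 j) (fun z => 'D_(delta_mx 0 i) f z) (s *: (h *: delta_mx 0 j) + a) =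
    'D_(delta_mx 0 i) f (a + h *: delta_mx 0 j) - 'D_(delta_mx 0 i) f a.
  by rewrite [a + _]addrC E' -E2.
by rewrite -E1 -E [h *: delta_mx 0 j + x]addrC addrA.
Qed.

Lemma dist_le_double (p q r c : R) :
  `|p - q| <= c -> `|r - q| <= c -> `|p - r| <= c + c.
Proof. by move=> pq rq; rewrite (le_trans (ler_distD q _ _))// lerD// distrC. Qed.

(** If the mixed derivatives at [x] differed by [d > 0], both would vary by at most [d / 4] near
    [x]. The symmetric second difference gives nearby points where they coincide, which bounds the
    gap by [d / 2]. *)
Lemma schwarz f x i j : C_germ 2 x f ->
  'D_(delta_mx 0 i) (fun y => 'D_(delta_mx 0 j) f y) x =
  'D_(delta_mx 0 j) (fun y => 'D_(delta_mx 0 i) f y) x.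
Proof.
move=> f2; pose D a b y := 'D_(delta_mx 0 a) (fun z => 'D_(delta_mx 0 b) f z) y.
have Dc a b : {for x, continuous (D a b)}.
  by apply: (@C_germ_continuous _ _ 0); do 2![apply: C_germ_derive].
have fd : \forall y \near x, forall a b, derivable f y (delta_mx 0 b) /\
    derivable (fun z => 'D_(delta_mx 0 b) f z) y (delta_mx 0 a).
  apply: filterS (C_germ_near f2) => y fy a b; split.
    by apply: diff_derivable; exact: C_germ_differentiable fy.
  by apply: diff_derivable; apply: (@C_germ_differentiable _ _ 0); exact: C_germ_derive.
apply/eqP/negPn/negP => /eqP/eqP; rewrite -subr_eq0 -normr_gt0 => d0.
set d := `|_| in d0.
have d4 : 0 < d / 4 by rewrite divr_gt0.
have dc a b : \forall y \near x, `|D a b x - D a b y| <= d / 4.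
  by have /cvgrPdist_le := Dc a b; apply.
move: (dc j i) => /(filterI (dc i j))/(filterI fd)/nbhs_ballP[e /= e0 eP].
(* The increment is [h = e / 4], so the points found lie within [2 h = e / 2] of [x]. *)
have e3 : 0 < e / 4 by rewrite divr_gt0.
have he : e / 4 *+ 2 < e by rewrite -mulr_natr; lra.
have yball y : `|y - x| < e -> ball x e y by rewrite -ball_normE /= distrC.
have [|y ye E] := @second_difference f x i j e e0 _ (e / 4) e3 he.
  by move=> y /yball /eP[fdy _]; have [] := fdy j i.
have [|z ze E'] := @second_difference f x j i e e0 _ (e / 4) e3 he.
  by move=> z /yball /eP[fdz _]; have [] := fdz i j.
have e3' : e / 4 != 0 by rewrite gt_eqF.
have DD : D j i y = D i j z.
  apply: (mulfI e3'); apply: (mulfI e3').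
  have G (p q r s : R) : p - q - (r - s) = p - r - (q - s) by ring.
  have AB (u w : 'rV[R]_n) : f (u + (w + x)) - f (u + x) - (f (w + x) - f x) =
      f (w + (u + x)) - f (w + x) - (f (u + x) - f x).
    by rewrite (addrCA u) G.
  exact: etrans (esym E) (etrans (AB _ _) E').
have [_ [_ yP]] := eP y (yball _ (le_lt_trans ye he)).
have [_ [zP _]] := eP z (yball _ (le_lt_trans ze he)).
rewrite DD in yP; have := dist_le_double zP yP; rewrite -/d; clear -d4; lra.
Qed.

End Schwarz.

(** * Smooth functions on row vector spaces *)

Section FlatFunction.
Context (R : realType).
Implicit Types (t : R) (m : nat).

(* [flat m.+2 - m * flat m.+1] is the derivative of [flat m], whence smoothness
   of the whole family by a single induction. *)
Definition flat m t : R := if 0 < t then t^-1 ^+ m * expR (- t^-1) else 0.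

Lemma flat_pos t : 0 < t -> 0 < flat 0 t.
Proof. by move=> t0; rewrite /flat t0 expr0 mul1r expR_gt0. Qed.

Lemma flat_ge0 m t : 0 <= flat m t.
Proof.
by rewrite /flat; case: ifPn => // t0; rewrite mulr_ge0 ?expR_ge0// exprn_ge0// invr_ge0 ltW.
Qed.

(** With [s = 1 / t], the exponential series gives [s ^ (m+1) / (m+1)! <= exp s], that is,
    [s ^ m * exp (- s) <= (m+1)! * t]. *)
Lemma flat_le m t : flat m t <= (m.+1)`!%:R * `|t|.
Proof.
rewrite /flat; case: ifPn => [t0|_]; last by rewrite mulr_ge0.
have s0 : 0 <= t^-1 by rewrite invr_ge0 ltW.
have : t^-1 ^+ m.+1 / (m.+1)`!%:R <= expR t^-1.
  by apply: le_trans (expR_ge1Dxn m s0); rewrite lerDr.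
rewrite ler_pdivrMr ?ltr0n ?fact_gt0// expRN gtr0_norm// => H.
by rewrite -ler_pdivrMr// mulrAC -exprSr ler_pdivrMr ?expR_gt0// mulrC.
Qed.

Lemma flat_cvg0 m : flat m h @[h --> (0 : R)] --> (0 : R).
Proof.
apply/cvgrPdist_le => e e0.
have c0 : 0 < (m.+1)`!%:R :> R by rewrite ltr0n fact_gt0.
have : \forall h \near (0 : R), `|h| <= e / (m.+1)`!%:R.
  by apply: nbhs0_le; rewrite divr_gt0.
apply: filterS => h; rewrite ler_pdivlMr// mulrC => he.
by rewrite sub0r normrN ger0_norm ?flat_ge0//; exact: le_trans (flat_le _ _) he.
Qed.

Lemma is_derive_flat m t : is_derive t 1 (flat m) (flat m.+2 t - m%:R * flat m.+1 t).
Proof.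
have [t0|t0|->] := ltgtP t 0.
- have E : \forall s \near t, cst 0 s = flat m s.
    by near=> s; rewrite /flat ifN// -leNgt ltW//; near: s; exact: lt_nbhsl.
  apply: near_eq_is_derive E _; rewrite /flat !ifN ?mulr0 ?subr0 -?leNgt ?ltW//.
  exact: is_derive_cst.
- have E : \forall s \near t, (s^-1) ^+ m * expR (- s^-1) = flat m s.
    by near=> s; rewrite /flat ifT//; near: s; exact: lt_nbhsr.
  apply: near_eq_is_derive E _.
  have tn0 : t != 0 by rewrite gt_eqF.
  have di : is_derive t 1 (fun s : R => s^-1) (- t ^- 2).
    have := @is_deriveV R id t 1 1 tn0 (is_derive_id _ _).
    by rewrite /= [_ *: _]mulr1.
  have de : is_derive t 1 (fun s : R => expR (- s^-1)) (expR (- t^-1) * t ^- 2).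
    have dn : is_derive t 1 (fun s : R => - s^-1) (t ^- 2).
      by have := is_deriveN di; rewrite opprK.
    exact: (is_derive1_comp _ dn).
  have dp := is_deriveX m di.
  have dM := is_deriveM dp de.
  have -> : (fun s : R => s^-1 ^+ m * expR (- s^-1)) =
      (GRing.inv : R -> R) ^+ m * (fun s : R => expR (- s^-1)).
    by apply/funext => s; rewrite /= exprfctE.
  apply: is_derive_eq; rewrite exprfctE /flat t0 /GRing.scale /=.
  rewrite -!exprVn; move: (t^-1) (expR _) => s y; clear.
  by case: m => [|m] /=; rewrite ?exprS ?expr0; ring.
- have -> : flat m.+2 0 - m%:R * flat m.+1 0 = 0 :> R.
    by rewrite /flat ltxx mulr0 subr0.
  (* The difference quotient of [flat m] at 0 is [flat m.+1], which tends to 0. *)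
  have L : h^-1 *: ((flat m \o shift 0) (h *: (1 : R)) - flat m 0) @[h --> 0^'] --> (0 : R).
    apply: (@cvg_trans _ (flat m.+1 h @[h --> 0^'])).
      apply: near_eq_cvg; near=> h; rewrite /= addr0 [h *: 1]mulr1 /flat ltxx subr0.
      by case: ifPn; rewrite ?scaler0// => _; rewrite exprS -mulrA.
    exact: cvg_within_filter (flat_cvg0 _).
  by apply: DeriveDef; [apply/cvg_ex; exists 0|apply: cvg_lim].
Unshelve. all: by end_near. Qed.

Lemma flat_differentiable m t : differentiable (flat m) t.
Proof. by apply/derivable1_diffP; have D := is_derive_flat m t; exact: ex_derive. Qed.

Lemma diff_flat m t (c : R) :
  'd (flat m) t c = c * (flat m.+2 t - m%:R * flat m.+1 t).
Proof.
rewrite -[X in 'd (flat m) t X = _]mulr1 -/(c *: (1 : R)) linearZ/=.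
rewrite -deriveE; last exact: flat_differentiable.
by rewrite (@derive_val _ _ _ _ _ _ _ (is_derive_flat m t)).
Qed.

Lemma C_germ_flat n k (x : 'rV[R]_n) f m :
  C_germ k x f -> C_germ k x (fun y => flat m (f y)).
Proof.
elim: k m => [|k IH] m fk.
  move/C_germ0 : fk => fk; apply/C_germ0; apply: filterS fk => y fy.
  apply: (@continuous_comp _ _ _ f (flat m)) => //.
  exact/differentiable_continuous/flat_differentiable.
apply: (@C_germS_of _ _ _ _ _ (fun j y =>
  'D_(delta_mx 0 j) f y * (flat m.+2 (f y) + (- m%:R) * flat m.+1 (f y)))).
  apply: filterS (C_germ_near_diff fk) => y fy; split=> [|j].
    by apply: differentiable_comp => //; exact: flat_differentiable.
  rewrite deriveE; last by apply: differentiable_comp => //; exact: flat_differentiable.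
  rewrite (@diff_comp _ _ _ _ f (flat m))//=; last exact: flat_differentiable.
  by rewrite diff_flat -deriveE// mulNr.
have fk' := C_germ_pred fk.
move=> j; apply: C_germM; first exact: C_germ_derive.
apply: C_germD; first exact: IH.
by apply: C_germM; [exact: C_germ_cst|exact: IH].
Qed.

End FlatFunction.

Section SmoothClosure.
Context (R : realType) (n : nat).
Implicit Types (f g : 'rV[R]_n -> R) (x : 'rV[R]_n).

Lemma smooth_at_cst x (a : R) : smooth_at x (fun=> a).
Proof. by apply/smooth_atP; near=> y => k; exact: C_germ_cst. Unshelve. all: by end_near. Qed.

Lemma smooth_atD x f g :
  smooth_at x f -> smooth_at x g -> smooth_at x (fun y => f y + g y).
Proof.
move=> /smooth_atP fx /smooth_atP gx; apply/smooth_atP.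
by apply: filterS2 fx gx => y fy gy k; exact: C_germD.
Qed.

Lemma smooth_atM x f g :
  smooth_at x f -> smooth_at x g -> smooth_at x (fun y => f y * g y).
Proof.
move=> /smooth_atP fx /smooth_atP gx; apply/smooth_atP.
by apply: filterS2 fx gx => y fy gy k; exact: C_germM.
Qed.

Lemma smooth_atV x f : f x != 0 -> smooth_at x f -> smooth_at x (fun y => (f y)^-1).
Proof.
move=> fx0 fs; have f0 : \forall y \near x, f y != 0.
  apply: (@near_fun _ _ f x (fun z => z != 0)); first exact: smooth_at_continuous.
  by apply: (@open_nbhs_nbhs _ _ [set z | z != 0]); split=> //; exact: open_neq.
move/smooth_atP : fs => fs; apply/smooth_atP.
by apply: filterS2 f0 fs => y fy fs k; exact: C_germV.
Qed.

Lemma smooth_at_flat x f m : smooth_at x f -> smooth_at x (fun y => flat m (f y)).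
Proof.
move=> /smooth_atP fx; apply/smooth_atP.
by apply: filterS fx => y fy k; exact: C_germ_flat.
Qed.

Lemma smooth_at_comp m (f : 'rV[R]_m -> R) (g : 'rV[R]_n -> 'rV[R]_m) x :
  smooth_at (g x) f -> (forall l, smooth_at x (fun y => g y 0 l)) ->
  smooth_at x (f \o g).
Proof.
move=> /smooth_atP fx gx; have gc : {for x, continuous g}.
  by apply: rV_continuous_at => l; exact: smooth_at_continuous.
have gs : \forall y \near x, forall l : 'I_m, smooth_at y (fun z => g z 0 l).
  apply: near_forall.
  by move=> l; exact: smooth_at_near (gx l).
apply/smooth_atP; apply: filterS2 gs (near_fun _ _ _ gc fx) => y gy fy k.
by apply: C_germ_comp => // l; exact: smooth_at_C_germ.
Qed.

End SmoothClosure.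

(** * Germs of functions and tangent vectors on a manifold *)

Section Charts.
Context (R : realType) (n : nat) (M : manifold R n).
Implicit Types (c : chart R M n) (p q : M) (f g : M -> R).

Lemma chart_fwdK c p : atlas M c -> dom c p -> bwd c (fwd c p) = p.
Proof. by move=> /atlas_chart[_ _ + _ _]; exact. Qed.

Lemma near_dom c p : atlas M c -> dom c p -> \forall q \near p, dom c q.
Proof.
by move=> /atlas_chart[oc _ _ _ _] cp; exact: open_nbhs_nbhs.
Qed.

Lemma near_fwd c p (P : set 'rV[R]_n) : atlas M c -> dom c p ->
  (\forall x \near fwd c p, P x) -> \forall q \near p, P (fwd c q).
Proof. by move=> /atlas_chart[_ _ _ fc _] /fc; exact: near_fun. Qed.

Lemma near_bwd c p (P : set M) : atlas M c -> dom c p ->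
  (\forall q \near p, P q) -> \forall x \near fwd c p, P (bwd c x).
Proof.
move=> /[dup] cA /atlas_chart[_ _ _ _ bc] cp.
have /bc : (fwd c @` dom c) (fwd c p) by exists p.
by rewrite /prop_for /continuous_at chart_fwdK// => H /H.
Qed.

Lemma near_bwdK c p : atlas M c -> dom c p ->
  \forall x \near fwd c p, dom c (bwd c x) /\ fwd c (bwd c x) = x.
Proof.
move=> /[dup] cA /atlas_chart[_ oc _ _ _] cp.
have : nbhs (fwd c p) (fwd c @` dom c) by apply: open_nbhs_nbhs; split=> //; exists p.
by apply: filterS => _ [q cq <-]; rewrite chart_fwdK.
Qed.

Lemma chart_image_open c (U : set M) : atlas M c -> open U ->
  open (fwd c @` (dom c `&` U)).
Proof.
move=> cA oU; rewrite openE => _ [p [cp Up] <-].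
have Up' := near_bwd cA cp (open_nbhs_nbhs (conj oU Up)).
suff: nbhs (fwd c p) (fwd c @` (dom c `&` U)) by [].
apply: filterS2 (near_bwdK cA cp) Up' => x [cx xK] Ux.
by exists (bwd c x).
Qed.

Lemma transition_smooth c c' p l : atlas M c -> atlas M c' -> dom c p -> dom c' p ->
  smooth_at (fwd c p) (fun x => fwd c' (bwd c x) 0 l).
Proof.
move=> cA cA' cp cp'.
have [oc' _ _ _ _] := atlas_chart cA'.
have := @atlas_compatible _ _ _ _ _ cA cA' l.
by move/(smooth_on_open _ (chart_image_open cA oc')); apply; exists p.
Qed.

(** Tested in the preferred chart only; by smoothness of the transition maps every chart of the
    atlas around [p] gives the same notion. *)
Definition msmooth p f : Prop :=
  smooth_at (fwd (chart_at p) p) (f \o bwd (chart_at p)).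

Lemma smooth_at_chart c c' p f : atlas M c -> dom c p -> atlas M c' -> dom c' p ->
  smooth_at (fwd c p) (f \o bwd c) -> smooth_at (fwd c' p) (f \o bwd c').
Proof.
move=> cA cp cA' cp' fs.
have S : smooth_at (fwd c' p) ((f \o bwd c) \o (fwd c \o bwd c')).
  apply: smooth_at_comp => /=; first by rewrite chart_fwdK.
  by move=> l; exact: transition_smooth.
apply: near_eq_smooth_at S.
by apply: filterS (near_bwd cA' cp' (near_dom cA cp)) => x cx /=; rewrite chart_fwdK.
Qed.

Lemma msmooth_chart c p f : atlas M c -> dom c p ->
  smooth_at (fwd c p) (f \o bwd c) -> msmooth p f.
Proof.
by move=> cA cp; exact: smooth_at_chart cA cp (chart_at_atlas p) (chart_at_dom p).
Qed.

Lemma msmooth_in_chart c p f : atlas M c -> dom c p ->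
  msmooth p f -> smooth_at (fwd c p) (f \o bwd c).
Proof. exact: smooth_at_chart (chart_at_atlas p) (chart_at_dom p). Qed.

Lemma msmooth_near p f : msmooth p f -> \forall q \near p, msmooth q f.
Proof.
move=> fs; have cA := chart_at_atlas p; have cp := chart_at_dom p.
have := near_fwd cA cp (smooth_at_near fs).
by apply: filterS2 (near_dom cA cp) => q; exact: msmooth_chart.
Qed.

Lemma smooth_fun_onP (U : set M) f : open U ->
  smooth_fun_on U f <-> forall p, U p -> msmooth p f.
Proof.
move=> oU; split=> [fU p Up|fU c cA].
  have /smooth_on_open := fU _ (chart_at_atlas p); apply.
    exact: chart_image_open (chart_at_atlas p) oU.
  by exists p => //; split=> //; exact: chart_at_dom.
apply/smooth_on_open; first exact: chart_image_open.
by move=> _ [p [cp Up] <-]; apply: msmooth_in_chart => //; exact: fU.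
Qed.

Lemma near_eq_msmooth p f g :
  (\forall q \near p, f q = g q) -> msmooth p f -> msmooth p g.
Proof.
move=> fg; apply: near_eq_smooth_at.
exact: near_bwd (chart_at_atlas p) (chart_at_dom p) fg.
Qed.

Lemma msmooth_cst p (a : R) : msmooth p (fun=> a).
Proof. exact: smooth_at_cst. Qed.

Lemma msmoothD p f g : msmooth p f -> msmooth p g -> msmooth p (fun q => f q + g q).
Proof. exact: smooth_atD. Qed.

Lemma msmoothM p f g : msmooth p f -> msmooth p g -> msmooth p (fun q => f q * g q).
Proof. exact: smooth_atM. Qed.

Lemma msmoothN p f : msmooth p f -> msmooth p (fun q => - f q).
Proof.
move=> fs; apply: near_eq_msmooth (msmoothM (msmooth_cst p (-1)) fs).
by near=> q; rewrite mulN1r.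
Unshelve. all: by end_near. Qed.

Lemma msmoothB p f g : msmooth p f -> msmooth p g -> msmooth p (fun q => f q - g q).
Proof. by move=> fs gs; apply: msmoothD => //; exact: msmoothN. Qed.

Lemma msmoothV p f : f p != 0 -> msmooth p f -> msmooth p (fun q => (f q)^-1).
Proof.
move=> fp0; apply: (@smooth_atV _ _ _ (f \o bwd (chart_at p))).
by rewrite /= chart_fwdK//; [exact: chart_at_atlas|exact: chart_at_dom].
Qed.

Lemma msmooth_flat p f m : msmooth p f -> msmooth p (fun q => flat m (f q)).
Proof. exact: (@smooth_at_flat _ _ _ (f \o bwd (chart_at p))). Qed.

(** The operation is a parameter because the expansion of a determinant needs sums as well as
    products. *)
Lemma msmooth_big (op : R -> R -> R) (idx : R) p (I : Type) (r : seq I) (P : pred I)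
    (F : I -> M -> R) :
  (forall f g, msmooth p f -> msmooth p g -> msmooth p (fun q => op (f q) (g q))) ->
  (forall i, P i -> msmooth p (F i)) ->
  msmooth p (fun q => \big[op/idx]_(i <- r | P i) F i q).
Proof.
move=> opS Fs; elim: r => [|i r IH].
  apply: near_eq_msmooth (msmooth_cst p idx).
  by near=> q; rewrite big_nil.
have [Pi|Pi] := boolP (P i).
  apply: near_eq_msmooth (opS _ _ (Fs i Pi) IH).
  by near=> q; rewrite big_cons Pi.
apply: near_eq_msmooth IH.
by near=> q; rewrite big_cons (negbTE Pi).
Unshelve. all: by end_near. Qed.

Lemma msmooth_continuous p f : msmooth p f -> {for p, continuous f}.
Proof.
move=> fs; have cA := chart_at_atlas p; have cp := chart_at_dom p.
have fc := smooth_at_continuous fs.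
apply: (@near_eq_continuous_at _ _ ((f \o bwd (chart_at p)) \o fwd (chart_at p))).
  by apply: filterS (near_dom cA cp) => q cq /=; rewrite chart_fwdK.
by apply: continuous_comp fc; have [_ _ _ fc _] := atlas_chart cA; exact: fc.
Qed.

Lemma msmooth_coord c p l : atlas M c -> dom c p -> msmooth p (fun q => fwd c q 0 l).
Proof.
by move=> cA cp; apply: transition_smooth => //; [exact: chart_at_atlas|exact: chart_at_dom].
Qed.

End Charts.

Lemma derive_coord (R : realType) (V : normedModType R) (m : nat)
    (g : V -> 'rV[R]_m) (x v : V) l :
  (forall j, derivable (fun y => g y 0 j) x v) ->
  ('D_v g x) 0 l = 'D_v (fun y => g y 0 l) x.
Proof.
move=> gd; rewrite derive_mx ?mxE//; apply/derivable_mxP => i j.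
by rewrite ord1.
Qed.

Lemma derive_rV_coord (R : realType) n (x v : 'rV[R]_n) j :
  'D_v (fun y : 'rV[R]_n => y 0 j) x = v 0 j.
Proof.
rewrite -[RHS](congr1 (fun w : 'rV[R]_n => w 0 j) (derive_id x v)).
have D : derivable (@id 'rV[R]_n) x v by exact: derivable_id.
by rewrite (derive_mx D) mxE.
Qed.

(** Bookkeeping for [lie_dv]: [c] and [d] are second-order terms whose sums agree by Schwarz's
    theorem and cancel. *)
Lemma sum_mulBl (R : pzRingType) (I : finType) (a b c d e f : I -> R) :
  \sum_i c i = \sum_i d i -> (forall i, e i = a i - b i) ->
  \sum_i e i * f i = \sum_i (a i * f i + c i) - \sum_i (b i * f i + d i).
Proof.
move=> cd eE; rewrite !big_split /= cd opprD addrACA subrr addr0 -sumrB.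
by apply: eq_bigr => i _; rewrite eE mulrBl.
Qed.

(** * Tangent vectors and vector fields as derivations *)

Section Derivations.
Context (R : realType) (n : nat) (M : manifold R n).
Implicit Types (c : chart R M n) (p q : M) (f g : M -> R) (v w : 'rV[R]_n)
  (X Y : vfield M).

Definition dv_def p v f : R := 'D_v (f \o bwd (chart_at p)) (fwd (chart_at p) p).

(* The tangent vector [v] at [p], acting as a derivation on germs at [p]; it is
   locked so that unification does not compare derivatives as limits. *)
Definition dv := locked dv_def.

Lemma dv_unlock p v f : dv p v f = 'D_v (f \o bwd (chart_at p)) (fwd (chart_at p) p).
Proof. by rewrite /dv -lock. Qed.

Lemma dvE p v f : msmooth p f -> dv p v f =
  \sum_j v 0 j * 'D_(delta_mx 0 j) (f \o bwd (chart_at p)) (fwd (chart_at p) p).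
Proof.
move=> fs; rewrite dv_unlock; apply: (@C_germ_deriveE _ _ 0).
exact: smooth_at_C_germ.
Qed.

Lemma dv_linear p f (a : R) v w : msmooth p f ->
  dv p (a *: v + w) f = a * dv p v f + dv p w f.
Proof.
move=> fs; rewrite !dvE// mulr_sumr -big_split /=; apply: eq_bigr => j _.
by rewrite !mxE mulrDl mulrA.
Qed.

Lemma dv_sum p f (I : finType) (a : I -> R) (v : I -> 'rV[R]_n) : msmooth p f ->
  dv p (\sum_i a i *: v i) f = \sum_i a i * dv p (v i) f.
Proof.
move=> fs; rewrite dvE// (eq_bigr (fun i => \sum_j a i * (v i 0 j * 'D_(delta_mx 0 j)
   (f \o bwd (chart_at p)) (fwd (chart_at p) p)))); last first.
  by move=> i _; rewrite dvE// mulr_sumr.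
rewrite exchange_big /=; apply: eq_bigr => j _; rewrite summxE mulr_suml.
by apply: eq_bigr => i _; rewrite !mxE mulrA.
Qed.

Lemma near_eq_dv p v f g : (\forall q \near p, f q = g q) -> dv p v f = dv p v g.
Proof.
move=> fg; rewrite !dv_unlock; apply: near_eq_derive.
exact: near_bwd (chart_at_atlas p) (chart_at_dom p) fg.
Qed.

Lemma msmooth_derivable p f v : msmooth p f ->
  derivable (f \o bwd (chart_at p)) (fwd (chart_at p) p) v.
Proof.
move=> fs; apply: diff_derivable; apply: (@C_germ_differentiable _ _ 0).
exact: smooth_at_C_germ.
Qed.

Lemma dv_cst p v (a : R) : dv p v (fun=> a) = 0.
Proof. by rewrite dv_unlock; exact: derive_cst. Qed.

Lemma dvD p v f g : msmooth p f -> msmooth p g ->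
  dv p v (fun q => f q + g q) = dv p v f + dv p v g.
Proof.
by move=> fs gs; rewrite !dv_unlock; exact: deriveD (msmooth_derivable fs) (msmooth_derivable gs).
Qed.

Lemma dvM p v f g : msmooth p f -> msmooth p g ->
  dv p v (fun q => f q * g q) = f p * dv p v g + g p * dv p v f.
Proof.
move=> fs gs; rewrite !dv_unlock.
have := @deriveM _ _ _ _ _ v (msmooth_derivable fs) (msmooth_derivable gs).
by rewrite /= (chart_fwdK (chart_at_atlas p) (chart_at_dom p)).
Qed.

Lemma tcoordE c p v l : atlas M c -> dom c p ->
  tcoord c p v 0 l = dv p v (fun q => fwd c q 0 l).
Proof.
move=> cA cp; rewrite dv_unlock; apply: derive_coord => j.
exact: msmooth_derivable (msmooth_coord j cA cp).
Qed.

Lemma dv_chart c p v f : atlas M c -> dom c p -> msmooth p f -> dv p v f =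
  \sum_l tcoord c p v 0 l * 'D_(delta_mx 0 l) (f \o bwd c) (fwd c p).
Proof.
move=> cA cp fs; have cA0 := chart_at_atlas p; have cp0 := chart_at_dom p.
pose x0 := fwd (chart_at p) p.
have E : dv p v f = 'D_v ((f \o bwd c) \o (fwd c \o bwd (chart_at p))) x0.
  rewrite dv_unlock; apply: near_eq_derive.
  by apply: filterS (near_bwd cA0 cp0 (near_dom cA cp)) => x cx /=; rewrite chart_fwdK.
have xE : (fwd c \o bwd (chart_at p)) x0 = fwd c p by rewrite /= chart_fwdK.
rewrite E (@chain_rule _ _ _ 0); first last.
- move=> l; apply: (@C_germ_differentiable _ _ 0).
  by apply: smooth_at_C_germ; exact: transition_smooth.
- by rewrite xE; apply/smooth_at_C_germ/msmooth_in_chart.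
by apply: eq_bigr => l _; rewrite xE (tcoordE _ _ cA cp) dv_unlock.
Qed.

Lemma tcoord_chart_at p v : tcoord (chart_at p) p v = v.
Proof.
have cA := chart_at_atlas p; have cp := chart_at_dom p.
apply/rowP => l; rewrite tcoordE// dv_unlock.
have -> : 'D_v ((fun q => fwd (chart_at p) q 0 l) \o bwd (chart_at p)) (fwd (chart_at p) p) =
   'D_v (fun x : 'rV[R]_n => x 0 l) (fwd (chart_at p) p).
  apply: near_eq_derive.
  by apply: filterS (near_bwdK cA cp) => x [_ /= ->].
exact: derive_rV_coord.
Qed.

(** Coordinate functions already separate tangent vectors. Identities between vectors are mostly
    proved by acting on an arbitrary germ. *)
Lemma dv_inj p v w :
  (forall f, msmooth p f -> dv p v f = dv p w f) -> v = w.
Proof.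
move=> vw; rewrite -(tcoord_chart_at p v) -(tcoord_chart_at p w).
have cA := chart_at_atlas p; have cp := chart_at_dom p.
by apply/rowP => l; rewrite !(tcoordE _ _ cA cp); apply: vw; exact: msmooth_coord cA cp.
Qed.

(** Equivalent to smooth components in any chart around [p], by [vsmooth_vrep] and
    [vsmooth_of_vrep]. The constructor keeps the quantified statement from being unfolded. *)
Variant vsmooth p X : Prop :=
  Vsmooth of forall f, msmooth p f -> msmooth p (fun q => dv q (X q) f).

Lemma vsmooth_dv p X f : vsmooth p X -> msmooth p f ->
  msmooth p (fun q => dv q (X q) f).
Proof. by case=> Xs; exact: Xs. Qed.

Lemma vrep_near c p X : atlas M c -> dom c p -> forall l,
  \forall x \near fwd c p, vrep c X x 0 l =
    ((fun q => dv q (X q) (fun z => fwd c z 0 l)) \o bwd c) x.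
Proof.
move=> cA cp l; apply: filterS (near_bwdK cA cp) => x [cx _] /=.
by rewrite /vrep tcoordE.
Qed.

Lemma vsmooth_vrep c p X l : atlas M c -> dom c p -> vsmooth p X ->
  smooth_at (fwd c p) (fun x => vrep c X x 0 l).
Proof.
move=> cA cp Xs; have := msmooth_in_chart cA cp (vsmooth_dv Xs (msmooth_coord l cA cp)).
by apply: near_eq_smooth_at; apply: filterS (vrep_near X cA cp l) => x ->.
Qed.

Lemma dv_vrep c p X f : atlas M c -> dom c p -> msmooth p f ->
  \forall x \near fwd c p, dv (bwd c x) (X (bwd c x)) f =
    \sum_l vrep c X x 0 l * 'D_(delta_mx 0 l) (f \o bwd c) x.
Proof.
move=> cA cp fs; have := near_bwd cA cp (msmooth_near fs).
apply: filterS2 (near_bwdK cA cp) => x [cx xK] fx.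
by rewrite (dv_chart _ cA cx fx) xK.
Qed.

Lemma vsmooth_of_vrep c p X : atlas M c -> dom c p ->
  (forall l, smooth_at (fwd c p) (fun x => vrep c X x 0 l)) -> vsmooth p X.
Proof.
move=> cA cp Xs; split=> f fs; apply: (msmooth_chart cA cp).
have S : smooth_at (fwd c p) (fun x => \sum_l vrep c X x 0 l * 'D_(delta_mx 0 l) (f \o bwd c) x).
  apply/smooth_atP; have : \forall y \near fwd c p, forall l : 'I_n,
      smooth_at y (fun x => vrep c X x 0 l).
    apply: near_forall.
    by move=> l; exact: smooth_at_near (Xs l).
  apply: filterS2 (smooth_at_near (msmooth_in_chart cA cp fs)) => y fy Xy k.
  apply: C_germ_sum => l _; apply: C_germM; first exact/smooth_at_C_germ.
  exact/smooth_at_C_germ/smooth_at_derive.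
apply: near_eq_smooth_at S.
by apply: filterS (dv_vrep X cA cp fs) => x /= ->.
Qed.

Lemma smooth_vfield_onP (U : set M) X : open U ->
  smooth_vfield_on U X <-> forall p, U p -> vsmooth p X.
Proof.
move=> oU; split=> [XU p Up|XU c cA l].
  have cA := chart_at_atlas p; have cp := chart_at_dom p.
  apply: (vsmooth_of_vrep cA cp) => l.
  have /smooth_on_open := XU _ cA l; apply; last by exists p.
  exact: chart_image_open.
apply/smooth_on_open; first exact: chart_image_open.
by move=> _ [p [cp Up] <-]; apply: vsmooth_vrep => //; exact: XU.
Qed.

Lemma near_eq_vsmooth p X Y :
  (\forall q \near p, X q = Y q) -> vsmooth p X -> vsmooth p Y.
Proof.
move=> XY Xs; split=> f fs; apply: near_eq_msmooth (vsmooth_dv Xs fs).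
by apply: filterS XY => q ->.
Qed.

Lemma vsmooth_near p X : vsmooth p X -> \forall q \near p, vsmooth q X.
Proof.
move=> Xs; have cA := chart_at_atlas p; have cp := chart_at_dom p.
have : \forall y \near fwd (chart_at p) p, forall l : 'I_n,
    smooth_at y (fun x => vrep (chart_at p) X x 0 l).
  apply: near_forall.
  by move=> l; apply: smooth_at_near; exact: vsmooth_vrep.
move/(near_fwd cA cp); apply: filterS2 (near_dom cA cp) => q cq.
by move/(vsmooth_of_vrep cA cq).
Qed.

Lemma lieE p X Y l :
  (forall j, derivable (fun y => vrep (chart_at p) Y y 0 j) (fwd (chart_at p) p) (X p)) ->
  (forall j, derivable (fun y => vrep (chart_at p) X y 0 j) (fwd (chart_at p) p) (Y p)) ->
  lie X Y p 0 l = 'D_(X p) (fun y => vrep (chart_at p) Y y 0 l) (fwd (chart_at p) p) -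
                  'D_(Y p) (fun y => vrep (chart_at p) X y 0 l) (fwd (chart_at p) p).
Proof.
move=> Yd Xd; rewrite -(derive_coord _ Yd) -(derive_coord _ Xd).
by rewrite [LHS]mxE [X in _ + X]mxE.
Qed.

Lemma lie_dv p X Y f : vsmooth p X -> vsmooth p Y -> msmooth p f ->
  dv p (lie X Y p) f = dv p (X p) (fun q => dv q (Y q) f) -
                       dv p (Y p) (fun q => dv q (X q) f).
Proof.
have cA := chart_at_atlas p; have cp := chart_at_dom p.
set c := chart_at p in cA cp *; pose x := fwd c p; pose F := f \o bwd c.
move=> Xs Ys fs; have Fs : smooth_at x F := fs.
have dF l v : 'D_v (fun y => 'D_(delta_mx 0 l) F y) x =
    \sum_j v 0 j * 'D_(delta_mx 0 j) (fun y => 'D_(delta_mx 0 l) F y) x.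
  by apply: (@C_germ_deriveE _ _ 0); exact/smooth_at_C_germ/smooth_at_derive.
have vrepd Z l v : vsmooth p Z -> derivable (fun y => vrep c Z y 0 l) x v.
  move=> Zs; apply: diff_derivable; apply: (@C_germ_differentiable _ _ 0).
  by apply: smooth_at_C_germ; exact: vsmooth_vrep.
have vrepp Z : vrep c Z x = Z p.
  by rewrite /vrep /x chart_fwdK// tcoord_chart_at.
(* The product rule applied to [Z f], written in coordinates as the sum of [Z^l d_l f]: a
   first-order part plus a part with second derivatives of [f]. *)
have second Z v : vsmooth p Z -> dv p v (fun q => dv q (Z q) f) =
    \sum_l ('D_v (fun y => vrep c Z y 0 l) x * 'D_(delta_mx 0 l) F x +
      Z p 0 l * \sum_j v 0 j * 'D_(delta_mx 0 j) (fun y => 'D_(delta_mx 0 l) F y) x).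
  move=> Zs; rewrite dv_unlock -/c -/x (near_eq_derive v (dv_vrep Z cA cp fs)) -/F.
  have Fd l : derivable (fun y => 'D_(delta_mx 0 l) F y) x v.
    apply: diff_derivable; apply: (@C_germ_differentiable _ _ 0).
    exact/smooth_at_C_germ/smooth_at_derive.
  rewrite -(fct_sumE _ _ (fun l y => vrep c Z y 0 l * 'D_(delta_mx 0 l) F y)).
  rewrite derive_sum => [|l]; last by apply: derivableM => //; exact: vrepd.
  apply: eq_bigr => l _; apply: etrans (deriveM (vrepd Z l v Zs) (Fd l)) _.
  by rewrite -dF vrepp addrC; congr (_ + _); exact: mulrC.
rewrite (second Y)// (second X)// dvE// -/c -/x -/F.
pose H j l := 'D_(delta_mx 0 j) (fun y => 'D_(delta_mx 0 l) F y) x.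
(* The second-order parts of [X (Y f)] and [Y (X f)] agree by Schwarz's theorem. *)
have sym : \sum_l (Y p 0 l * \sum_j X p 0 j * H j l) =
           \sum_l (X p 0 l * \sum_j Y p 0 j * H j l).
  under eq_bigr do rewrite mulr_sumr; under [RHS]eq_bigr do rewrite mulr_sumr.
  rewrite exchange_big /=; apply: eq_bigr => l _; apply: eq_bigr => j _.
  rewrite /H (schwarz l j); first by rewrite !mulrA [Y p 0 j * _]mulrC.
  exact: smooth_at_C_germ.
apply: (@sum_mulBl R 'I_n (fun l => 'D_(X p) (fun y => vrep c Y y 0 l) x)
  (fun l => 'D_(Y p) (fun y => vrep c X y 0 l) x) _ _
  (fun l => lie X Y p 0 l) (fun l => 'D_(delta_mx 0 l) F x) sym) => l.
by apply: lieE => j; exact: vrepd.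
Qed.

(** Locked for the same reason as [dv]. *)
Definition lie_br := locked (@lie R n M).

Lemma lie_brE X Y : lie_br X Y = lie X Y.
Proof. by rewrite /lie_br -lock. Qed.

Lemma lie_br_dv p X Y f : vsmooth p X -> vsmooth p Y -> msmooth p f ->
  dv p (lie_br X Y p) f = dv p (X p) (fun q => dv q (Y q) f) -
                          dv p (Y p) (fun q => dv q (X q) f).
Proof. by rewrite lie_brE; exact: lie_dv. Qed.

Lemma lie_br_vsmooth p X Y : vsmooth p X -> vsmooth p Y -> vsmooth p (lie_br X Y).
Proof.
move=> Xs Ys; split=> f fs.
have S : msmooth p (fun q => dv q (X q) (fun z => dv z (Y z) f) -
                             dv q (Y q) (fun z => dv z (X z) f)).
  by apply: msmoothB; do 2![apply: vsmooth_dv => //].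
apply: near_eq_msmooth S.
apply: filterS3 (vsmooth_near Xs) (vsmooth_near Ys) (msmooth_near fs) => q Xq Yq fq.
by rewrite lie_br_dv.
Qed.

End Derivations.

(** * Smooth maps, smooth linear systems and bump functions *)

Section SmoothMaps.
Context (R : realType) (m n : nat) (N : manifold R m) (Z : manifold R n).
Context (i : N -> Z).
Hypothesis iS : smooth_map i.

Lemma smooth_map_near q (P : set Z) :
  (\forall p \near i q, P p) -> \forall q' \near q, P (i q').
Proof. by case: iS => ic _; apply: (@near_fun _ _ i q P); exact: ic. Qed.

Lemma smooth_map_coord c c' q l : atlas N c -> dom c q -> atlas Z c' -> dom c' (i q) ->
  smooth_at (fwd c q) (fun x => fwd c' (i (bwd c x)) 0 l).
Proof.
move=> cA cq cA' cq'; case: iS => ic /(_ c c' cA cA' l).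
have [oc' _ _ _ _] := atlas_chart cA'.
move/smooth_on_open; apply; last by exists q.
by apply: chart_image_open => //; move/continuousP : ic; exact.
Qed.

Lemma msmooth_comp q f : msmooth (i q) f -> msmooth q (f \o i).
Proof.
move=> fs; have cA := chart_at_atlas q; have cq := chart_at_dom q.
have cA' := chart_at_atlas (i q); have cq' := chart_at_dom (i q).
pose c := chart_at q; pose c' := chart_at (i q).
have S : smooth_at (fwd c q) ((f \o bwd c') \o (fwd c' \o i \o bwd c)).
  apply: smooth_at_comp => /=; first by rewrite (chart_fwdK cA cq).
  by move=> l; exact: smooth_map_coord.
apply: near_eq_smooth_at S.
apply: filterS (near_bwd cA cq (smooth_map_near (near_dom cA' cq'))) => x cx /=.
by rewrite (chart_fwdK cA' cx).
Qed.

Lemma dv_tmap q v f : msmooth (i q) f -> dv (i q) (tmap i q v) f = dv q v (f \o i).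
Proof.
move=> fs; have cA := chart_at_atlas q; have cq := chart_at_dom q.
have cA' := chart_at_atlas (i q); have cq' := chart_at_dom (i q).
pose c := chart_at q; pose c' := chart_at (i q).
have xE : (fwd c' \o i \o bwd c) (fwd c q) = fwd c' (i q).
  by rewrite /= (chart_fwdK cA cq).
have gd l : differentiable (fun x => (fwd c' \o i \o bwd c) x 0 l) (fwd c q).
  apply: (@C_germ_differentiable _ _ 0); apply: smooth_at_C_germ.
  exact: smooth_map_coord.
have -> : dv q v (f \o i) = 'D_v ((f \o bwd c') \o (fwd c' \o i \o bwd c)) (fwd c q).
  rewrite dv_unlock; apply: near_eq_derive.
  apply: filterS (near_bwd cA cq (smooth_map_near (near_dom cA' cq'))) => x cx /=.
  by rewrite (chart_fwdK cA' cx).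
rewrite (@chain_rule _ _ _ 0)//; last by rewrite xE; exact: smooth_at_C_germ.
rewrite dvE//; apply: eq_bigr => l _; rewrite xE; congr (_ * _).
by apply: derive_coord => j; apply: diff_derivable.
Qed.

Definition push := locked (@tmap R m n N Z i).

Lemma pushE q v : push q v = tmap i q v.
Proof. by rewrite /push -lock. Qed.

Lemma dv_push q v f : msmooth (i q) f -> dv (i q) (push q v) f = dv q v (f \o i).
Proof. by rewrite pushE; exact: dv_tmap. Qed.

(** Inherited from linearity of [dv] in the vector, since a pushed vector acts by composition with
    [i]. *)
Lemma push_linear q (a : R) v w :
  push q (a *: v + w) = a *: push q v + push q w.
Proof.
apply: (@dv_inj _ _ Z (i q)) => f fs; rewrite [RHS](dv_linear _ _ _ fs) !(dv_push _ fs).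
by rewrite (dv_linear _ _ _ (msmooth_comp fs)).
Qed.

End SmoothMaps.

(** * Smooth dependence of solutions of linear systems *)

Section SmoothMatrices.
Context (R : realType) (n : nat) (M : manifold R n).
Implicit Types (p q : M).

Definition mxsmooth k m p (A : M -> 'M[R]_(k, m)) : Prop :=
  forall a b, msmooth p (fun q => A q a b).

Lemma mxsmooth_mul k m l p (A : M -> 'M[R]_(k, m)) (B : M -> 'M[R]_(m, l)) :
  mxsmooth p A -> mxsmooth p B -> mxsmooth p (fun q => A q *m B q).
Proof.
move=> As Bs a b.
have S : msmooth p (fun q => \sum_j A q a j * B q j b).
  apply: msmooth_big => [f g|j _]; first exact: msmoothD.
  exact: msmoothM.
by apply: near_eq_msmooth S; near=> q; rewrite mxE.
Unshelve. all: by end_near. Qed.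

Lemma msmooth_det k p (A : M -> 'M[R]_k) :
  mxsmooth p A -> msmooth p (fun q => \det (A q)).
Proof.
move=> As; apply: msmooth_big => [f g|s _]; first exact: msmoothD.
apply: msmoothM; first exact: msmooth_cst.
by apply: msmooth_big => [f g|j _]; [exact: msmoothM|exact: As].
Qed.

Lemma mxsmooth_adj k p (A : M -> 'M[R]_k) :
  mxsmooth p A -> mxsmooth p (fun q => \adj (A q)).
Proof.
move=> As a b.
have S : msmooth p (fun q => (-1) ^+ (b + a) * \det (row' b (col' a (A q)))).
  apply: msmoothM; first exact: msmooth_cst.
  apply: msmooth_det => a' b'; apply: near_eq_msmooth (As (lift b a') (lift a b')).
  by near=> q; rewrite !mxE.
by apply: near_eq_msmooth S; near=> q; rewrite mxE.
Unshelve. all: by end_near. Qed.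

(** A constant right inverse [B] of [A p] turns the rectangular system into the square one with
    matrix [A q *m B]. Its determinant is 1 at [p], so it is nonzero nearby, and the adjugate
    expresses the solution smoothly. *)
Lemma mxsmooth_solve k m p (A : M -> 'M[R]_(k, m)) (b : M -> 'rV[R]_m) (a : M -> 'rV[R]_k) :
  mxsmooth p A -> mxsmooth p b -> row_free (A p) ->
  (\forall q \near p, a q *m A q = b q) -> mxsmooth p a.
Proof.
move=> As bs /row_freeP[B AB] aA; pose G q := A q *m B.
have Bs : mxsmooth p (fun=> B) by move=> i j; exact: msmooth_cst.
have Gs : mxsmooth p G by exact: mxsmooth_mul.
have ds := msmooth_det Gs.
have d0 : \forall q \near p, \det (G q) != 0.
  apply: (@near_fun _ _ (fun q => \det (G q)) p (fun z => z != 0)).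
    exact: msmooth_continuous.
  apply: (@open_nbhs_nbhs _ _ [set z | z != 0]); split; first exact: open_neq.
  by rewrite /G AB /= det1 oner_neq0.
have bs' := mxsmooth_mul (mxsmooth_mul bs Bs) (mxsmooth_adj Gs).
move=> i j; have S : msmooth p (fun q => (\det (G q))^-1 * (b q *m B *m \adj (G q)) i j).
  by apply: msmoothM; [exact: msmoothV (nbhs_singleton d0) ds|exact: bs'].
apply: near_eq_msmooth S; apply: filterS2 aA d0 => q <- dq.
rewrite -(mulmxA (a q)) -/(G q) -mulmxA mul_mx_adj mul_mx_scalar mxE mulrA.
by rewrite mulVf// mul1r.
Qed.

End SmoothMatrices.

(** * Bump functions *)

Section Bump.
Context (R : realType).

Definition smooth_step (t : R) : R := flat 0 t / (flat 0 t + flat 0 (1 - t)).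

Lemma smooth_step_den_gt0 t : 0 < flat 0 t + flat 0 (1 - t) :> R.
Proof.
have [t0|t0] := ltP 0 t; first by rewrite ltr_pwDl ?flat_pos// flat_ge0.
by rewrite ltr_wpDl ?flat_ge0// flat_pos// subr_gt0 (le_lt_trans t0).
Qed.

Lemma smooth_step0 t : t <= 0 -> smooth_step t = 0 :> R.
Proof. by move=> t0; rewrite /smooth_step {1}/flat ltNge t0 mul0r. Qed.

Lemma smooth_step1 t : 1 <= t -> smooth_step t = 1 :> R.
Proof.
move=> t1; have := smooth_step_den_gt0 t; rewrite /smooth_step.
have -> : flat 0 (1 - t) = 0 :> R by rewrite /flat subr_gt0 ltNge t1.
by rewrite addr0 => /lt0r_neq0 ?; rewrite divff.
Qed.

Context (n : nat) (M : manifold R n).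
Implicit Types (p q : M).

Lemma msmooth_step p (f : M -> R) :
  msmooth p f -> msmooth p (fun q => smooth_step (f q)).
Proof.
move=> fs; have f1 : msmooth p (fun q => 1 - f q) by apply: msmoothB => //; exact: msmooth_cst.
have S := msmoothD (msmooth_flat 0 fs) (msmooth_flat 0 f1).
apply: msmoothM; first exact: msmooth_flat.
by apply: msmoothV => //; rewrite gt_eqF ?smooth_step_den_gt0.
Qed.

(** The last clause places the support inside [U] in the form used for extension by zero: each point
    is in [U] or has a neighbourhood where [chi] vanishes. *)
Lemma bump_function p (U : set M) : nbhs p U -> exists chi : M -> R,
  [/\ forall q, msmooth q chi, \forall q \near p, chi q = 1 &
      forall q, U q \/ \forall q' \near q, chi q' = 0].
Proof.
move=> pU; pose c := chart_at p; have cA : atlas M c := chart_at_atlas p.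
have cp : dom c p := chart_at_dom p; pose x0 := fwd c p.
(* The squared Euclidean distance, because the norm of row vectors is the maximum norm and is not
   smooth. *)
pose sigma (x : 'rV[R]_n) : R := \sum_j (x 0 j - x0 0 j) ^+ 2.
have sigma_coord (x : 'rV[R]_n) j : (x 0 j - x0 0 j) ^+ 2 <= sigma x.
  rewrite /sigma (bigD1 j)//= lerDl; apply: sumr_ge0 => l _; exact: sqr_ge0.
have sigma_cont : continuous sigma.
  move=> x; apply: (@smooth_at_continuous _ _ x sigma).
  apply/smooth_atP; near=> y => k; apply: C_germ_sum => j _; apply: C_germM.
    by apply: C_germD; [exact: C_germ_coord|exact: C_germ_cst].
  by apply: C_germD; [exact: C_germ_coord|exact: C_germ_cst].
have : \forall x \near x0, (dom c (bwd c x) /\ fwd c (bwd c x) = x) /\ U (bwd c x).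
  by apply: filterI; [exact: near_bwdK|exact: near_bwd].
move=> /nbhs_ballP[d /= d0 dP].
(* On [K] one has [sigma <= d ^ 2 / 2], so each coordinate differs from that of [x0] by at most
   [3 d / 4], whose square is [9 d ^ 2 / 16]. *)
pose rho := d ^+ 2 / 4.
have rho0 : 0 < rho by rewrite divr_gt0// exprn_gt0.
pose K := [set x : 'rV[R]_n | sigma x <= rho *+ 2].
have Kball x : K x -> ball x0 d x.
  move=> Kx; rewrite -ball_normE /=; case: (ltP `|x0 - x| d) => // dx; exfalso.
  have : `|x0 - x| <= d / 2 + d / 4.
    have d34 : 0 <= d / 2 + d / 4 by lra.
    apply: rV_norm_le => // j; rewrite !mxE distrC -ler_sqr ?nnegrE//.
    rewrite real_normK ?num_real//.
    apply: le_trans (sigma_coord x j) _; apply: le_trans Kx _; rewrite /rho; nra.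
  lra.
have Kc : compact K.
  apply: bounded_closed_compact; last first.
    exact: (closed_comp (fun x _ => sigma_cont x) (@closed_le R (rho *+ 2))).
  exists (`|x0| + d); split; first exact: num_real.
  move=> b bd x /Kball; rewrite -ball_normE /= => xd.
  apply: le_trans (ltW bd); rewrite -(subrK x0 x) addrC.
  by rewrite (le_trans (ler_normD _ _))// lerD2l distrC ltW.
have bwdc x : K x -> {for x, continuous (bwd c)}.
  move=> /Kball/dP[[cx xK] _]; have [_ _ _ _ bc] := atlas_chart cA.
  by apply: bc; exists (bwd c x).
(* The Hausdorff property enters here: the compact image of [K] is closed in [M], so [chi] vanishes
   near every point outside it, even at the boundary of the chart domain. *)
have Mc : closed (bwd c @` K).
  apply: (compact_closed (@manifold_hausdorff _ _ M)); apply: continuous_compact => //.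
  by apply: continuous_in_subspaceT => x /set_mem /bwdc.
(* Equal to 1 for [sigma <= rho] and to 0 for [sigma >= 2 rho]. *)
pose chi0 x : R := smooth_step (2 - sigma x / rho).
pose chi q : R := if pselect (dom c q) then chi0 (fwd c q) else 0.
have chiE q : dom c q -> chi q = chi0 (fwd c q).
  by rewrite /chi; case: pselect.
have out q : ~ (bwd c @` K) q -> \forall q' \near q, chi q' = 0.
  move=> qK; have : nbhs q (~` (bwd c @` K)).
    by apply: open_nbhs_nbhs; split=> //; rewrite openC.
  apply: filterS => z zK; rewrite /chi; case: pselect => // cz.
  apply: smooth_step0; rewrite subr_le0 ler_pdivlMr// mulr_natl leNgt.
  apply/negP => sz; apply: zK; exists (fwd c z); last exact: chart_fwdK.
  exact: ltW.
exists chi; split.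
- move=> q; have [[x Kx <-]|qK] := pselect ((bwd c @` K) q); last first.
    by apply: near_eq_msmooth (msmooth_cst q 0); apply: filterS (out q qK) => z ->.
  have [[cx xK] _] := dP _ (Kball x Kx).
  have S : msmooth (bwd c x) (fun q => smooth_step (2 - sigma (fwd c q) / rho)).
    apply: msmooth_step; apply: msmoothB; first exact: msmooth_cst.
    apply: msmoothM; last exact: msmooth_cst.
    apply: msmooth_big => [f g|j _]; first exact: msmoothD.
    have D : msmooth (bwd c x) (fun q => fwd c q 0 j - x0 0 j).
      by apply: msmoothB; [exact: msmooth_coord|exact: msmooth_cst].
    exact: msmoothM.
  apply: near_eq_msmooth S; apply: filterS (near_dom cA cx) => z cz.
  by rewrite chiE.
- have : \forall x \near x0, sigma x < rho.
    apply: (@near_fun _ _ sigma x0 (fun z => z < rho)); first exact: sigma_cont.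
    apply: lt_nbhsl; rewrite /sigma big1// => j _.
    by rewrite subrr expr0n.
  move/(near_fwd cA cp); apply: filterS2 (near_dom cA cp) => q cq sq.
  rewrite chiE// /chi0 smooth_step1// lerBrDr -lerBrDl.
  by rewrite ler_pdivrMr//; lra.
- move=> q; have [[x Kx <-]|qK] := pselect ((bwd c @` K) q); last by right; exact: out.
  by left; have [_] := dP _ (Kball x Kx).
Unshelve. all: by end_near. Qed.

End Bump.
Lemma vderivE (R : realType) (n : nat) (M : manifold R n) (X : vfield M) f p :
  vderiv X f p = dv p (X p) f.
Proof. by rewrite dv_unlock. Qed.

(** * Sections of an involutive subbundle *)

Section VectorFields.
Context (R : realType) (n : nat) (M : manifold R n).
Implicit Types (p q : M) (X Y : vfield M) (E : M -> {vspace 'rV[R]_n}).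

Lemma vsmooth0 p : vsmooth p (fun=> 0 : 'rV[R]_n).
Proof.
split=> f fs; apply: near_eq_msmooth (msmooth_cst p 0).
apply: filterS (msmooth_near fs) => q fq.
by rewrite dvE// big1// => j _; rewrite mxE mul0r.
Qed.

Lemma vsmoothZD p (a : M -> R) X Y : msmooth p a -> vsmooth p X -> vsmooth p Y ->
  vsmooth p (fun q => a q *: X q + Y q).
Proof.
move=> as_ Xs Ys; split=> f fs.
have S := msmoothD (msmoothM as_ (vsmooth_dv Xs fs)) (vsmooth_dv Ys fs).
apply: near_eq_msmooth S; apply: filterS (msmooth_near fs) => q fq.
by rewrite (dv_linear _ _ _ fq).
Qed.

Lemma vsmoothZ p (a : M -> R) X : msmooth p a -> vsmooth p X ->
  vsmooth p (fun q => a q *: X q).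
Proof.
move=> as_ Xs; apply: near_eq_vsmooth (vsmoothZD as_ Xs (vsmooth0 p)).
by near=> q; rewrite addr0.
Unshelve. all: by end_near. Qed.

Lemma vsmooth_sum p (I : Type) (r : seq I) (a : I -> M -> R) (X : I -> vfield M) :
  (forall i, msmooth p (a i)) -> (forall i, vsmooth p (X i)) ->
  vsmooth p (fun q => \sum_(i <- r) a i q *: X i q).
Proof.
move=> as_ Xs; elim: r => [|i r IH].
  by apply: near_eq_vsmooth (vsmooth0 p); near=> q; rewrite big_nil.
apply: near_eq_vsmooth (vsmoothZD (as_ i) (Xs i) IH).
by near=> q; rewrite big_cons.
Unshelve. all: by end_near. Qed.

Lemma section_onP E (U : set M) X : open U ->
  section_on E U X <-> forall p, U p -> vsmooth p X /\ X p \in E p.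
Proof.
move=> oU; split=> [[/smooth_vfield_onP XU XE] p Up|XU].
  by split; [exact: XU|exact: XE].
split=> [|p /XU[]//]; apply/smooth_vfield_onP => // p /XU[].
by [].
Qed.

Lemma global_sectionP E X :
  global_section E X <-> forall p, vsmooth p X /\ X p \in E p.
Proof.
split=> [/section_onP XE p|XE]; first by apply: XE => //; exact: openT.
by apply/section_onP => // ; exact: openT.
Qed.

Definition section_germ E p X : Prop :=
  \forall q \near p, vsmooth q X /\ X q \in E q.

Lemma section_germ_near E p X : section_germ E p X -> \forall q \near p, section_germ E q X.
Proof. exact: near_join. Qed.

Lemma section_germ_vsmooth E p X : section_germ E p X -> vsmooth p X.
Proof. by move=> /nbhs_singleton[]. Qed.

Lemma section_germ_in E p X : section_germ E p X -> X p \in E p.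
Proof. by move=> /nbhs_singleton[]. Qed.

Lemma global_section_germ E p X : global_section E X -> section_germ E p X.
Proof. by move=> /global_sectionP XE; near=> q; exact: XE. Unshelve. all: by end_near. Qed.

Lemma near_eq_section_germ E p X Y :
  (\forall q \near p, X q = Y q) -> section_germ E p X -> section_germ E p Y.
Proof.
move=> XY; apply: filterS2 (near_join XY) => q XYq [Xs Xin].
by split; [exact: near_eq_vsmooth Xs|rewrite -(nbhs_singleton XYq)].
Qed.

Lemma section_germZD E p (a : M -> R) X Y : msmooth p a ->
  section_germ E p X -> section_germ E p Y ->
  section_germ E p (fun q => a q *: X q + Y q).
Proof.
move=> /msmooth_near; apply: filterS3 => q aq [Xs XE] [Ys YE].
by split; [exact: vsmoothZD|rewrite memvD// memvZ].
Qed.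

Lemma section_germ_sum E p (I : finType) (a : I -> M -> R) (X : I -> vfield M) :
  (forall i, msmooth p (a i)) -> (forall i, section_germ E p (X i)) ->
  section_germ E p (fun q => \sum_i a i q *: X i q).
Proof.
move=> as_ Xs.
have : \forall q \near p, forall i, msmooth q (a i).
  by apply: near_forall => i; exact: msmooth_near.
have : \forall q \near p, forall i, vsmooth q (X i) /\ X i q \in E q.
  exact: near_forall.
apply: filterS2 => q Xq aq; split; first by apply: vsmooth_sum => i //; case: (Xq i).
by apply: memv_suml => i _; rewrite memvZ//; case: (Xq i).
Qed.

(** A bump function supported where [X] is a smooth section cuts [X] off; at other points the
    product is locally zero, whatever [X] is there. *)
Lemma section_germ_extend E p X : section_germ E p X ->
  exists2 Y, global_section E Y & \forall q \near p, Y q = X q.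
Proof.
move=> Xp; have [chi [chis chi1 chi0]] := bump_function Xp.
exists (fun q => chi q *: X q); last first.
  by apply: filterS chi1 => q ->; rewrite scale1r.
apply/global_sectionP => q; case: (chi0 q) => [[Xs XE]|q0].
  by split; [exact: vsmoothZ|rewrite memvZ].
split; last by rewrite (nbhs_singleton q0) scale0r mem0v.
by apply: near_eq_vsmooth (vsmooth0 q); apply: filterS q0 => z ->; rewrite scale0r.
Qed.

End VectorFields.

(** * Vector fields along a map *)

Section VectorsAlongMaps.
Context (R : realType) (m n : nat) (N : manifold R m) (Z : manifold R n).
Implicit Types (i : N -> Z) (q : N).

(** Smoothness at [q] of a section of the tangent bundle of [Z] pulled back by [i]. *)
Definition vsmooth_along i q (V : N -> 'rV[R]_n) : Prop :=
  forall f, msmooth (i q) f -> msmooth q (fun q' => dv (i q') (V q') f).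

(* In coordinates the coefficients solve a linear system of full row rank, and
   Cramer's rule applies. *)
Lemma msmooth_coef i q k (W : 'I_k -> N -> 'rV[R]_n) (V : N -> 'rV[R]_n)
    (a : 'I_k -> N -> R) :
  {for q, continuous i} ->
  (forall l, vsmooth_along i q (W l)) -> vsmooth_along i q V ->
  (forall u : 'I_k -> R, \sum_l u l *: W l q = 0 -> forall l, u l = 0) ->
  (\forall q' \near q, V q' = \sum_l a l q' *: W l q') ->
  forall l, msmooth q (a l).
Proof.
move=> ic Ws Vs freeW Va l.
have cA := chart_at_atlas (i q); have cq := chart_at_dom (i q).
set c := chart_at (i q) in cA cq; pose z j (p : Z) := fwd c p 0 j.
pose A q' := \matrix_(l, j) dv (i q') (W l q') (z j).
pose b q' := \row_j dv (i q') (V q') (z j).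
pose ar q' := \row_l a l q'.
have zs j : msmooth (i q) (z j) by exact: msmooth_coord.
suff arS : mxsmooth q ar.
  by apply: near_eq_msmooth (arS 0 l); near=> q'; rewrite mxE.
apply: (@mxsmooth_solve _ _ _ _ _ q A b ar).
- by move=> l' j; apply: near_eq_msmooth (Ws l' _ (zs j)); near=> q'; rewrite mxE.
- by move=> l' j; apply: near_eq_msmooth (Vs _ (zs j)); near=> q'; rewrite mxE.
- apply: inj_row_free => u uA; apply/rowP => l'; rewrite mxE.
  have AE l1 j : A q l1 j = W l1 q 0 j by rewrite mxE -tcoordE// tcoord_chart_at.
  apply: (freeW (fun l1 => u 0 l1)); apply/rowP => j; rewrite summxE mxE.
  transitivity ((u *m A q) 0 j); last by rewrite uA mxE.
  by rewrite mxE; apply: eq_bigr => l1 _; rewrite AE mxE.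
- apply: filterS2 Va (near_fun _ _ _ ic (near_dom cA cq)) => q' VE cq'.
  apply/rowP => j; rewrite !mxE VE dv_sum; last exact: msmooth_coord.
  by apply: eq_bigr => l' _; rewrite !mxE.
Unshelve. all: by end_near. Qed.

End VectorsAlongMaps.

(** * Local frames and involutive subbundles *)

Section Frames.
Context (R : realType) (n : nat) (M : manifold R n).
Implicit Types (p q : M) (X Y : vfield M) (E : M -> {vspace 'rV[R]_n})
  (c : chart R M n).

(** The coordinate field of the chart [c] in direction [l], written in the preferred chart of each
    point. *)
Definition coord_field c (l : 'I_n) : vfield M := fun q =>
  'D_(delta_mx 0 l) (fwd (chart_at q) \o bwd c) (fwd c q).

Lemma dv_coord_field c l q f : atlas M c -> dom c q -> msmooth q f ->
  dv q (coord_field c l q) f = 'D_(delta_mx 0 l) (f \o bwd c) (fwd c q).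
Proof.
move=> cA cq fs; have cA0 := chart_at_atlas q; have cq0 := chart_at_dom q.
pose c0 := chart_at q.
have gd j : differentiable (fun x => (fwd c0 \o bwd c) x 0 j) (fwd c q).
  apply: (@C_germ_differentiable _ _ 0); apply: smooth_at_C_germ.
  exact: transition_smooth.
have -> : 'D_(delta_mx 0 l) (f \o bwd c) (fwd c q) =
    'D_(delta_mx 0 l) ((f \o bwd c0) \o (fwd c0 \o bwd c)) (fwd c q).
  apply: near_eq_derive.
  by apply: filterS (near_bwd cA cq (near_dom cA0 cq0)) => x cx /=; rewrite (chart_fwdK cA0 cx).
have xE : (fwd c0 \o bwd c) (fwd c q) = fwd c0 q by rewrite /= (chart_fwdK cA cq).
rewrite (@chain_rule _ _ _ 0)//; last by rewrite xE; exact: smooth_at_C_germ.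
rewrite dvE//; apply: eq_bigr => j _; rewrite xE; congr (_ * _).
by apply: derive_coord => j'; apply: diff_derivable.
Qed.

Lemma coord_field_vsmooth c l q : atlas M c -> dom c q -> vsmooth q (coord_field c l).
Proof.
move=> cA cq; split=> f fs; apply: (msmooth_chart cA cq).
apply: near_eq_smooth_at (smooth_at_derive l (msmooth_in_chart cA cq fs)).
apply: filterS2 (near_bwdK cA cq) (near_bwd cA cq (msmooth_near fs)) => x [cx xK] fx /=.
by rewrite (dv_coord_field l cA cx fx) xK.
Qed.

Lemma coord_field_expand c q v : atlas M c -> dom c q ->
  v = \sum_l tcoord c q v 0 l *: coord_field c l q.
Proof.
move=> cA cq; apply: (@dv_inj _ _ M q) => f fs.
rewrite dv_sum// (dv_chart _ cA cq fs); apply: eq_bigr => l _.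
by rewrite (dv_coord_field l cA cq fs).
Qed.

Lemma coord_field_free c q (u : 'I_n -> R) : atlas M c -> dom c q ->
  \sum_l u l *: coord_field c l q = 0 -> forall l, u l = 0.
Proof.
move=> cA cq u0 j; have zs := msmooth_coord j cA cq.
have D l : dv q (coord_field c l q) (fun z => fwd c z 0 j) = (l == j)%:R.
  rewrite (dv_coord_field l cA cq zs).
  have -> : 'D_(delta_mx 0 l) ((fun z => fwd c z 0 j) \o bwd c) (fwd c q) =
      'D_(delta_mx 0 l) (fun x : 'rV[R]_n => x 0 j) (fwd c q).
    by apply: near_eq_derive; apply: filterS (near_bwdK cA cq) => x [_ /= ->].
  by rewrite derive_rV_coord !mxE eqxx eq_sym.
have := dv_sum u (fun l => coord_field c l q) zs; rewrite u0.
rewrite dvE// big1 => [|l _]; last by rewrite mxE mul0r.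
rewrite (bigD1 j isT) /= D eqxx mulr1 big1 ?addr0// => l /negbTE lj.
by rewrite D lj mulr0.
Qed.

Definition frame_germ E p k (Y : 'I_k -> vfield M) : Prop :=
  \forall q \near p, [/\ forall l, vsmooth q (Y l),
    forall u : 'I_k -> R, \sum_l u l *: Y l q = 0 -> forall l, u l = 0 &
    forall v, v \in E q <-> exists u : 'I_k -> R, v = \sum_l u l *: Y l q].

Lemma coord_frame p : frame_germ (fun=> fullv) p (coord_field (chart_at p)).
Proof.
have cA := chart_at_atlas p; have cp := chart_at_dom p.
apply: filterS (near_dom cA cp) => q cq; split=> [l|u|v].
- exact: coord_field_vsmooth.
- exact: coord_field_free.
- split=> [_|_]; last exact: memvf.
  by exists (fun l => tcoord (chart_at p) q v 0 l); exact: coord_field_expand.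
Qed.

(** Covers both the full tangent bundle and a foliation, so the de Rham and the leafwise
    differential are treated together. *)
Record involutive_subbundle E : Prop := InvolutiveSubbundle {
  local_frame : forall p, exists k (Y : 'I_k -> vfield M), frame_germ E p Y;
  involutive : forall X Y, global_section E X -> global_section E Y ->
    global_section E (lie_br X Y) }.

Lemma involutive_fullv : involutive_subbundle (fun=> fullv).
Proof.
split=> [p|X Y XE YE]; first by exists n, (coord_field (chart_at p)); exact: coord_frame.
apply/global_sectionP => p; split; last exact: memvf.
have [Xs _] := (global_sectionP _ _).1 XE p.
have [Ys _] := (global_sectionP _ _).1 YE p.
exact: lie_br_vsmooth.
Qed.

Lemma involutive_foliation k (D : foliation M k) : involutive_subbundle D.
Proof.
split; last by move=> X Y XD YD; rewrite lie_brE; exact: tfol_involutive.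
move=> p; have [U [X [oU Up XD DE]]] := tfol_smooth D p; exists k, X.
apply: filterS (open_nbhs_nbhs (conj oU Up)) => q Uq.
pose t := mktuple (fun l => X l q).
have tE : (D q = <<t>>)%VS by rewrite DE.
have tX (l : 'I_k) : t`_l = X l q by rewrite -tnth_nth tnth_mktuple.
split=> [l|u u0 l|v].
- by have /(section_onP _ _ oU)/(_ q Uq)[] := XD l.
(* The constant rank is used here: [k] vectors that span a space of dimension [k] are free. *)
- have ft : free t by rewrite /free -tE tfol_rank size_tuple.
  move/freeP : ft; apply; rewrite -[RHS]u0.
  by apply: eq_bigr => l' _; rewrite tX.
- rewrite tE; split=> [/coord_span ->|[u ->]].
    by exists (fun l => coord t l v); apply: eq_bigr => l _; rewrite tX.
  apply: memv_suml => l _; apply/memvZ/memv_span.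
  by apply/tnthP; exists l; rewrite tnth_mktuple.
Qed.

Context (E : M -> {vspace 'rV[R]_n}) (EI : involutive_subbundle E).

Lemma frame_section_germ p k (Y : 'I_k -> vfield M) l :
  frame_germ E p Y -> section_germ E p (Y l).
Proof.
apply: filterS => q [Ys _ YE]; split=> //; apply/YE.
exists (fun l' => (l' == l)%:R); rewrite (bigD1 l)//= eqxx scale1r big1 ?addr0//.
by move=> j /negbTE ->; rewrite scale0r.
Qed.

Lemma section_germ_coef p k (Y : 'I_k -> vfield M) X :
  frame_germ E p Y -> section_germ E p X ->
  exists a : 'I_k -> M -> R, (forall l, msmooth p (a l)) /\
    \forall q \near p, X q = \sum_l a l q *: Y l q.
Proof.
move=> Yf XE.
(* Choice needs a value at every point; the premise restricts the equation to points where [X] is in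
   the span, and elsewhere the value is 0. *)
have /choice[a aP] : forall q, exists u : 'I_k -> R,
    (exists u, X q = \sum_l u l *: Y l q) -> X q = \sum_l u l *: Y l q.
  move=> q; have [[u uP]|nu] := pselect (exists u : 'I_k -> R, X q = \sum_l u l *: Y l q).
    by exists u.
  by exists (fun=> 0) => /nu.
have Xa : \forall q \near p, X q = \sum_l a q l *: Y l q.
  by apply: filterS2 Yf XE => q [_ _ YE] [_ /YE]; exact: aP.
exists (fun l q => a q l); split=> //.
have [Ys Yfree _] := nbhs_singleton Yf.
apply: (@msmooth_coef _ _ _ M M id p k Y X) => //.
- by move=> l f; exact: vsmooth_dv.
- by move=> f; exact: vsmooth_dv (section_germ_vsmooth XE).
Qed.

Lemma section_germ_through p v : v \in E p ->
  exists2 X, section_germ E p X & X p = v.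
Proof.
move=> vE; have [k [Y Yf]] := local_frame EI p.
have [_ _ YE] := nbhs_singleton Yf; have /YE[u uv] := vE.
exists (fun q => \sum_l u l *: Y l q); last by rewrite uv.
apply: section_germ_sum => l; first exact: msmooth_cst.
exact: frame_section_germ Yf.
Qed.

Lemma global_section_through p v : v \in E p ->
  exists2 X, global_section E X & X p = v.
Proof.
move=> /section_germ_through[X /section_germ_extend[Y YE YX] <-].
by exists Y => //; exact: nbhs_singleton YX.
Qed.

Lemma near_eq_lie p X Y X' Y' : section_germ E p X -> section_germ E p Y ->
  (\forall q \near p, X q = X' q) -> (\forall q \near p, Y q = Y' q) ->
  lie_br X Y p = lie_br X' Y' p.
Proof.
move=> XE YE XX YY; have XE' := near_eq_section_germ XX XE.
have YE' := near_eq_section_germ YY YE.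
apply: (@dv_inj _ _ M p) => f fs.
apply: etrans (lie_br_dv (section_germ_vsmooth XE) (section_germ_vsmooth YE) fs) _.
apply: etrans (esym (lie_br_dv (section_germ_vsmooth XE') (section_germ_vsmooth YE') fs)).
rewrite (nbhs_singleton XX) (nbhs_singleton YY).
apply: (congr2 (fun x y : R => x - y)).
  by apply: near_eq_dv; apply: filterS YY => q ->.
by apply: near_eq_dv; apply: filterS XX => q ->.
Qed.

(** Involutivity is given for global sections only; germs are extended, and the bracket depends only
    on germs. *)
Lemma section_germ_lie p X Y : section_germ E p X -> section_germ E p Y ->
  section_germ E p (lie_br X Y).
Proof.
move=> XE YE; have [X' X'E XX] := section_germ_extend XE.
have [Y' Y'E YY] := section_germ_extend YE.
have LE := global_section_germ p (involutive EI X'E Y'E).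
apply: near_eq_section_germ LE.
apply: filterS2 (near_join XX) (near_join YY) => q XXq YYq.
by apply: near_eq_lie => //; exact: global_section_germ.
Qed.

End Frames.

(** * The Chevalley-Eilenberg differential *)

Section AlternatingFunctions.
Context (R : numDomainType) (A : Type) (n : nat) (S : A -> Prop).
Context (add : A -> A -> A) (T : ('I_n -> A) -> R).
Implicit Types (X : 'I_n -> A) (i j : 'I_n).

Definition upd X i a : 'I_n -> A := fun j => if j == i then a else X j.

Hypothesis S_add : forall a b, S a -> S b -> S (add a b).
Hypothesis T_add : forall X i a b, (forall j, S (X j)) -> S a -> S b ->
  T (upd X i (add a b)) = T (upd X i a) + T (upd X i b).

Definition alternates i j := forall X, (forall l, S (X l)) -> X i = X j -> T X = 0.

Lemma upd_S X i a : (forall j, S (X j)) -> S a -> forall j, S (upd X i a j).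
Proof. by move=> XS aS j; rewrite /upd; case: ifP. Qed.

(** Polarization: expand [T] with the sum of the two arguments placed in both slots. All hypotheses
    are relative to [S], which will be the germs of sections. *)
Lemma swap_of_alternates i j X : i != j -> alternates i j -> (forall l, S (X l)) ->
  T (fun l => X (tperm i j l)) = - T X.
Proof.
move=> ij alt XS; pose B a b := upd (upd X i a) j b.
have BS a b : S a -> S b -> forall l, S (B a b l) by move=> aS bS; do 2![apply: upd_S => //].
have Bi a b : B a b i = a by rewrite /B /upd (negbTE ij) eqxx.
have Bj a b : B a b j = b by rewrite /B /upd eqxx.
have Baa a : S a -> T (B a a) = 0 by move=> aS; apply: alt; [exact: BS|rewrite Bi Bj].
have BC a b : B a b = upd (upd X j b) i a.
  apply/funext => l; rewrite /B /upd; case: (eqVneq l j) => [->|//].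
  by rewrite eq_sym (negbTE ij).
have BDr a b c : S a -> S b -> S c -> T (B a (add b c)) = T (B a b) + T (B a c).
  by move=> aS bS cS; apply: T_add => //; exact: upd_S.
have BDl a b c : S a -> S b -> S c -> T (B (add a b) c) = T (B a c) + T (B b c).
  by move=> aS bS cS; rewrite !BC; apply: T_add => //; exact: upd_S.
have XE : X = B (X i) (X j).
  apply/funext => l; rewrite /B /upd.
  by case: (eqVneq l j) => [->//|_]; case: (eqVneq l i) => [->|].
have XsE : (fun l => X (tperm i j l)) = B (X j) (X i).
  apply/funext => l; rewrite /B /upd.
  case: (eqVneq l j) => [->|lj]; first by rewrite tpermR.
  case: (eqVneq l i) => [->|li]; first by rewrite tpermL.
  by rewrite tpermD// eq_sym.
have := Baa _ (S_add (XS i) (XS j)); rewrite BDr ?BDl//; try exact: S_add.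
rewrite !Baa// add0r addr0 -XE -XsE => /eqP.
by rewrite addrC addr_eq0 => /eqP ->; rewrite opprK.
Qed.

Lemma alternates_sym i j : alternates i j -> alternates j i.
Proof. by move=> alt X XS Xij; apply: alt. Qed.

Lemma alternates_of_adjacent :
  (forall i j, j = i.+1 :> nat -> alternates i j) ->
  forall i j, i != j -> alternates i j.
Proof.
move=> adj; suff lt i j : (i < j)%N -> alternates i j.
  move=> i j; rewrite -val_eqE /= neq_ltn => /orP[/lt//|/lt].
  exact: alternates_sym.
move=> ij; have [d jE] : exists d, j = (i + d).+1 :> nat.
  by exists (j - i.+1)%N; rewrite -addSn subnKC.
elim: d j jE {ij} => [|d IH] j jE; first by apply: adj; rewrite jE addn0.
have j'n : (j.-1 < n)%N by rewrite (leq_ltn_trans (leq_pred _))//.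
pose j' := Ordinal j'n.
have j'E : j' = (i + d).+1 :> nat by rewrite /= jE addnS.
have jj' : j = j'.+1 :> nat by rewrite j'E jE addnS.
have j'j : j' != j by apply/eqP => /(congr1 val) /=; lia.
have ij' : i != j' by apply/eqP => /(congr1 val) /=; lia.
have ij : i != j by apply/eqP => /(congr1 val) /=; lia.
(* Transposing [j] with its predecessor costs a sign and brings the repeated argument one slot
   closer to [i]. *)
move=> X XS Xij; apply: oppr_inj; rewrite oppr0.
rewrite -(swap_of_alternates j'j (adj _ _ jj') XS).
apply: (IH _ j'E) => [l|]; first exact: XS.
by rewrite tpermL tpermD 1?eq_sym.
Qed.

End AlternatingFunctions.

Section PairEnumeration.
Context (r : nat).
Implicit Types (b c i : 'I_r.+1) (m : 'I_r).

(** Slot 0 of the form holds the bracket, so slot [m > 0] holds the index number [m - 1] among those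
    other than [b < c]; the value at [m = 0] is meaningless. *)
Definition pair_idx b c m : 'I_r.+1 := inord (bump c (bump b m.-1)).

Lemma pair_idxE b c m : m != 0%N :> nat ->
  pair_idx b c m = bump c (bump b m.-1) :> nat.
Proof.
move=> m0; rewrite /pair_idx inordK//.
by have := ltn_ord m; rewrite /bump; lia.
Qed.

Lemma pair_idx_neq b c m : (b < c)%N -> m != 0%N :> nat ->
  (pair_idx b c m != b) /\ (pair_idx b c m != c).
Proof.
move=> bc m0; rewrite -!val_eqE /= pair_idxE// /bump.
by split; lia.
Qed.

Lemma pair_idx_inj b c m m' : (b < c)%N -> m != 0%N :> nat -> m' != 0%N :> nat ->
  pair_idx b c m = pair_idx b c m' -> m = m'.
Proof.
move=> bc m0 m0' /(congr1 val); rewrite /= !pair_idxE// /bump => H.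
apply: val_inj => /=; lia.
Qed.

Lemma pair_idx_surj b c i : (b < c)%N -> i != b -> i != c ->
  exists2 m : 'I_r, m != 0%N :> nat & pair_idx b c m = i.
Proof.
rewrite -!val_eqE /= => bc ib ic; pose k := (unbump b (unbump c i)).+1.
have kr : (k < r)%N.
  by have := ltn_ord i; have := ltn_ord c; rewrite /k /unbump; lia.
exists (Ordinal kr) => //; apply: val_inj; rewrite /= pair_idxE//= /k /=.
by rewrite /bump /unbump; lia.
Qed.

End PairEnumeration.

(** * Leibniz rule for the bracket *)

Section LieOfGerms.
Context (R : realType) (n : nat) (M : manifold R n).
Implicit Types (p q : M) (X Y W Z : vfield M) (E : M -> {vspace 'rV[R]_n}).

Lemma lie_anti p X Y : vsmooth p X -> vsmooth p Y -> lie_br X Y p = - lie_br Y X p.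
Proof.
move=> Xs Ys; apply: (@dv_inj _ _ M p) => f fs.
have E0 := dv_linear (-1) (lie_br Y X p) 0 fs; rewrite addr0 scaleN1r in E0.
have V0 : dv p 0 f = 0 by rewrite dvE// big1// => j _; rewrite mxE mul0r.
apply: etrans (lie_br_dv Xs Ys fs) _; apply: etrans (esym E0).
by rewrite V0 addr0 mulN1r (lie_br_dv Ys Xs fs) opprB.
Qed.

Lemma leibniz_rearrange (A : comPzRingType) (a z x s t u w : A) :
  (a * s + t) - (a * u + x * z + w) = - z * x + (a * (s - u) + (t - w)).
Proof. by ring. Qed.

Lemma lie_linearl p (a : M -> R) X Y W Z : msmooth p a -> vsmooth p X -> vsmooth p Y ->
  vsmooth p Z -> (\forall q \near p, W q = a q *: X q + Y q) ->
  lie_br W Z p = a p *: lie_br X Z p + lie_br Y Z p - dv p (Z p) a *: X p.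
Proof.
move=> as_ Xs Ys Zs WE.
have WE' : \forall q \near p, a q *: X q + Y q = W q by apply: filterS WE => q ->.
have Ws := near_eq_vsmooth WE' (vsmoothZD as_ Xs Ys).
apply: (@dv_inj _ _ M p) => f fs.
have Xf := vsmooth_dv Xs fs; have Yf := vsmooth_dv Ys fs; have Zf := vsmooth_dv Zs fs.
have E1 : dv p (Z p) (fun q => dv q (W q) f) =
    a p * dv p (Z p) (fun q => dv q (X q) f) + dv p (X p) f * dv p (Z p) a
    + dv p (Z p) (fun q => dv q (Y q) f).
  rewrite -(dvM _ as_ Xf) -(dvD _ (msmoothM as_ Xf) Yf); apply: near_eq_dv.
  by apply: filterS2 WE (msmooth_near fs) => q -> fq; exact: dv_linear.
have E2 : dv p (W p) (fun q => dv q (Z q) f) =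
    a p * dv p (X p) (fun q => dv q (Z q) f) + dv p (Y p) (fun q => dv q (Z q) f).
  by rewrite (nbhs_singleton WE); exact: dv_linear.
apply: etrans (lie_br_dv Ws Zs fs) _.
apply: etrans (congr2 (fun x y : R => x - y) E2 E1) _.
have L3 := dv_linear (- dv p (Z p) a) (X p) (a p *: lie_br X Z p + lie_br Y Z p) fs.
rewrite addrC scaleNr in L3; apply: etrans (esym L3).
have L2 := dv_linear (a p) (lie_br X Z p) (lie_br Y Z p) fs.
have L1 := etrans L2 (congr2 (fun s t => a p * s + t) (lie_br_dv Xs Zs fs) (lie_br_dv Ys Zs fs)).
apply: etrans (congr1 (fun t => - dv p (Z p) a * dv p (X p) f + t) (esym L1)).
exact: leibniz_rearrange.
Qed.

Lemma lie_linearr p (a : M -> R) X Y W Z : msmooth p a -> vsmooth p X -> vsmooth p Y ->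
  vsmooth p Z -> (\forall q \near p, W q = a q *: X q + Y q) ->
  lie_br Z W p = a p *: lie_br Z X p + lie_br Z Y p + dv p (Z p) a *: X p.
Proof.
move=> as_ Xs Ys Zs WE.
have WE' : \forall q \near p, a q *: X q + Y q = W q by apply: filterS WE => q ->.
have Ws := near_eq_vsmooth WE' (vsmoothZD as_ Xs Ys).
rewrite (lie_anti Zs Ws) (lie_linearl as_ Xs Ys Zs WE).
by rewrite (lie_anti Zs Xs) (lie_anti Zs Ys) scalerN !opprD opprK.
Qed.

Lemma lie_self p X : vsmooth p X -> lie_br X X p = 0.
Proof.
move=> Xs; apply/eqP; have := lie_anti Xs Xs => /eqP.
rewrite -addr_eq0 -mulr2n -scaler_nat scaler_eq0 pnatr_eq0 /=; exact.
Qed.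

End LieOfGerms.

Section FormValues.
Context (R : realType) (n : nat) (M : manifold R n).
Context (E : M -> {vspace 'rV[R]_n}) (r : nat) (phi : cochain M r).
Hypothesis phiF : forms E phi.
Implicit Types (p q : M) (u v w : 'I_r -> 'rV[R]_n) (X Y : 'I_r -> vfield M).

Lemma form_outside p v l : v l \notin E p -> phi p v = 0.
Proof. by case: phiF => + _ _ _; exact. Qed.

(** Linearity in slot [l] through three tuples that agree elsewhere, so that users need not exhibit
    their arguments as updates. *)
Lemma form_linear p v u w l (a : R) : (forall m, u m \in E p) -> w l \in E p ->
  (forall m, m != l -> v m = u m) -> (forall m, m != l -> w m = u m) ->
  v l = a *: u l + w l -> phi p v = a * phi p u + phi p w.
Proof.
case: phiF => _ lin _ _ uE wE vu wu vl.
have := lin p u l a (u l) (w l) uE (uE l) wE.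
have -> : [eta u with l |-> a *: u l + w l] = v :> ('I_r -> _).
  by apply/funext => m /=; case: eqVneq => [->//|/vu ->].
have -> : [eta u with l |-> u l] = u :> ('I_r -> _).
  by apply/funext => m /=; case: eqVneq => [->//|].
have -> // : [eta u with l |-> w l] = w :> ('I_r -> _).
by apply/funext => m /=; case: eqVneq => [->//|/wu ->].
Qed.

Lemma form_alt p v l m : l != m -> v l = v m -> phi p v = 0.
Proof. by case: phiF => _ _ + _; exact. Qed.

Lemma form_eq0 p v l : v l = 0 -> phi p v = 0.
Proof.
move=> vl0; have [vE|] := pselect (forall m, v m \in E p); last first.
  by move=> /existsNP[m /negP]; exact: form_outside.
have := @form_linear p v v v l (-1) vE (vE l) (fun _ _ => erefl) (fun _ _ => erefl).
by rewrite vl0 scaler0 addr0 mulN1r addNr; exact.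
Qed.

Lemma form_msmooth p X : (forall l, section_germ E p (X l)) ->
  msmooth p (fun q => phi q (fun l => X l q)).
Proof.
move=> XE; have : nbhs p [set q | forall l, vsmooth q (X l) /\ X l q \in E q].
  exact: near_forall.
rewrite nbhsE => -[U [oU Up] UX]; case: phiF => _ _ _ /(_ U X oU).
have XU l : section_on E U (X l) by apply/section_onP => // q /UX; exact.
by move=> /(_ XU)/(smooth_fun_onP _ oU); exact.
Qed.

End FormValues.

(** * The Chevalley-Eilenberg expression on germs of sections *)

Section ChevalleyEilenberg.
Context (R : realType) (n : nat) (M : manifold R n).
Context (E : M -> {vspace 'rV[R]_n}) (EI : involutive_subbundle E).
Context (r : nat) (phi : cochain M r).
Hypothesis phiF : forms E phi.
Implicit Types (p q : M) (X Y W : 'I_r.+1 -> vfield M) (b c i : 'I_r.+1).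

Definition ce_fun X b q : R := phi q (fun m => X (lift b m) q).

Definition ce_arg X b c (w : 'rV[R]_n) p : 'I_r -> 'rV[R]_n :=
  fun m => if m == 0%N :> nat then w else X (pair_idx b c m) p.

Definition ce_bracket X b c p : R := phi p (ce_arg X b c (lie_br (X b) (X c) p) p).

Lemma chevalley_eilenbergE X p : chevalley_eilenberg phi X p =
  \sum_(b < r.+1) (-1) ^+ b * dv p (X b p) (ce_fun X b) +
  \sum_(b < r.+1) \sum_(c < r.+1 | (b < c)%N) (-1) ^+ (b + c) * ce_bracket X b c p.
Proof.
rewrite /chevalley_eilenberg; congr (_ + _).
  by apply: eq_bigr => b _; rewrite vderivE.
by apply: eq_bigr => b _; apply: eq_bigr => c _; rewrite /ce_bracket lie_brE.
Qed.

Definition section_germs p X := forall b, section_germ E p (X b).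

Lemma section_germs_near p X : section_germs p X -> \forall q \near p, section_germs q X.
Proof.
move=> XE; apply: near_forall.
by move=> b; exact: section_germ_near.
Qed.

Lemma ce_fun_msmooth p X b : section_germs p X -> msmooth p (ce_fun X b).
Proof. by move=> XE; apply: (form_msmooth phiF) => l; exact: XE. Qed.

(* [W] is obtained from [X] by replacing [X i] by [a X i + Y i] near [p]. *)
Section Slot.
Variables (p : M) (X Y W : 'I_r.+1 -> vfield M) (i : 'I_r.+1) (a : M -> R).
Hypotheses (as_ : msmooth p a) (XE : section_germs p X) (YE : section_germ E p (Y i)).
Hypotheses (WX : forall b, b != i -> W b = X b) (YX : forall b, b != i -> Y b = X b).
Hypothesis Wi : \forall q \near p, W i q = a q *: X i q + Y i q.

Lemma slot_Y : section_germs p Y.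
Proof. by move=> b; have [->//|/YX ->] := eqVneq b i. Qed.

(** For [b != i] the coefficient sits inside the differentiated function, and the product rule adds
    the derivative of [a] along [X b]. *)
Lemma slot_fun b : dv p (W b p) (ce_fun W b) =
  a p * dv p (X b p) (ce_fun X b) + dv p (Y b p) (ce_fun Y b) +
  (if b == i then 0 else dv p (X b p) a * ce_fun X b p).
Proof.
have Xs := ce_fun_msmooth b XE; have Ys := ce_fun_msmooth b slot_Y.
have [->{b Xs Ys}|bi] := eqVneq b i.
  have WXf : ce_fun W i = ce_fun X i.
    by apply/funext => q; congr (phi q _); apply/funext => m; rewrite WX// eq_sym neq_lift.
  have YXf : ce_fun Y i = ce_fun X i.
    by apply/funext => q; congr (phi q _); apply/funext => m; rewrite YX// eq_sym neq_lift.
  rewrite WXf YXf (nbhs_singleton Wi) addr0; apply: dv_linear.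
  exact: ce_fun_msmooth.
have [m bm] : exists m, lift b m = i by case: (unlift_some bi) => m -> _; exists m.
have fE : \forall q \near p, ce_fun W b q = a q * ce_fun X b q + ce_fun Y b q.
  apply: filterS3 Wi (section_germs_near XE) (section_germ_near YE) => q Wq Xq Yq.
  have ml l : l != m -> lift b l != i.
    by apply: contra => /eqP; rewrite -bm => /lift_inj ->.
  apply: (form_linear phiF (l := m)) => [l||||].
  - exact: section_germ_in (Xq _).
  - by rewrite bm; exact: section_germ_in.
  - by move=> l /ml/WX ->.
  - by move=> l /ml/YX ->.
  - by rewrite bm.
rewrite (near_eq_dv _ fE) (dvD _ (msmoothM as_ Xs) Ys) (dvM _ as_ Xs).
by rewrite (WX bi) (YX bi); ring.
Qed.

(** The extra term is the derivative of [a] produced by the bracket when slot [i] is one of the two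
    bracketed fields. *)
Lemma slot_bracket b c : (b < c)%N -> ce_bracket W b c p =
  a p * ce_bracket X b c p + ce_bracket Y b c p +
  (if b == i then - dv p (X c p) a * phi p (ce_arg X b c (X i p) p)
   else if c == i then dv p (X b p) a * phi p (ce_arg X b c (X i p) p) else 0).
Proof.
move=> bc; have Ys := slot_Y.
have in0 (w : 'rV[R]_n) : w \in E p -> forall m, ce_arg X b c w p m \in E p.
  by move=> wE m; rewrite /ce_arg; case: ifP => // _; exact: section_germ_in.
have lieX := section_germ_in (section_germ_lie EI (XE b) (XE c)).
have lieY := section_germ_in (section_germ_lie EI (Ys b) (Ys c)).
have Xv d := section_germ_vsmooth (XE d).
have Yv d := section_germ_vsmooth (Ys d).
have r0 : (0 < r)%N by have := ltn_ord c; lia.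
pose o := Ordinal r0.
have arg0 (V : 'I_r.+1 -> vfield M) w : ce_arg V b c w p o = w by rewrite /ce_arg eqxx.
have argm (V : 'I_r.+1 -> vfield M) w m : m != o -> ce_arg V b c w p m = V (pair_idx b c m) p.
  by rewrite /ce_arg -val_eqE /= => /negbTE ->.
have mo m : m != o -> m != 0%N :> nat by rewrite -val_eqE.
have arg_lin w1 w2 s : w1 \in E p -> w2 \in E p ->
    phi p (ce_arg X b c (s *: w1 + w2) p) =
    s * phi p (ce_arg X b c w1 p) + phi p (ce_arg X b c w2 p).
  move=> w1E w2E; apply: (form_linear phiF (l := o)); rewrite ?arg0//.
  - exact: in0.
  - by move=> m mo'; rewrite !argm.
  - by move=> m mo'; rewrite !argm.
have eq_arg (V : 'I_r.+1 -> vfield M) w : (forall d, d != i -> V d = X d) ->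
    (forall m, m != o -> pair_idx b c m != i) -> ce_arg V b c w p = ce_arg X b c w p.
  move=> VX noti; apply/funext => m; have [->|mo'] := eqVneq m o; first by rewrite !arg0.
  by rewrite !argm// VX// noti.
have Xi := section_germ_in (XE i).
have [bi|bi] := eqVneq b i.
  have ci : c != i by rewrite -bi neq_ltn bc orbT.
  have notm m : m != o -> pair_idx b c m != i.
    by move=> /mo m0; have [] := pair_idx_neq bc m0; rewrite bi.
  rewrite /ce_bracket (eq_arg W)// (eq_arg Y)//; rewrite bi in lieX lieY bc arg_lin *.
  rewrite (WX ci) (YX ci) in lieY *.
  rewrite (lie_linearl as_ (Xv i) (Yv i) (Xv c) Wi) addrC -scaleNr.
  have LE : a p *: lie_br (X i) (X c) p + lie_br (Y i) (X c) p \in E p.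
    by rewrite memvD// memvZ.
  by rewrite (arg_lin _ _ _ Xi LE) (arg_lin _ _ _ lieX lieY) addrC.
have [ci|ci] := eqVneq c i.
  have notm m : m != o -> pair_idx b c m != i.
    by move=> /mo m0; have [] := pair_idx_neq bc m0; rewrite ci.
  rewrite /ce_bracket (eq_arg W)// (eq_arg Y)//; rewrite ci in lieX lieY bc arg_lin *.
  rewrite (WX bi) (YX bi) in lieY *.
  rewrite (lie_linearr as_ (Xv i) (Yv i) (Xv b) Wi) addrC.
  have LE : a p *: lie_br (X b) (X i) p + lie_br (X b) (Y i) p \in E p.
    by rewrite memvD// memvZ.
  by rewrite (arg_lin _ _ _ Xi LE) (arg_lin _ _ _ lieX lieY) addrC.
rewrite addr0 /ce_bracket (WX bi) (WX ci) (YX bi) (YX ci).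
(* Now [i] is not bracketed, so it occupies an ordinary slot [m0] and linearity of [phi] there
   suffices. *)
have [||m0 m00 m0i] := pair_idx_surj bc (_ : i != b) (_ : i != c); rewrite 1?eq_sym//.
have mo0 : m0 != o by [].
have mi m : m != o -> m != m0 -> pair_idx b c m != i.
  move=> mo' mm0; apply: contra mm0 => /eqP; rewrite -m0i.
  by move=> /(pair_idx_inj bc (mo m mo') m00) ->.
apply: (form_linear phiF (l := m0)).
- exact: in0.
- rewrite argm// m0i; exact: section_germ_in.
- by move=> m mm0; have [->|mo'] := eqVneq m o; rewrite ?arg0// !argm// WX// mi.
- by move=> m mm0; have [->|mo'] := eqVneq m o; rewrite ?arg0// !argm// YX// mi.
- by rewrite !argm// m0i (nbhs_singleton Wi).
Qed.

End Slot.

(** For a constant coefficient the derivative terms of [slot_fun] and [slot_bracket] vanish. *)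
Lemma ce_slot_linear p X Y W i (a : R) : section_germs p X -> section_germ E p (Y i) ->
  (forall b, b != i -> W b = X b) -> (forall b, b != i -> Y b = X b) ->
  (\forall q \near p, W i q = a *: X i q + Y i q) ->
  chevalley_eilenberg phi W p =
  a * chevalley_eilenberg phi X p + chevalley_eilenberg phi Y p.
Proof.
move=> XE YE WX YX Wi; have as_ := msmooth_cst p a.
rewrite !chevalley_eilenbergE mulrDr addrACA; congr (_ + _).
  rewrite mulr_sumr -big_split /=; apply: eq_bigr => b _.
  rewrite (slot_fun as_ XE YE WX YX Wi b) dv_cst mul0r if_same addr0.
  by rewrite mulrDr mulrCA.
rewrite mulr_sumr -big_split /=; apply: eq_bigr => b _.
rewrite mulr_sumr -big_split /=; apply: eq_bigr => c bc.
rewrite (slot_bracket as_ XE YE WX YX Wi bc) !dv_cst oppr0 !mul0r !if_same addr0.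
by rewrite mulrDr mulrCA.
Qed.

Lemma ce_near_eq p X W i : section_germs p X ->
  (forall b, b != i -> W b = X b) -> (\forall q \near p, W i q = X i q) ->
  chevalley_eilenberg phi W p = chevalley_eilenberg phi X p.
Proof.
move=> XE WX Wi; have := @ce_slot_linear p X X W i 0 XE (XE i) WX (fun _ _ => erefl).
rewrite mul0r add0r; apply; apply: filterS Wi => q ->.
by rewrite scale0r add0r.
Qed.

Lemma ce_eq0 p X i : section_germs p X -> (\forall q \near p, X i q = 0) ->
  chevalley_eilenberg phi X p = 0.
Proof.
move=> XE Xi; have := @ce_slot_linear p X X X i 1 XE (XE i) (fun _ _ => erefl) (fun _ _ => erefl).
rewrite mul1r => /(_ _)/eqP; rewrite -subr_eq0 opprD addrA subrr sub0r oppr_eq0 => H.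
by apply/eqP/H; apply: filterS Xi => q ->; rewrite scaler0 addr0.
Qed.

(* In the first slot the derivatives of [a] coming from the two sums of the
   Chevalley-Eilenberg formula cancel without any reordering of arguments; the
   other slots are reached by alternation. *)
Lemma ce_slot0 p X W (a : M -> R) : msmooth p a -> section_germs p X ->
  (forall b, b != ord0 -> W b = X b) ->
  (\forall q \near p, W ord0 q = a q *: X ord0 q) ->
  chevalley_eilenberg phi W p = a p * chevalley_eilenberg phi X p.
Proof.
(* A zero field in slot 0 of [Y] turns the slot lemmas, stated for [a X + Y], into scaling. *)
move=> as_ XE WX W0; pose Y := upd X ord0 (fun=> 0 : 'rV[R]_n).
have Y0 : Y ord0 = (fun=> 0) by rewrite /Y /upd eqxx.
have YE0 : section_germ E p (Y ord0).
  by rewrite Y0; near=> q; split; [exact: vsmooth0|exact: mem0v].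
have YX b : b != ord0 -> Y b = X b by rewrite /Y /upd => /negbTE ->.
have Wi : \forall q \near p, W ord0 q = a q *: X ord0 q + Y ord0 q.
  by apply: filterS W0 => q ->; rewrite Y0 addr0.
have CY : chevalley_eilenberg phi Y p = 0.
  apply: (@ce_eq0 p Y ord0); last by near=> q; rewrite Y0.
  by move=> b; have [->//|/YX ->] := eqVneq b ord0.
rewrite -[RHS]addr0 -CY !chevalley_eilenbergE mulrDr addrACA.
pose d1 (b : 'I_r.+1) := if b == ord0 then 0 else dv p (X b p) a * ce_fun X b p.
have -> : \sum_(b < r.+1) (-1) ^+ b * dv p (W b p) (ce_fun W b) =
    a p * \sum_(b < r.+1) (-1) ^+ b * dv p (X b p) (ce_fun X b) +
    \sum_(b < r.+1) (-1) ^+ b * dv p (Y b p) (ce_fun Y b) +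
    \sum_(b < r.+1) (-1) ^+ b * d1 b.
  rewrite mulr_sumr -!big_split /=; apply: eq_bigr => b _.
  by rewrite (slot_fun as_ XE YE0 WX YX Wi b) !mulrDr mulrCA.
have -> : \sum_(b < r.+1) \sum_(c < r.+1 | (b < c)%N) (-1) ^+ (b + c) * ce_bracket W b c p =
    a p * \sum_(b < r.+1) \sum_(c < r.+1 | (b < c)%N) (-1) ^+ (b + c) * ce_bracket X b c p +
    \sum_(b < r.+1) \sum_(c < r.+1 | (b < c)%N) (-1) ^+ (b + c) * ce_bracket Y b c p -
    \sum_(b < r.+1) (-1) ^+ b * d1 b.
  transitivity (a p *
      \sum_(b < r.+1) \sum_(c < r.+1 | (b < c)%N) (-1) ^+ (b + c) * ce_bracket X b c p +
    \sum_(b < r.+1) \sum_(c < r.+1 | (b < c)%N) (-1) ^+ (b + c) * ce_bracket Y b c p +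
    \sum_(b < r.+1) \sum_(c < r.+1 | (b < c)%N) (-1) ^+ (b + c) *
      (if b == ord0 then - (dv p (X c p) a * ce_fun X c p) else 0)).
    rewrite mulr_sumr -!big_split /=; apply: eq_bigr => b _.
    rewrite mulr_sumr -!big_split /=; apply: eq_bigr => c bc.
    rewrite (slot_bracket as_ XE YE0 WX YX Wi bc) !mulrDr mulrCA; congr (_ + _ * _).
    have c0 : (c == ord0) = false by apply/eqP => c0; rewrite c0 in bc.
    rewrite c0; case: eqP => // b0; rewrite b0 mulNr; congr (- (_ * phi p _)).
    (* With [X 0] in the bracket's slot, the arguments for the pair [(0, c)] are those of
       [ce_fun X c], already in order. *)
    apply/funext => m; rewrite /ce_arg; case: eqP => m0.
      congr (X _ p); apply: val_inj; rewrite /= m0 /bump.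
      by have c1 : (0 < c)%N := leq_ltn_trans (leq0n b) bc; lia.
    congr (X _ p); apply: val_inj; rewrite /= pair_idxE; last exact/eqP.
    by rewrite /bump /=; lia.
  (* Only pairs with [b = 0] contribute, with sign [(-1) ^ c]; they cancel the terms [d1 c] of the
     first sum. *)
  congr (_ + _); rewrite -sumrN (bigD1 ord0)//= [X in _ + X]big1 ?addr0; last first.
    move=> b /negbTE b0; apply: big1 => c _; by rewrite b0 mulr0.
  have d10 : d1 ord0 = 0 by rewrite /d1 eqxx.
  rewrite [RHS](bigD1 ord0)//= d10 mulr0 oppr0 add0r.
  apply: eq_big => [c|c c0]; first by rewrite lt0n -val_eqE.
  rewrite /d1 add0n mulrN; case: eqP => // c0'; by rewrite c0' in c0.
by rewrite [LHS]addrACA subrr addr0.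
Unshelve. all: by end_near. Qed.

(* Exchanging [i] and [j] in the summation indices changes the sign of every
   summand. *)
Lemma ce_adjacent p X i (j : 'I_r.+1) : j = i.+1 :> nat -> section_germs p X -> X i = X j ->
  chevalley_eilenberg phi X p = 0.
Proof.
move=> ji XE Xij; pose s := tperm i j; have ij : i != j by apply/eqP => /(congr1 val) /=; lia.
have Xs b : X (s b) = X b.
  rewrite /s; case: tpermP => [->|->|//]; exact/esym.
have two0 (t : R) : t = - t -> t = 0.
  by move=> /eqP; rewrite -addr_eq0 -mulr2n mulrn_eq0 /= => /eqP.
rewrite chevalley_eilenbergE -[RHS]addr0; congr (_ + _); apply: two0.
  rewrite [LHS](reindex_inj (@perm_inj _ s)) /= -sumrN; apply: eq_bigr => b _.
  (* Omitting [i] or [j] leaves the same list, as the two are adjacent and carry the same field. *)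
  have lift_ij : ce_fun X i = ce_fun X j.
    apply/funext => q; congr (phi q _); apply/funext => m.
    have [mi|mi] := eqVneq (m : nat) i.
      have -> : lift i m = j by apply: val_inj; rewrite /= /bump; lia.
      have -> : lift j m = i by apply: val_inj; rewrite /= /bump; lia.
      by rewrite Xij.
    congr (X _ q); apply: val_inj; rewrite /= /bump; move/eqP: mi => mi; lia.
  rewrite Xs /s; case: tpermP => [->|->|/eqP bi /eqP bj].
  - by rewrite -lift_ij ji exprS mulN1r mulNr.
  - by rewrite lift_ij ji exprS mulN1r mulNr opprK.
  - suff -> : ce_fun X b = fun=> 0 by rewrite dv_cst mulr0 oppr0.
    have [l li] : exists l, lift b l = i by case: (unlift_some bi) => l -> _; exists l.
    have [m mj] : exists m, lift b m = j by case: (unlift_some bj) => m -> _; exists m.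
    apply/funext => q; apply: (@form_alt _ _ _ _ _ _ phiF _ _ l m); last by rewrite li mj Xij.
    by apply: contra ij => /eqP lm; rewrite -li -mj lm.
(* Extension by zero to all pairs, so that both indices can be permuted freely. *)
pose T (b c : 'I_r.+1) := if (b < c)%N then (-1) ^+ (b + c) * ce_bracket X b c p else 0.
have -> : \sum_(b < r.+1) \sum_(c < r.+1 | (b < c)%N) (-1) ^+ (b + c) * ce_bracket X b c p =
    \sum_(b < r.+1) \sum_(c < r.+1) T b c.
  by apply: eq_bigr => b _; rewrite big_mkcond.
rewrite [LHS](reindex_inj (@perm_inj _ s)) /= -sumrN; apply: eq_bigr => b _.
rewrite [LHS](reindex_inj (@perm_inj _ s)) /= -sumrN; apply: eq_bigr => c _.
have brl (d : 'I_r.+1) : (j < d)%N -> ce_bracket X i d p = ce_bracket X j d p.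
  move=> jd; rewrite /ce_bracket Xij; congr (phi p _); apply/funext => m.
  rewrite /ce_arg; case: eqP => // /eqP m0.
  have [mi|mi] := eqVneq m.-1 (i : nat).
    have -> : pair_idx i d m = j by apply: val_inj; rewrite /= pair_idxE// /bump; lia.
    have -> : pair_idx j d m = i by apply: val_inj; rewrite /= pair_idxE// /bump; lia.
    by rewrite Xij.
  congr (X _ p); apply: val_inj; rewrite /= !pair_idxE// /bump.
  by move/eqP: mi => mi; lia.
have brr (d : 'I_r.+1) : (d < i)%N -> ce_bracket X d i p = ce_bracket X d j p.
  move=> di; rewrite /ce_bracket Xij; congr (phi p _); apply/funext => m.
  rewrite /ce_arg; case: eqP => // /eqP m0.
  have [mi|mi] := eqVneq (bump d m.-1) (i : nat).
    have -> : pair_idx d i m = j by apply: val_inj; rewrite /= pair_idxE// mi /bump; lia.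
    have -> : pair_idx d j m = i by apply: val_inj; rewrite /= pair_idxE// mi /bump; lia.
    by rewrite Xij.
  congr (X _ p); apply: val_inj; rewrite /= !pair_idxE//.
  by move/eqP: mi; move: (bump d m.-1) => x xi; rewrite /bump; lia.
have Tij : T i j = 0.
  rewrite /T /ce_bracket Xij (lie_self (section_germ_vsmooth (XE j))).
  case: ifP => // ltij; have r0 : (0 < r)%N by have := ltn_ord j; lia.
  by rewrite (@form_eq0 _ _ _ _ _ _ phiF p _ (Ordinal r0)) ?mulr0.
have Tdiag d : T d d = 0 by rewrite /T ltnn.
have Tji : T j i = 0 by rewrite /T; case: ifP => //; lia.
have Tl d : d != i -> d != j -> T j d = - T i d.
  rewrite -!val_eqE /= => di dj; rewrite /T.
  have -> : (j < d)%N = (i < d)%N by lia.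
  case: ifP => [id|]; last by rewrite oppr0.
  by rewrite brl ?ji ?addSn ?exprS ?mulN1r ?mulNr//; lia.
have Tr d : d != i -> d != j -> T d j = - T d i.
  rewrite -!val_eqE /= => di dj; rewrite /T.
  have -> : (d < j)%N = (d < i)%N by lia.
  case: ifP => [id|]; last by rewrite oppr0.
  by rewrite brr ?ji ?addnS ?exprS ?mulN1r ?mulNr.
rewrite /s; case: (tpermP i j b) => [->|->|/eqP bi /eqP bj];
  case: (tpermP i j c) => [->|->|/eqP ci /eqP cj];
  rewrite ?Tdiag ?Tij ?Tji ?oppr0 ?Tl ?Tr ?opprK//.
(* Neither [i] nor [j] is bracketed, so both occur as arguments of [phi], which then has a repeated
   argument. *)
suff -> : T b c = 0 by rewrite oppr0.
rewrite /T; case: ifP => // bc.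
have [||l l0 li] := pair_idx_surj bc (_ : i != b) (_ : i != c); rewrite 1?eq_sym//.
have [||m m0 mj] := pair_idx_surj bc (_ : j != b) (_ : j != c); rewrite 1?eq_sym//.
rewrite /ce_bracket (@form_alt _ _ _ _ _ _ phiF _ _ l m) ?mulr0//.
  by apply: contra ij => /eqP lm; rewrite -li -mj lm.
by rewrite /ce_arg (negbTE l0) (negbTE m0) li mj Xij.
Qed.

End ChevalleyEilenberg.

(** * Tensoriality; existence and uniqueness of the differential *)

Section Differential.
Context (R : realType) (n : nat) (M : manifold R n).
Context (E : M -> {vspace 'rV[R]_n}) (EI : involutive_subbundle E).
Context (r : nat) (phi : cochain M r).
Hypothesis phiF : forms E phi.
Implicit Types (p q : M) (X Y W : 'I_r.+1 -> vfield M) (b c i j : 'I_r.+1).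

Local Notation CE := (chevalley_eilenberg phi).

Lemma section_germD p (a b : vfield M) : section_germ E p a -> section_germ E p b ->
  section_germ E p (fun q => a q + b q).
Proof.
move=> aE bE; apply: near_eq_section_germ (section_germZD (msmooth_cst p 1) aE bE).
by near=> q; rewrite scale1r.
Unshelve. all: by end_near. Qed.

Lemma upd_germs p X i (a : vfield M) : section_germs E p X -> section_germ E p a ->
  section_germs E p (upd X i a).
Proof. by move=> XE aE b; exact: (@upd_S _ _ (section_germ E p)). Qed.

Lemma updE X i (a : vfield M) : upd X i a i = a.
Proof. by rewrite /upd eqxx. Qed.

Lemma upd_neq X i (a : vfield M) b : b != i -> upd X i a b = X b.
Proof. by rewrite /upd => /negbTE ->. Qed.

Lemma ce_upd_linear p X i (s : R) (a b : vfield M) :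
  section_germs E p X -> section_germ E p a -> section_germ E p b ->
  CE (upd X i (fun q => s *: a q + b q)) p = s * CE (upd X i a) p + CE (upd X i b) p.
Proof.
move=> XE aE bE.
apply: (@ce_slot_linear _ _ _ _ EI _ _ phiF p (upd X i a) (upd X i b) _ i s).
- exact: upd_germs.
- by rewrite updE.
- by move=> c ci; rewrite !upd_neq.
- by move=> c ci; rewrite !upd_neq.
- by near=> q; rewrite !updE.
Unshelve. all: by end_near. Qed.

Lemma ce_updD p X i (a b : vfield M) :
  section_germs E p X -> section_germ E p a -> section_germ E p b ->
  CE (upd X i (fun q => a q + b q)) p = CE (upd X i a) p + CE (upd X i b) p.
Proof.
move=> XE aE bE; rewrite -[X in _ = X + _]mul1r -ce_upd_linear//.
by congr (CE _ p); congr upd; apply/funext => q; rewrite scale1r.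
Qed.

Lemma ce_alternates p i j : i != j ->
  alternates (section_germ E p) (CE^~ p) i j.
Proof.
move=> ij; refine (@alternates_of_adjacent R (vfield M) r.+1 (section_germ E p)
  (fun (a b : vfield M) q => a q + b q) (CE^~ p) _ _ _ i j ij).
- exact: section_germD.
- by move=> X k a b XE aE bE; exact: ce_updD.
- by move=> k l lk X XE Xkl; exact: (ce_adjacent phiF lk XE Xkl).
Qed.

(** Exchanging slot [i] with slot 0 changes the sign of both sides and reduces the claim to
    [ce_slot0]. *)
Lemma ce_slot_homogeneous p X i (f : M -> R) (a : vfield M) : msmooth p f ->
  section_germs E p X -> section_germ E p a ->
  CE (upd X i (fun q => f q *: a q)) p = f p * CE (upd X i a) p.
Proof.
move=> fs XE aE; have faE : section_germ E p (fun q => f q *: a q).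
  have zE : section_germ E p (fun=> 0).
    by near=> q; split; [exact: vsmooth0|exact: mem0v].
  apply: near_eq_section_germ (section_germZD fs aE zE).
  by near=> q; rewrite addr0.
have [->|i0] := eqVneq i ord0.
  apply: (ce_slot0 EI phiF fs) => [|b b0|]; first exact: upd_germs.
    by rewrite !upd_neq.
  by near=> q; rewrite !updE.
apply: oppr_inj; rewrite -mulrN.
have sw Y : section_germs E p Y -> CE (fun l => Y (tperm ord0 i l)) p = - CE Y p.
  apply: (@swap_of_alternates _ _ _ (section_germ E p)
    (fun (a b : vfield M) q => a q + b q) (CE^~ p)).
  - exact: section_germD.
  - by move=> X' k a' b' X'E aE' bE'; exact: ce_updD.
  - by rewrite eq_sym.
  - by apply: ce_alternates; rewrite eq_sym.
rewrite -!sw; try exact: upd_germs.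
apply: (ce_slot0 EI phiF fs) => [l|b b0|]; first exact: upd_germs.
  by rewrite !upd_neq// -[X in _ != X](tpermL ord0 i) (inj_eq (@perm_inj _ _)).
by near=> q; rewrite tpermL !updE.
Unshelve. all: by end_near. Qed.

Lemma ce_upd_sum p X i (I : finType) (s : seq I) (f : I -> M -> R) (a : I -> vfield M) :
  section_germs E p X -> (forall l, msmooth p (f l)) -> (forall l, section_germ E p (a l)) ->
  section_germ E p (fun q => \sum_(l <- s) f l q *: a l q) /\
  CE (upd X i (fun q => \sum_(l <- s) f l q *: a l q)) p =
  \sum_(l <- s) f l p * CE (upd X i (a l)) p.
Proof.
move=> XE fs aE.
have zE : section_germ E p (fun=> 0).
  by near=> q; split; [exact: vsmooth0|exact: mem0v].
elim: s => [|l s [IHE IH]].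
  have -> : (fun q : M => \sum_(l <- [::]) f l q *: a l q) = (fun=> 0).
    by apply/funext => q; rewrite big_nil.
  split=> //; rewrite big_nil.
  by apply: (ce_eq0 EI phiF (upd_germs i XE zE) (i := i)); near=> q; rewrite updE.
have -> : (fun q : M => \sum_(l <- l :: s) f l q *: a l q) =
    (fun q => f l q *: a l q + \sum_(l <- s) f l q *: a l q).
  by apply/funext => q; rewrite big_cons.
split; first exact: section_germZD.
have faE : section_germ E p (fun q => f l q *: a l q).
  apply: near_eq_section_germ (section_germZD (fs l) (aE l) zE).
  by near=> q; rewrite addr0.
by rewrite big_cons -IH -ce_slot_homogeneous// -ce_updD.
Unshelve. all: by end_near. Qed.

Lemma upd_id X i : upd X i (X i) = X.
Proof. by apply/funext => b; rewrite /upd; case: eqVneq => [->|]. Qed.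

(** Expand [X i] in a local frame: its coefficients vanish at [p] by freeness, and they factor out
    of the expression. *)
Lemma ce_tensorial p X i : section_germs E p X -> X i p = 0 -> CE X p = 0.
Proof.
move=> XE Xi0; have [k [Y Yf]] := local_frame EI p.
have [f [fs Xf]] := section_germ_coef Yf (XE i).
have YE l : section_germ E p (Y l) by exact: frame_section_germ Yf.
have f0 l : f l p = 0.
  have [_ Yfree _] := nbhs_singleton Yf; apply: (Yfree (f^~ p)).
  by rewrite -(nbhs_singleton Xf).
have [sE S] := ce_upd_sum i (enum 'I_k) XE fs YE.
have := ce_near_eq EI phiF (upd_germs i XE sE) (i := i) (W := X).
move=> ->; first by rewrite S big1// => l _; rewrite f0 mul0r.
- by move=> b bi; rewrite upd_neq.
- by apply: filterS Xf => q ->; rewrite updE big_enum.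
Qed.

Lemma ce_ext p X Y : section_germs E p X -> section_germs E p Y ->
  (forall b, X b p = Y b p) -> CE X p = CE Y p.
Proof.
(* [H m] takes its first [m] fields from [Y]. One step changes one field by a difference that
   vanishes at [p]. *)
move=> XE YE XY; pose H m b := if (b < m)%N then Y b else X b.
have HE m : section_germs E p (H m) by move=> b; rewrite /H; case: ifP.
have step m : (m < r.+1)%N -> CE (H m) p = CE (H m.+1) p.
  move=> mr; pose i := Ordinal mr.
  have Hi : H m = upd (H m) i (fun q => 1 *: (X i q - Y i q) + Y i q).
    rewrite -[LHS](upd_id _ i); congr upd; apply/funext => q.
    by rewrite scale1r subrK /H /= ltnn.
  have HSi : H m.+1 = upd (H m) i (Y i).
    apply/funext => b; rewrite /upd /H; case: eqVneq => [->|bi] /=.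
      by rewrite ltnSn.
    by rewrite ltnS leq_eqVlt (_ : (b == m :> nat) = false)//; exact/negbTE.
  have dE : section_germ E p (fun q => X i q - Y i q).
    apply: near_eq_section_germ (section_germZD (msmooth_cst p (-1)) (YE i) (XE i)).
    by near=> q; rewrite scaleN1r addrC.
  rewrite {1}Hi ce_upd_linear// mul1r -HSi (@ce_tensorial p _ i) ?add0r//.
    exact: upd_germs.
  by rewrite updE XY subrr.
have H0 : H 0%N = X by apply/funext => b; rewrite /H ltn0.
have Hr : H r.+1 = Y by apply/funext => b; rewrite /H ltn_ord.
have all m : (m <= r.+1)%N -> CE (H 0%N) p = CE (H m) p.
  by elim: m => // m IH mr; exact: etrans (IH (ltnW mr)) (step m mr).
by rewrite -H0 -Hr; exact: all.
Unshelve. all: by end_near. Qed.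

Lemma ce_msmooth p X : section_germs E p X -> msmooth p (CE X).
Proof.
move=> XE.
have S : msmooth p (fun q => \sum_(b < r.+1) (-1) ^+ b * dv q (X b q) (ce_fun phi X b) +
  \sum_(b < r.+1) \sum_(c < r.+1 | (b < c)%N) (-1) ^+ (b + c) * ce_bracket phi X b c q).
  apply: msmoothD; apply: msmooth_big => [f g|b _]; try exact: msmoothD.
    apply: msmoothM; first exact: msmooth_cst.
    apply: vsmooth_dv; first exact: section_germ_vsmooth (XE b).
    exact: ce_fun_msmooth XE.
  apply: msmooth_big => [f g|c _]; first exact: msmoothD.
  apply: msmoothM; first exact: msmooth_cst.
  pose V (m : 'I_r) := if m == 0%N :> nat then lie_br (X b) (X c) else X (pair_idx b c m).
  have VE l : section_germ E p (V l).
    by rewrite /V; case: ifP => _ //; exact: section_germ_lie.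
  apply: near_eq_msmooth (form_msmooth phiF VE); near=> q; congr (phi q _).
  by apply/funext => m; rewrite /V /ce_arg; case: ifP.
by apply: near_eq_msmooth S; near=> q; rewrite chevalley_eilenbergE.
Unshelve. all: by end_near. Qed.

(** Every tuple in [E p] is the value of global sections, and forms are zero on the other tuples. *)
Lemma forms_unique s (psi psi' : cochain M s) : forms E psi -> forms E psi' ->
  (forall X : 'I_s -> vfield M, (forall l, global_section E (X l)) ->
     forall p, psi p (fun l => X l p) = psi' p (fun l => X l p)) ->
  psi = psi'.
Proof.
move=> psiF psiF' H; apply/funext => p; apply/funext => v.
have [vE|] := pselect (forall l, v l \in E p); last first.
  by move=> /existsNP[l /negP vl]; rewrite (form_outside psiF vl) (form_outside psiF' vl).
have /choice[X XP] : forall l : 'I_s, exists X : vfield M, global_section E X /\ X p = v l.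
  by move=> l; have [X XE Xp] := global_section_through EI (vE l); exists X.
have -> : v = (fun l => X l p) by apply/funext => l; case: (XP l).
by apply: H => l; case: (XP l).
Qed.

Lemma ce_form_exists : exists2 psi : cochain M r.+1, forms E psi &
  forall p X, section_germs E p X -> psi p (fun b => X b p) = CE X p.
Proof.
have /choice[sec secP] : forall pw : M * 'rV[R]_n, exists X : vfield M,
    pw.2 \in E pw.1 -> section_germ E pw.1 X /\ X pw.1 = pw.2.
  case=> p w /=; have [wE|nwE] := boolP (w \in E p); last by exists (fun=> 0).
  by have [X XE Xp] := section_germ_through EI wE; exists X.
(* The vectors are extended by the chosen germs, and [ce_ext] makes the choice immaterial. The value
   0 off [E] is the convention of [forms]. *)
pose psi : cochain M r.+1 := fun p v =>
  if pselect (forall b, v b \in E p) then CE (fun b => sec (p, v b)) p else 0.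
have psiE p X : section_germs E p X -> psi p (fun b => X b p) = CE X p.
  move=> XE; rewrite /psi; case: pselect => [XpE|[]]; last first.
    by move=> b; exact: section_germ_in.
  apply: ce_ext => // b; first by have [] := secP (p, X b p) (XpE b).
  by have [_ /= ->] := secP (p, X b p) (XpE b).
have psi_sec p v : (forall b, v b \in E p) -> exists X, section_germs E p X /\
    v = (fun b => X b p).
  move=> vE; exists (fun b => sec (p, v b)); split=> [b|].
    by have [] := secP (p, v b) (vE b).
  by apply/funext => b; have [_ /= ->] := secP (p, v b) (vE b).
exists psi => //; split.
- by move=> p v b vb; rewrite /psi; case: pselect => // vE; have := vE b; rewrite (negbTE vb).
- move=> p v b a u w /psi_sec[X [XE ->]] uE wE.
  have [U UE Up] := section_germ_through EI uE.
  have [V VE Vp] := section_germ_through EI wE.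
  have updp (z : 'rV[R]_n) (Z : vfield M) : Z p = z ->
      [eta (fun c => X c p) with b |-> z] = (fun c => upd X b Z c p) :> ('I_r.+1 -> _).
    by move=> <-; apply/funext => c /=; rewrite /upd; case: ifP.
  rewrite (updp u U Up) (updp w V Vp).
  rewrite (updp _ (fun q => a *: U q + V q)); last by rewrite Up Vp.
  rewrite !psiE; try by exact: upd_germs.
    exact: ce_upd_linear.
  exact: upd_germs _ XE (section_germZD (msmooth_cst p a) UE VE).
- move=> p v i j ij vij; have [vE|nvE] := pselect (forall b, v b \in E p); last first.
    by rewrite /psi; case: pselect.
  rewrite /psi; case: pselect => // ?; apply: (ce_alternates ij); last by rewrite vij.
  by move=> b; have [] := secP (p, v b) (vE b).
- move=> U X oU XU; apply/smooth_fun_onP => // p Up.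
  have XE q : U q -> section_germs E q X.
    move=> Uq b; apply: filterS (open_nbhs_nbhs (conj oU Uq)) => z Uz.
    by have /(section_onP _ _ oU)/(_ z Uz) := XU b.
  apply: near_eq_msmooth (ce_msmooth (XE p Up)).
  by apply: filterS (open_nbhs_nbhs (conj oU Up)) => q /XE XEq; rewrite psiE.
Qed.

Lemma ce_diffP : forms E (ce_diff E phi) /\
  forall X, (forall b, global_section E (X b)) ->
  forall p, ce_diff E phi p (fun b => X b p) = CE X p.
Proof.
have [psi psiF psiE] := ce_form_exists.
apply: (@xgetPex _ (0 : cochain M r.+1) [set psi | forms E psi /\
    forall X : 'I_r.+1 -> vfield M, (forall i, global_section E (X i)) ->
    forall p, psi p (fun i => X i p) = chevalley_eilenberg phi X p]).
exists psi; split=> // X XE p; apply: psiE => b; exact: global_section_germ.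
Qed.

(** The tool for all later identities about [ce_diff]: it is enough to exhibit a form with the right
    values on global sections. *)
Lemma ce_diff_unique (psi : cochain M r.+1) : forms E psi ->
  (forall X, (forall b, global_section E (X b)) ->
     forall p, psi p (fun b => X b p) = CE X p) ->
  ce_diff E phi = psi.
Proof.
have [dF dE] := ce_diffP; move=> psiF psiE; apply: forms_unique => // X XE p.
by rewrite dE// psiE.
Qed.

End Differential.

(** * Linearity of the differential *)

Section Linearity.
Context (R : realType) (n : nat) (M : manifold R n).
Context (E : M -> {vspace 'rV[R]_n}) (EI : involutive_subbundle E).
Implicit Types (p q : M).

Lemma forms_linear r (a : R) (phi psi : cochain M r) :
  forms E phi -> forms E psi -> forms E (a *: phi + psi).
Proof.
move=> phiF psiF; have [phi0 philin phialt phis] := phiF.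
have [psi0 psilin psialt psis] := psiF; split.
- move=> p v i vi; rewrite -[LHS]/(a * phi p v + psi p v).
  by rewrite (phi0 _ _ _ vi) (psi0 _ _ _ vi) mulr0 addr0.
- move=> p v i b u w vE uE wE.
  rewrite -[LHS]/(a * phi p _ + psi p _) (philin _ _ _ _ _ _ vE uE wE).
  rewrite (psilin _ _ _ _ _ _ vE uE wE).
  rewrite -[X in _ = b * X + _]/(a * phi p _ + psi p _).
  by rewrite -[X in _ = _ + X]/(a * phi p _ + psi p _); ring.
- move=> p v i j ij vij; rewrite -[LHS]/(a * phi p v + psi p v).
  by rewrite (phialt _ _ _ _ ij vij) (psialt _ _ _ _ ij vij) mulr0 addr0.
- move=> U X oU XU; apply/(smooth_fun_onP _ oU) => p Up.
  have phip := (smooth_fun_onP _ oU).1 (phis U X oU XU) p Up.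
  have psip := (smooth_fun_onP _ oU).1 (psis U X oU XU) p Up.
  exact: msmoothD (msmoothM (msmooth_cst p a) phip) psip.
Qed.

Lemma forms0 r : forms E (0 : cochain M r).
Proof.
split=> //.
- by move=> p v i a u w _ _ _; rewrite -[LHS]/0 -[X in a * X]/0 -[X in _ + X]/0 mulr0 addr0.
- by move=> U X oU _; apply/(smooth_fun_onP _ oU) => p _; exact: msmooth_cst.
Qed.

Lemma chevalley_eilenberg_linear r (a : R) (phi psi : cochain M r) p X :
  forms E phi -> forms E psi -> section_germs E p X ->
  chevalley_eilenberg (a *: phi + psi) X p =
  a * chevalley_eilenberg phi X p + chevalley_eilenberg psi X p.
Proof.
move=> phiF psiF XE; rewrite !chevalley_eilenbergE mulrDr addrACA; congr (_ + _).
  rewrite mulr_sumr -big_split /=; apply: eq_bigr => b _.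
  have phis := ce_fun_msmooth phiF b XE; have psis := ce_fun_msmooth psiF b XE.
  have -> : ce_fun (a *: phi + psi) X b = (fun q => a * ce_fun phi X b q + ce_fun psi X b q) by [].
  rewrite (dvD _ (msmoothM (msmooth_cst p a) phis) psis) (dvM _ (msmooth_cst p a) phis).
  by rewrite dv_cst mulr0 addr0 mulrDr mulrCA.
rewrite mulr_sumr -big_split /=; apply: eq_bigr => b _.
rewrite mulr_sumr -big_split /=; apply: eq_bigr => c bc.
rewrite -[ce_bracket (_ + _) _ _ _ _]/(a * ce_bracket phi X b c p + ce_bracket psi X b c p).
by rewrite mulrDr mulrCA.
Qed.

Lemma ce_diff_linear r (a : R) (phi psi : cochain M r) : forms E phi -> forms E psi ->
  ce_diff E (a *: phi + psi) = a *: ce_diff E phi + ce_diff E psi.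
Proof.
move=> phiF psiF; have [dphiF dphiE] := ce_diffP EI phiF.
have [dpsiF dpsiE] := ce_diffP EI psiF.
apply: (ce_diff_unique EI); [exact: forms_linear|exact: forms_linear|].
move=> X XE p; rewrite (chevalley_eilenberg_linear _ phiF psiF); last first.
  by move=> b; exact: global_section_germ.
by rewrite -dphiE// -dpsiE.
Qed.

End Linearity.

(** * Restriction to the leaves and pull-back to a leaf *)

Section Restriction.
Context (R : realType) (n k : nat) (Z : manifold R n) (D : foliation Z k).
Implicit Types (p q : Z).

Let restr r (omega : cochain Z r) := leafwise_restriction D r omega.

Lemma restrE r (omega : cochain Z r) p v : (forall i, v i \in D p) ->
  restr omega p v = omega p v.
Proof. by move=> vD; rewrite /restr /=; case: ifPn => // /forallPn[i]; rewrite vD. Qed.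

Lemma restr_out r (omega : cochain Z r) p v i : v i \notin D p -> restr omega p v = 0.
Proof.
by move=> vi; rewrite /restr /=; case: ifPn => // /forallP/(_ i); rewrite (negbTE vi).
Qed.

Lemma restr_forms r (omega : cochain Z r) : forms (fun=> fullv) omega -> forms D (restr omega).
Proof.
move=> oF; split.
- by move=> p v i; exact: restr_out.
- move=> p v i a u w vD uD wD.
  have uv (z : 'rV[R]_n) : z \in D p -> forall l, [eta v with i |-> z] l \in D p.
    by move=> zD l /=; case: ifP.
  rewrite !restrE; try by apply: uv; rewrite ?memvD ?memvZ.
  by case: oF => _ + _ _; apply=> // *; exact: memvf.
- move=> p v i j ij vij; have [vD|] := pselect (forall l, v l \in D p).
    by rewrite restrE//; exact: form_alt oF _ _ _ _ ij vij.
  by move=> /existsNP[l /negP]; exact: restr_out.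
- move=> U X oU XU; apply/(smooth_fun_onP _ oU) => p Up.
  have XD q : U q -> forall l, vsmooth q (X l) /\ X l q \in D q.
    by move=> Uq l; have /(section_onP _ _ oU)/(_ q Uq) := XU l.
  have XF l : section_germ (fun=> fullv) p (X l).
    apply: filterS (open_nbhs_nbhs (conj oU Up)) => q /XD/(_ l)[Xs _].
    by split=> //; exact: memvf.
  apply: near_eq_msmooth (form_msmooth oF XF).
  apply: filterS (open_nbhs_nbhs (conj oU Up)) => q /XD XDq.
  by rewrite restrE// => l; case: (XDq l).
Qed.

(** The form and its restriction agree on [D], and involutivity keeps the bracket arguments in
    [D]. *)
Lemma restr_ce r (omega : cochain Z r) X p : section_germs D p X ->
  chevalley_eilenberg (restr omega) X p = chevalley_eilenberg omega X p.
Proof.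
move=> XD; rewrite !chevalley_eilenbergE; congr (_ + _).
  apply: eq_bigr => b _; congr (_ * _); apply: near_eq_dv.
  apply: filterS (section_germs_near XD) => q XDq; apply: restrE => l.
  exact: section_germ_in (XDq _).
apply: eq_bigr => b _; apply: eq_bigr => c _; congr (_ * _).
apply: restrE => m; rewrite /ce_arg; case: ifP => _; last exact: section_germ_in.
exact: section_germ_in (section_germ_lie (involutive_foliation D) (XD b) (XD c)).
Qed.

Lemma restr_diff r (omega : cochain Z r) : forms (fun=> fullv) omega ->
  restr (ce_diff (fun=> fullv) omega) = ce_diff D (restr omega).
Proof.
move=> oF; have [dF dE] := ce_diffP (involutive_fullv Z) oF.
apply/esym/(ce_diff_unique (involutive_foliation D)); try exact: restr_forms.
move=> X XD p; have XDg : section_germs D p X by move=> b; exact: global_section_germ.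
rewrite restr_ce// restrE => [|b]; last exact: section_germ_in.
apply: dE => b; apply/global_sectionP => q.
by have [Xs _] := (global_sectionP _ _).1 (XD b) q; split=> //; exact: memvf.
Qed.

Lemma restriction_cochain_morphism : cochain_morphism (leafwise_restriction D).
Proof.
split.
- by move=> r omega; exact: restr_forms.
- move=> r a x y _ _; apply/funext => p; apply/funext => v /=.
  rewrite -[RHS]/(a * _ + _); case: ifP => // _.
  by rewrite mulr0 addr0.
- by move=> r omega; exact: restr_diff.
- split=> [s _|a x y _ _|s _] //=.
    by split=> //; apply/(smooth_fun_onP _ openT) => p _; exact: msmooth_cst.
  apply/funext => p; apply/funext => v; case: ifPn => // /forallPn[]; by case.
Qed.

End Restriction.

(** * Pull-back of leafwise forms to an integral manifold *)

Section IntegralManifold.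
Context (R : realType) (n k : nat) (Z : manifold R n) (D : foliation Z k).
Context (F : manifold R k) (i : F -> Z) (iI : integral_manifold D i).
Implicit Types (q : F).

Local Lemma iS : smooth_map i. Proof. by case: iI. Qed.

Local Notation pushi := (push i).

Lemma push_in q v : pushi q v \in D (i q).
Proof.
case: iI => _ _ _ /(_ q) rg; rewrite pushE.
have : range (tmap i q) (tmap i q v) by exists v.
by rewrite rg.
Qed.

Lemma push_inj q : injective (pushi q).
Proof. by move=> v w; rewrite !pushE; case: iI => _ _ + _; exact. Qed.

Lemma push_surj q w : w \in D (i q) -> exists v, pushi q v = w.
Proof.
move=> wD; case: iI => _ _ _ /(_ q) rg.
have [v _ vw] : range (tmap i q) w by rewrite rg.
by exists v; rewrite pushE.
Qed.

Lemma push0 q : pushi q 0 = 0.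
Proof.
have := push_linear iS q (-1) 0 0.
by rewrite scaler0 addr0 scaleN1r addNr.
Qed.

Lemma push_sum q (I : finType) (a : I -> R) (v : I -> 'rV[R]_k) :
  pushi q (\sum_l a l *: v l) = \sum_l a l *: pushi q (v l).
Proof.
elim: (index_enum I) => [|l s IH]; first by rewrite !big_nil push0.
by rewrite !big_cons (push_linear iS) IH.
Qed.

Lemma push_along q (X : vfield F) : vsmooth q X ->
  vsmooth_along i q (fun q' => pushi q' (X q')).
Proof.
move=> Xs f fs; apply: near_eq_msmooth (vsmooth_dv Xs (msmooth_comp iS fs)).
apply: filterS (smooth_map_near iS (msmooth_near fs)) => q' fq'.
by rewrite (dv_push iS).
Qed.

Lemma comp_along q (Y : vfield Z) : vsmooth (i q) Y -> vsmooth_along i q (Y \o i).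
Proof. by move=> Ys f fs; exact: (msmooth_comp iS (vsmooth_dv Ys fs)). Qed.

Lemma continuous_leaf q : {for q, continuous i}.
Proof. by case: iS => ic _; exact: ic. Qed.

(** Pointwise the tangent map is a bijection onto the distribution. Its injectivity also makes the
    pushed coordinate fields independent, so [msmooth_coef] gives smooth components. *)
Lemma related_field (Y : vfield Z) : global_section D Y ->
  exists X : vfield F, (forall q, vsmooth q X) /\ forall q, pushi q (X q) = Y (i q).
Proof.
move=> YD; have /choice[X XY] : forall q, exists v, pushi q v = Y (i q).
  by move=> q; apply: push_surj; have [] := (global_sectionP _ _).1 YD (i q).
exists X; split=> // q; pose c := chart_at q.
have cA : atlas F c := chart_at_atlas q; have cq : dom c q := chart_at_dom q.
pose a l q' := tcoord c q' (X q') 0 l.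
have Xa : \forall q' \near q, \sum_l a l q' *: coord_field c l q' = X q'.
  by apply: filterS (near_dom cA cq) => q' cq'; rewrite -coord_field_expand.
have as_ l : msmooth q (a l).
  apply: (@msmooth_coef _ _ _ F Z i q k (fun l q' => pushi q' (coord_field c l q')) (Y \o i)).
  - exact: continuous_leaf.
  - by move=> l'; apply: push_along; exact: coord_field_vsmooth.
  - by apply: comp_along; have [] := (global_sectionP _ _).1 YD (i q).
  - move=> u; rewrite -push_sum -(push0 q) => /push_inj u0.
    exact: (coord_field_free cA cq u0).
  - by apply: filterS Xa => q' Xq'; rewrite -push_sum Xq' XY.
apply: near_eq_vsmooth Xa _; apply: vsmooth_sum => // l.
exact: coord_field_vsmooth.
Qed.

Definition leaf_pull r (phi : cochain Z r) : cochain F r :=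
  fun q v => phi (i q) (fun m => tmap i q (v m)).

Lemma leaf_pullE r (phi : cochain Z r) q v :
  leaf_pull phi q v = phi (i q) (fun m => pushi q (v m)).
Proof. by congr (phi _ _); apply/funext => m; rewrite pushE. Qed.

Lemma form_sum r (phi : cochain Z r) p (v : 'I_r -> 'rV[R]_n) (l : 'I_r)
    (I : finType) (a : I -> R) (w : I -> 'rV[R]_n) :
  forms D phi -> (forall m, v m \in D p) -> (forall j, w j \in D p) ->
  phi p (upd v l (\sum_j a j *: w j)) = \sum_j a j * phi p (upd v l (w j)).
Proof.
move=> phiF vD wD; have uD (z : 'rV[R]_n) : z \in D p -> forall m, upd v l z m \in D p.
  by move=> zD m; rewrite /upd; case: ifP.
elim: (index_enum I) => [|j s IH].
  by rewrite !big_nil (@form_eq0 _ _ _ _ _ _ phiF _ _ l)// /upd eqxx.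
rewrite !big_cons -IH.
have sD : \sum_(j <- s) a j *: w j \in D p by apply: memv_suml => j' _; rewrite memvZ.
apply: (@form_linear _ _ _ _ _ _ phiF p _ _ _ l) => [||m ml|m ml|].
- exact: uD.
- by rewrite /upd eqxx.
- by rewrite /upd (negbTE ml).
- by rewrite /upd (negbTE ml).
- by rewrite /upd eqxx.
Qed.

(* Slot by slot, vectors along the leaf are expanded in a local frame of the
   foliation, down to values of the form on sections of the foliation. *)
Lemma form_along_msmooth r (phi : cochain Z r) q (W : 'I_r -> F -> 'rV[R]_n) :
  forms D phi -> (forall l, vsmooth_along i q (W l)) ->
  (\forall q' \near q, forall l, W l q' \in D (i q')) ->
  msmooth q (fun q' => phi (i q') (fun l => W l q')).
Proof.
move=> phiF Ws WD; have [d [Y Yf]] := local_frame (involutive_foliation D) (i q).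
have YE l : section_germ D (i q) (Y l) by exact: frame_section_germ Yf.
have [_ Yfree _] := nbhs_singleton Yf.
have WE l : exists a : 'I_d -> F -> R, (forall j, msmooth q (a j)) /\
    \forall q' \near q, W l q' = \sum_j a j q' *: Y j (i q').
  have /choice[u uP] : forall q', exists u : 'I_d -> R,
      (exists u, W l q' = \sum_j u j *: Y j (i q')) -> W l q' = \sum_j u j *: Y j (i q').
    move=> q'.
    have [[u uE]|nu] := pselect (exists u : 'I_d -> R, W l q' = \sum_j u j *: Y j (i q')).
      by exists u.
    by exists (fun=> 0) => /nu.
  have Wu : \forall q' \near q, W l q' = \sum_j u q' j *: Y j (i q').
    apply: filterS2 WD (smooth_map_near iS Yf) => q' WD' [_ _ YD'].
    by apply: uP; exact/YD'.
  exists (fun j q' => u q' j); split=> //.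
  apply: (@msmooth_coef _ _ _ F Z i q d (fun j => Y j \o i) (W l)) => //.
    exact: continuous_leaf.
  by move=> j; apply: comp_along; exact: section_germ_vsmooth.
(* Slots below [m] still hold the given vectors along the leaf, the others already hold sections
   composed with [i]; the claim for [m = r] is the goal. *)
suff H m : (m <= r)%N -> forall V : 'I_r -> F -> 'rV[R]_n,
    (forall l : 'I_r, (l < m)%N -> V l = W l) ->
    (forall l : 'I_r, (m <= l)%N -> exists2 S, section_germ D (i q) S & V l = S \o i) ->
    msmooth q (fun q' => phi (i q') (fun l => V l q')).
  by apply: (H r (leqnn r) W) => // l; rewrite leqNgt ltn_ord.
elim: m => [_|m IH mr] V VW VS.
  have /choice[S SP] : forall l, exists S, section_germ D (i q) S /\ V l = S \o i.
    by move=> l; have [S SD VE] := VS l isT; exists S.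
  have phis := form_msmooth phiF (fun l => (SP l).1).
  apply: near_eq_msmooth (msmooth_comp iS phis); near=> q' => /=.
  by congr (phi _ _); apply/funext => l; rewrite (SP l).2.
pose l0 := Ordinal mr; have [a [as_ Wa]] := WE l0.
have S1 : msmooth q (fun q' => \sum_j a j q' *
    phi (i q') (fun l => upd V l0 (Y j \o i) l q')).
  apply: msmooth_big => [f g|j _]; first exact: msmoothD.
  apply: msmoothM => //; apply: IH => [|l lm|l ml]; first exact: ltnW.
    rewrite /upd; case: eqP => [ll0|_]; last by apply: VW; rewrite ltnS ltnW.
    by move: lm; rewrite ll0 /= ltnn.
  rewrite /upd; case: eqVneq => [_|ll0]; first by exists (Y j).
  by apply: VS; rewrite ltn_neqAle ml andbT; move: ll0; rewrite -val_eqE /= eq_sym.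
apply: near_eq_msmooth S1.
have VD : \forall q' \near q, forall l, V l q' \in D (i q').
  apply: near_forall => l.
  case: (ltnP l m.+1) => [lm|ml].
    by rewrite VW//; apply: filterS WD.
  have [S SD ->] := VS l ml.
  by apply: filterS (smooth_map_near iS SD) => q' [].
have YD : \forall q' \near q, forall j, Y j (i q') \in D (i q').
  apply: near_forall => j.
  by apply: filterS (smooth_map_near iS (YE j)) => q' [].
apply: filterS3 Wa VD YD => q' Waq VDq YDq.
have -> : (fun l => V l q') = upd (fun l => V l q') l0 (\sum_j a j q' *: Y j (i q')).
  by apply/funext => l; rewrite /upd; case: eqP => // ->; rewrite -Waq VW /=.
rewrite form_sum//; apply: eq_bigr => j _; congr (_ * phi _ _).
by apply/funext => l; rewrite /upd; case: ifP.
Unshelve. all: by end_near. Qed.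

Lemma leaf_pull_forms r (phi : cochain Z r) : forms D phi ->
  forms (fun=> fullv) (leaf_pull phi).
Proof.
move=> phiF; split.
- by move=> q v l; rewrite memvf.
- move=> q v l a u w _ _ _; rewrite !leaf_pullE.
  apply: (@form_linear _ _ _ _ _ _ phiF _ _ _ _ l) => [m||m ml|m ml|] /=.
  + exact: push_in.
  + exact: push_in.
  + by rewrite (negbTE ml).
  + by rewrite (negbTE ml).
  + by rewrite eqxx (push_linear iS).
- move=> q v l m lm vlm; rewrite leaf_pullE.
  by apply: (@form_alt _ _ _ _ _ _ phiF _ _ l m) => //; rewrite vlm.
- move=> U X oU XU; apply/(smooth_fun_onP _ oU) => q Uq.
  have S : msmooth q (fun q' => phi (i q') (fun l => pushi q' (X l q'))).
    apply: (form_along_msmooth (W := fun l q' => pushi q' (X l q'))) => //.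
      move=> l; apply: push_along.
      by have /(section_onP _ _ oU)/(_ q Uq)[] := XU l.
    by near=> q' => l; exact: push_in.
  by apply: near_eq_msmooth S; near=> q'; rewrite leaf_pullE.
Unshelve. all: by end_near. Qed.

(** Related fields differentiate functions compatibly with composition by [i], hence so do their
    commutators. *)
Lemma push_lie q (X X' : vfield F) (Y Y' : vfield Z) :
  vsmooth q X -> vsmooth q X' -> vsmooth (i q) Y -> vsmooth (i q) Y' ->
  (forall q, pushi q (X q) = Y (i q)) -> (forall q, pushi q (X' q) = Y' (i q)) ->
  pushi q (lie_br X X' q) = lie_br Y Y' (i q).
Proof.
move=> Xs X's Ys Y's XY XY'; apply: (@dv_inj _ _ Z (i q)) => f fs.
apply: etrans (dv_push iS _ fs) _.
apply: etrans (lie_br_dv Xs X's (msmooth_comp iS fs)) _.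
apply: etrans (esym (lie_br_dv Ys Y's fs)).
have rel (V V' : vfield F) (S S' : vfield Z) : vsmooth (i q) S' ->
    (forall q, pushi q (V q) = S (i q)) -> (forall q, pushi q (V' q) = S' (i q)) ->
    dv q (V q) (fun q' => dv q' (V' q') (f \o i)) =
    dv (i q) (S (i q)) (fun p => dv p (S' p) f).
  move=> S's VS VS'; rewrite -VS (dv_push iS _ (vsmooth_dv S's fs)).
  apply: near_eq_dv; apply: filterS (smooth_map_near iS (msmooth_near fs)) => q' fq'.
  by rewrite /= -VS' (dv_push iS _ fq').
by apply: (congr2 (fun x y : R => x - y)); exact: rel.
Qed.

Lemma leaf_pull_ce r (phi : cochain Z r) q (X : 'I_r.+1 -> vfield F)
    (Y : 'I_r.+1 -> vfield Z) : forms D phi ->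
  (forall b q, vsmooth q (X b)) -> (forall b, global_section D (Y b)) ->
  (forall b q, pushi q (X b q) = Y b (i q)) ->
  chevalley_eilenberg (leaf_pull phi) X q = chevalley_eilenberg phi Y (i q).
Proof.
move=> phiF Xs YD XY; rewrite !chevalley_eilenbergE.
have YG : section_germs D (i q) Y by move=> b; exact: global_section_germ.
have Ys b : vsmooth (i q) (Y b) := section_germ_vsmooth (YG b).
congr (_ + _).
  apply: eq_bigr => b _; congr (_ * _).
  rewrite -XY (dv_push iS _ (ce_fun_msmooth phiF b YG)).
  apply: near_eq_dv; near=> q'; rewrite /ce_fun /= leaf_pullE.
  by congr (phi _ _); apply/funext => m; rewrite XY.
apply: eq_bigr => b _; apply: eq_bigr => c _; congr (_ * _).
rewrite /ce_bracket leaf_pullE; congr (phi _ _); apply/funext => m.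
rewrite /ce_arg; case: ifP => _; last exact: XY.
by apply: push_lie => //; exact: XY.
Unshelve. all: by end_near. Qed.

Lemma leaf_pull_diff r (phi : cochain Z r) : forms D phi ->
  leaf_pull (ce_diff D phi) = ce_diff (fun=> fullv) (leaf_pull phi).
Proof.
move=> phiF; have DI := involutive_foliation D; have [dF dE] := ce_diffP DI phiF.
have pullF := leaf_pull_forms phiF; have FI := involutive_fullv F.
apply/esym/(ce_diff_unique FI) => //; first exact: leaf_pull_forms.
move=> X XF q.
(* Sections of the distribution through the pushed vectors at [i q]; their related fields agree with
   [X] at [q], which is enough by [ce_ext]. *)
have /choice[Y YP] : forall b, exists Y : vfield Z,
    global_section D Y /\ Y (i q) = pushi q (X b q).
  by move=> b; have [Y YD Yq] := global_section_through DI (push_in q (X b q)); exists Y.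
have YD b : global_section D (Y b) by case: (YP b).
have /choice[X' X'P] : forall b, exists X' : vfield F,
    (forall q, vsmooth q X') /\ forall q, pushi q (X' q) = Y b (i q).
  by move=> b; exact: related_field.
have X'Y b q' : pushi q' (X' b q') = Y b (i q') by case: (X'P b).
have X'q b : X' b q = X b q.
  by apply: (@push_inj q); rewrite X'Y; case: (YP b).
have X's b q' : vsmooth q' (X' b) by case: (X'P b).
have -> : chevalley_eilenberg (leaf_pull phi) X q = chevalley_eilenberg (leaf_pull phi) X' q.
  apply: (ce_ext FI pullF) => [b|b|b]; last by rewrite X'q.
    exact: global_section_germ.
  by near=> q'; split; [exact: X's|exact: memvf].
rewrite (leaf_pull_ce q phiF X's YD X'Y) -(dE _ YD) leaf_pullE.
by congr (ce_diff _ _ _ _); apply/funext => b; case: (YP b).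
Unshelve. all: by end_near. Qed.

End IntegralManifold.

(** * Complexes and cohomology *)

Section CohomologyOfComplexes.
Context (R : realType).
Implicit Types (K L P : complex R).

Local Notation coboundaries K r := (@coboundaries _ K r).
Local Notation cocycles K r := (@cocycles _ K r).

(** [complex] carries data only; these are the closure properties on which computing with cosets
    relies. *)
Record closed_complex K : Prop := ClosedComplex {
  cterm0 : forall r, cterm K r 0;
  cterm_linear : forall r (a : R) x y, cterm K r x -> cterm K r y -> cterm K r (a *: x + y);
  cdiff_term : forall r x, cterm K r x -> cterm K r.+1 (cdiff K r x);
  cdiff_linear : forall r, linear_on (cterm K r) (cdiff K r) }.

Lemma coboundary_term K r b : closed_complex K -> coboundaries K r b -> cterm K r b.
Proof.
move=> KC; case: r b => [|r] b /=; first by move=> ->; exact: cterm0.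
by case=> x Kx <-; exact: cdiff_term.
Qed.

Lemma linear_on0 (V W : lmodType R) (S : set V) (f : V -> W) :
  S 0 -> linear_on S f -> f 0 = 0.
Proof.
by move=> S0 /(_ (-1) 0 0 S0 S0); rewrite !scaleN1r addNr addNr.
Qed.

Lemma coboundary_linear K r (a : R) b b' : closed_complex K ->
  coboundaries K r b -> coboundaries K r b' -> coboundaries K r (a *: b + b').
Proof.
move=> KC; case: r b b' => [|r] b b' /=.
  by move=> -> ->; rewrite scaler0 addr0.
case=> x Kx <- [y Ky <-]; exists (a *: x + y); first exact: cterm_linear.
exact: cdiff_linear.
Qed.

Lemma coboundary0 K r : closed_complex K -> coboundaries K r 0.
Proof.
move=> KC; case: r => [//|r] /=; exists 0; first exact: cterm0.
by apply: linear_on0 (cdiff_linear KC (r := r)); exact: cterm0.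
Qed.

Lemma coboundaryD K r b b' : closed_complex K ->
  coboundaries K r b -> coboundaries K r b' -> coboundaries K r (b + b').
Proof. by move=> KC Kb Kb'; rewrite -[b]scale1r; exact: coboundary_linear. Qed.

Lemma coboundary_map K L (f : cmap K L) r b : closed_complex K -> closed_complex L ->
  cochain_morphism f -> coboundaries K r b -> coboundaries L r (f r b).
Proof.
move=> KC LC [ft fl fd _]; case: r b => [|r] b /=.
  by move=> ->; apply: linear_on0 (fl 0%N); exact: cterm0.
by case=> x Kx <-; exists (f r x); [exact: ft|rewrite fd].
Qed.

Definition coset K r x : set (cspace K r) := [set x + b | b in coboundaries K r].

(** Any representative may be used, because [f] sends coboundaries to coboundaries. *)
Lemma cohom_map_coset K L (f : cmap K L) r x : closed_complex K -> closed_complex L ->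
  cochain_morphism f -> cterm K r x -> cohom_map f r (coset x) = coset (f r x).
Proof.
move=> KC LC fm Kx; have [ft fl fd _] := fm.
have fD b : coboundaries K r b -> f r (x + b) = f r x + f r b.
  move=> /(coboundary_term KC) Kb.
  by have := fl r 1 x b Kx Kb; rewrite !scale1r.
rewrite eqEsubset; split=> [_ [_ [b Kb <-]] [c Lc <-]|_ [c Lc <-]].
  exists (f r b + c); last by rewrite fD// addrA.
  by apply: coboundaryD => //; exact: coboundary_map.
exists (x + 0); first by exists 0 => //; exact: coboundary0.
by exists c => //; rewrite addr0.
Qed.

Lemma lincomb_coset K r (a : R) x y : closed_complex K ->
  lincomb a (coset x) (coset y) = @coset K r (a *: x + y).
Proof.
move=> KC; rewrite eqEsubset; split=> [_ [_ [b Kb <-]] [_ [c Kc <-] <-]|_ [c Kc <-]].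
  exists (a *: b + c); first exact: coboundary_linear.
  by rewrite scalerDr addrACA.
exists (x + 0); first by exists 0 => //; exact: coboundary0.
by exists (y + c); [exists c|rewrite addr0 addrA].
Qed.

Lemma cocycle_map K L (f : cmap K L) r x : closed_complex K ->
  cochain_morphism f -> cocycles K r x -> cocycles L r (f r x).
Proof.
move=> KC [ft fl fd _] [Kx dx]; split; first exact: ft.
by rewrite -fd// dx; apply: linear_on0 (fl r.+1); exact: cterm0.
Qed.

Lemma cocycle_linear K r (a : R) x y : closed_complex K ->
  cocycles K r x -> cocycles K r y -> cocycles K r (a *: x + y).
Proof.
move=> KC [Kx dx] [Ky dy]; split; first exact: cterm_linear.
by rewrite (cdiff_linear KC)// dx dy scaler0 addr0.
Qed.

Lemma cohom_map_homomorphism K L (f : cmap K L) : closed_complex K -> closed_complex L ->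
  cochain_morphism f -> cohom_homomorphism (cohom_map f).
Proof.
move=> KC LC fm r; split=> [_ [x Kx <-]|a _ _ [x Kx <-] [y Ky <-]].
  rewrite cohom_map_coset//; last by case: Kx.
  by exists (f r x) => //; exact: cocycle_map.
rewrite lincomb_coset// !cohom_map_coset ?lincomb_coset//; try by case: Kx; case: Ky.
  by case: fm => _ fl _ _; rewrite fl//; [case: Kx|case: Ky].
by have [] := cocycle_linear a KC Kx Ky.
Qed.

Lemma cochain_morphism_comp K L P (g : cmap L P) (f : cmap K L) :
  closed_complex K -> cochain_morphism f -> cochain_morphism g ->
  cochain_morphism (cmap_comp g f).
Proof.
move=> KC [ft fl fd [fat fal fe]] [gt gl gd [gat gal ge]]; split.
- by move=> r x Kx; apply/gt/ft.
- by move=> r a x y Kx Ky /=; rewrite fl// gl//; exact: ft.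
- by move=> r x Kx /=; rewrite fd// gd//; exact: ft.
- split=> [s Ks|a s t Ks Kt|s Ks] /=; first exact/gat/fat.
    by rewrite fal// gal//; exact: fat.
  by rewrite fe// ge//; exact: fat.
Qed.

(** The maps agree on the terms only, so closure of the terms under the operations involved must be
    known. *)
Lemma cochain_morphism_eq K L (f g : cmap K L) : closed_complex K -> 
  (forall s, caug K s -> cterm K 0 (ceps K s)) ->
  (forall (a : R) s t, caug K s -> caug K t -> caug K (a *: s + t)) ->
  cmap_eq f g -> cochain_morphism g -> cochain_morphism f.
Proof.
move=> KC epsK augK [fg fga] [gt gl gd [gat gal ge]]; split.
- by move=> r x Kx; rewrite fg//; exact: gt.
- by move=> r a x y Kx Ky; rewrite !fg//; [exact: gl|exact: cterm_linear].
- by move=> r x Kx; rewrite !fg//; [exact: gd|exact: cdiff_term].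
- split=> [s Ks|a s t Ks Kt|s Ks].
  + by rewrite fga//; exact: gat.
  + by rewrite !fga//; [exact: gal|exact: augK].
  + by rewrite fg ?fga ?ge//; exact: epsK.
Qed.

Lemma cohom_map_comp K L P (h : cmap K P) (g : cmap L P) (f : cmap K L) r A :
  closed_complex K -> closed_complex L -> closed_complex P ->
  cochain_morphism f -> cochain_morphism g -> cochain_morphism h ->
  cmap_eq h (cmap_comp g f) -> cohomology K r A ->
  cohom_map h r A = cohom_map g r (cohom_map f r A).
Proof.
move=> KC LC PC fm gm hm [hgf _] [x [Kx _] <-].
rewrite !cohom_map_coset ?hgf//.
by case: fm => ft _ _ _; exact: ft.
Qed.

Lemma closed_complex_forms (n : nat) (M : manifold R n) (E : M -> {vspace 'rV[R]_n})
    (A : lmodType R) (S : set A) eps : involutive_subbundle E ->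
  closed_complex (@Complex R (fun r => cochain M r : lmodType R) (@forms R n M E)
    (@ce_diff R n M E) A S eps).
Proof.
move=> EI; split=> /= r.
- exact: forms0.
- by move=> a x y; exact: forms_linear.
- by move=> x xF; have [] := ce_diffP EI xF.
- by move=> a x y xF yF; exact: ce_diff_linear.
Qed.

End CohomologyOfComplexes.

(** A leafwise constant function is constant on the leaf, and its value at [q0] is that real
    number. *)
Definition leaf_map (R : realType) (n k : nat) (Z : manifold R n) (D : foliation Z k)
    (F : manifold R k) (i : F -> Z) (q0 : F) : cmap (leafwise_deRham D) (deRham F) :=
  @CMap R (leafwise_deRham D) (deRham F) (fun r phi => leaf_pull i phi)
    (fun f => f (i q0)).

Lemma leaf_map_cochain_morphism (R : realType) (n k : nat) (Z : manifold R n)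
    (D : foliation Z k) (F : manifold R k) (i : F -> Z) (q0 : F) :
  is_leaf D i -> cochain_morphism (leaf_map D i q0).
Proof.
move=> iL; have iI : integral_manifold D i by case: iL.
split=> /=.
- by move=> r phi; exact: leaf_pull_forms.
- by [].
- by move=> r phi; exact: leaf_pull_diff.
- split=> // f [_ fc]; apply/funext => q; apply/funext => v.
  exact: fc iL _ _.
Qed.

Theorem proposition1 (R : realType) (n k : nat) (Z : manifold R n)
    (D : foliation Z k) (F : manifold R k) (i : F -> Z) (hi : is_leaf D i) :
  cochain_morphism (pullback i) /\
  cochain_morphism (leafwise_restriction D) /\
  exists g : cmap (leafwise_deRham D) (deRham F),
    cochain_morphism g /\
    cmap_eq (pullback i) (cmap_comp g (leafwise_restriction D)) /\
    cohom_homomorphism (cohom_map (pullback i)) /\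
    cohom_homomorphism (cohom_map (leafwise_restriction D)) /\
    cohom_homomorphism (cohom_map g) /\
    forall (r : nat) (A : set (cspace (deRham Z) r)),
      cohomology (deRham Z) r A ->
      cohom_map (pullback i) r A =
      cohom_map g r (cohom_map (leafwise_restriction D) r A).
Proof.
have [q0 _] := @manifold_nonempty _ _ F.
have iI : integral_manifold D i by case: hi.
have ZC : closed_complex (deRham Z).
  exact: closed_complex_forms (involutive_fullv Z).
have FC : closed_complex (deRham F).
  exact: closed_complex_forms (involutive_fullv F).
have DC : closed_complex (leafwise_deRham D).
  exact: closed_complex_forms (involutive_foliation D).
have rm := restriction_cochain_morphism D.
pose g := leaf_map D i q0.
have gm : cochain_morphism g by exact: leaf_map_cochain_morphism.
(* Pushed vectors lie in the distribution, so the default value 0 of the restriction is never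
   met. *)
have eq_comp : cmap_eq (pullback i) (cmap_comp g (leafwise_restriction D)).
  split=> // r omega _; apply/funext => q; apply/funext => v /=.
  rewrite /leaf_pull; case: ifPn => // /forallPn[m].
  by rewrite -pushE (push_in iI).
(* That pull-back commutes with the differentials is read off from the factorization. *)
have pm : cochain_morphism (pullback i).
  apply: (cochain_morphism_eq ZC _ _ eq_comp) => //.
    move=> c _; split=> [p v []|p v []|p v []|U X oU _] //.
    by apply/(smooth_fun_onP _ oU) => p _; exact: msmooth_cst.
  exact: cochain_morphism_comp.
split; first exact: pm.
split; first exact: rm.
exists g; split; first exact: gm.
split; first exact: eq_comp.
split; first exact: cohom_map_homomorphism.
split; first exact: cohom_map_homomorphism.
split; first exact: cohom_map_homomorphism.
by move=> r A; exact: (cohom_map_comp ZC DC FC).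
Qed.
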